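(* Let $f\in L^1(\mathbb{R}^2,\mathbb{H})$ and $(x_0,y_0)\in\mathbb{R}^2$. Suppose that in a cross-neighborhood of $(x_0,y_0)$ the function $f$ is a quaternion bounded variation function (QBVF) and belongs to $\mathbf{LC}$. Let $\mathcal{F}_T(u,v)=\int_{\mathbb{R}^2}e^{-\mathbf{i}us}f(s,t)e^{-\mathbf{j}vt}\,ds\,dt$ be the two-sided quaternion Fourier transform of $f$. Then $$\eta(x_0,y_0)=\lim_{N\to\infty,\,M\to\infty}\frac{1}{4\pi^2}\int_{-N}^{N}\int_{-M}^{M}e^{\mathbf{i}ux_0}\mathcal{F}_T(u,v)e^{\mathbf{j}vy_0}\,du\,dv,$$ where $$\eta(x_0,y_0)=\frac{f(x_0+0,y_0+0)+f(x_0+0,y_0-0)+f(x_0-0,y_0+0)+f(x_0-0,y_0-0)}{4}.$$ If moreover $f$ is continuous at $(x_0,y_0)$, then $\eta(x_0,y_0)=f(x_0,y_0)$.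
   Context: $\mathbb{H}$ is the algebra of quaternions $q=q_0+\mathbf{i}q_1+\mathbf{j}q_2+\mathbf{k}q_3$ ($q_n\in\mathbb{R}$) with $\mathbf{i}^2=\mathbf{j}^2=\mathbf{k}^2=-1$, $\mathbf{i}\mathbf{j}=-\mathbf{j}\mathbf{i}=\mathbf{k}$, $\mathbf{j}\mathbf{k}=-\mathbf{k}\mathbf{j}=\mathbf{i}$, $\mathbf{k}\mathbf{i}=-\mathbf{i}\mathbf{k}=\mathbf{j}$, and modulus $|q|=(q_0^2+q_1^2+q_2^2+q_3^2)^{1/2}$; $e^{\mathbf{i}\theta}=\cos\theta+\mathbf{i}\sin\theta$ and likewise for $\mathbf{j}$. $L^1(\mathbb{R}^2,\mathbb{H})$ is the space of $f:\mathbb{R}^2\to\mathbb{H}$ with $\int_{\mathbb{R}^2}|f|\,ds\,dt<\infty$; integrals are taken componentwise. One-sided limits: $f(x_0\pm0,y_0\pm0)=\lim_{h\to0^+,k\to0^+}f(x_0\pm h,y_0\pm k)$ (all four sign combinations, double limits). In the double integral $u\in[-M,M]$, $v\in[-N,N]$, and $M,N\to\infty$ independently. Bounded variation: a real function $f$ on a rectangle $[a_1,b_1]\times[a_2,b_2]$ is a bounded variation function (BVF) if (i) the sums $\sum_{i=0}^{m-1}\sum_{j=0}^{n-1}|f(s_{i+1},t_{j+1})-f(s_{i+1},t_j)-f(s_i,t_{j+1})+f(s_i,t_j)|$ are bounded over all nets $a_1=s_0<\dots<s_m=b_1$, $a_2=t_0<\dots<t_n=b_2$; (ii) for at least one $\tilde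 s\in[a_1,b_1]$, $f(\tilde s,\cdot)$ is of (one-dimensional) bounded variation on $[a_2,b_2]$; (iii) for at least one $\tilde t\in[a_2,b_2]$, $f(\cdot,\tilde t)$ is of bounded variation on $[a_1,b_1]$. A quaternionic function $f=f_0+\mathbf{i}f_1+\mathbf{j}f_2+\mathbf{k}f_3$ ($f_n$ real) is a QBVF if and only if each component $f_n$, $n=0,1,2,3$, is a BVF. Cross-neighborhood: for $\varepsilon_1,\varepsilon_2>0$, the set of points $(s,t)$ with $|s-x_0|\le\varepsilon_1$ or $|t-y_0|\le\varepsilon_2$ (or both). A function is a BVF (QBVF) in this set if its restriction to each closed bounded rectangle contained in it is. Class $\mathbf{LC}$: put $\tilde f(s,t)=f(x_0-s,y_0-t)+f(x_0+s,y_0+t)+f(x_0-s,y_0+t)+f(x_0+s,y_0-t)$, $\mathbb{A}=\{s\in\mathbb{R}:\int_{\mathbb{R}}|\tilde f(s,t)|dt<\infty\}$, $\mathbb{B}=\{t\in\mathbb{R}:\int_{\mathbb{R}}|\tilde f(s,t)|ds<\infty\}$. Then $f$ belongs to $\mathbf{LC}$ in the cross-neighborhood of $(x_0,y_0)$ with parameters $\varepsilon_1,\varepsilon_2$ if for some $a\in\mathbb{A}$, $b\in\mathbb{B}$ $$\int_{\varepsilon_2}^{\infty}\int_0^{\varepsilon_1}\left|\frac{\tilde f(s,t)-\tilde f(a,t)}{s}\right|ds\,dt<\infty,\qquad \int_{\varepsilon_1}^{\infty}\int_0^{\varepsilon_2}\left|\frac{\tilde f(s,t)-\tilde f(s,b)}{t}\right|dt\,ds<\infty.$$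 *)

(* Defs.v *)
From HB Require Import structures.
From mathcomp Require Import all_boot all_order all_algebra.
From mathcomp Require Import all_classical all_reals all_analysis.
From mathcomp Require Import ring.

Set Implicit Arguments.
Unset Strict Implicit.
Unset Printing Implicit Defensive.

Import Order.TTheory GRing.Theory Num.Theory.
Import numFieldNormedType.Exports.

Local Open Scope classical_set_scope.
Local Open Scope ring_scope.

(* The carrier of the quaternions is R^4, with the library's addition, real
   scaling and topology.  The library's norm `|q| on row vectors is the sup
   norm; the quaternion modulus is [qmod]. *)
Notation quat R := 'rV[R]_4.

Definition Quat {R : realType} (a b c d : R) : quat R :=
  \row_(n < 4) [:: a; b; c; d]`_n.

Definition qre {R : realType} (q : quat R) : R := q 0 (inord 0).
Definition qi {R : realType} (q : quat R) : R := q 0 (inord 1).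
Definition qj {R : realType} (q : quat R) : R := q 0 (inord 2).
Definition qk {R : realType} (q : quat R) : R := q 0 (inord 3).

Definition qmul {R : realType} (p q : quat R) : quat R :=
  Quat (qre p * qre q - qi p * qi q - qj p * qj q - qk p * qk q)
       (qre p * qi q + qi p * qre q + qj p * qk q - qk p * qj q)
       (qre p * qj q - qi p * qk q + qj p * qre q + qk p * qi q)
       (qre p * qk q + qi p * qj q - qj p * qi q + qk p * qre q).

Notation "p *q q" := (qmul p q) (at level 40, left associativity).

Definition qmod {R : realType} (q : quat R) : R :=
  Num.sqrt (\sum_(n < 4) q 0 n ^+ 2).

Definition expi {R : realType} (x : R) : quat R := Quat (cos x) (sin x) 0 0.
Definition expj {R : realType} (x : R) : quat R := Quat (cos x) 0 (sin x) 0.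

Lemma qreE (R : realType) (a b c d : R) : qre (Quat a b c d) = a.
Proof. by rewrite /qre mxE inordK. Qed.

Lemma qiE (R : realType) (a b c d : R) : qi (Quat a b c d) = b.
Proof. by rewrite /qi mxE inordK. Qed.

Lemma qjE (R : realType) (a b c d : R) : qj (Quat a b c d) = c.
Proof. by rewrite /qj mxE inordK. Qed.

Lemma qkE (R : realType) (a b c d : R) : qk (Quat a b c d) = d.
Proof. by rewrite /qk mxE inordK. Qed.

Lemma quat_mult_table (R : realType) (one := Quat 1 0 0 0 : quat R)
    (i := Quat 0 1 0 0 : quat R) (j := Quat 0 0 1 0 : quat R)
    (k := Quat 0 0 0 1 : quat R) :
  [/\ [/\ i *q i = - one, j *q j = - one & k *q k = - one],
      [/\ i *q j = k, j *q k = i & k *q i = j],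
      [/\ j *q i = - k, k *q j = - i & i *q k = - j] &
      forall q, one *q q = q /\ q *q one = q].
Proof.
have QN a b c d : - Quat a b c d = Quat (- a) (- b) (- c) (- d) :> quat R.
  by apply/rowP => -[[|[|[|[|//]]]] ?]; rewrite !mxE.
have QE (q : quat R) : Quat (qre q) (qi q) (qj q) (qk q) = q.
  apply/rowP => n; rewrite mxE /qre /qi /qj /qk.
  by case: n => -[|[|[|[|//]]]] ? /=; congr (q 0 _); apply/val_inj;
    rewrite /= inordK.
rewrite /one /i /j /k; do !split; try move=> q;
  rewrite /qmul ?QN ?(qreE, qiE, qjE, qkE);
  try (by congr Quat; ring); by rewrite -[RHS]QE; congr Quat; ring.
Qed.

Definition qintegral {d} {T : measurableType d} {R : realType}
    (mu : {measure set T -> \bar R}) (D : set T) (F : T -> quat R) : quat R :=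
  \row_n Rintegral mu D (fun x => F x 0 n).

Notation leb1 := (@lebesgue_measure _).
Notation leb2 := (leb1 \x leb1)%E.

(* The library's measurable sets of R and R * R are the Borel sets; a function
   is Lebesgue measurable iff it agrees almost everywhere with a Borel one.  On
   such functions the library's integral is the Lebesgue integral. *)
Definition L1 {d} {T : measurableType d} {R : realType}
    (mu : {measure set T -> \bar R}) (f : T -> quat R) : Prop :=
  (exists g : T -> quat R,
    (forall n : 'I_4, measurable_fun [set: T] (fun x => g x 0 n)) /\
    {ae mu, forall x, f x = g x}) /\
  (\int[mu]_x (qmod (f x))%:E < +oo)%E.

Definition QFT {R : realType} (f : R * R -> quat R) (u v : R) : quat R :=
  qintegral leb2 [set: R * R]
    (fun p => expi (- (u * p.1)) *q f p *q expj (- (v * p.2))).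

Definition QFT_inversion {R : realType} (f : R * R -> quat R) (x0 y0 M N : R)
    : quat R :=
  (4 * pi ^+ 2)^-1 *:
  qintegral leb1 `[- N, N] (fun v =>
    qintegral leb1 `[- M, M] (fun u =>
      expi (u * x0) *q QFT f u v *q expj (v * y0))).

Definition variation2 {R : realType} (a1 b1 a2 b2 : R) (g : R * R -> R)
    (s t : seq R) : R :=
  let S := nth b1 (a1 :: s) in
  let T := nth b2 (a2 :: t) in
  \sum_(0 <= i < size s) \sum_(0 <= j < size t)
    `|g (S i.+1, T j.+1) - g (S i.+1, T j) - g (S i, T j.+1) + g (S i, T j)|.

Definition BVF {R : realType} (a1 b1 a2 b2 : R) (g : R * R -> R) : Prop :=
  [/\ exists B : R, forall s t : seq R,
        itv_partition a1 b1 s -> itv_partition a2 b2 t ->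
        variation2 a1 b1 a2 b2 g s t <= B,
      exists2 s0, s0 \in `[a1, b1] &
        bounded_variation a2 b2 (fun t => g (s0, t)) &
      exists2 t0, t0 \in `[a2, b2] &
        bounded_variation a1 b1 (fun s => g (s, t0))].

Definition QBVF {R : realType} (a1 b1 a2 b2 : R) (f : R * R -> quat R) : Prop :=
  forall n : 'I_4, BVF a1 b1 a2 b2 (fun p => f p 0 n).

Definition cross_nbhd {R : realType} (x0 y0 e1 e2 : R) : set (R * R) :=
  [set p | `|p.1 - x0| <= e1 \/ `|p.2 - y0| <= e2].

Definition QBVF_in {R : realType} (C : set (R * R)) (f : R * R -> quat R)
    : Prop :=
  forall a1 b1 a2 b2 : R, a1 < b1 -> a2 < b2 ->
    `[a1, b1] `*` `[a2, b2] `<=` C -> QBVF a1 b1 a2 b2 f.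

Section LC.
Context {R : realType}.
Variables (f : R * R -> quat R) (x0 y0 : R).

Definition symm (s t : R) : quat R :=
  f (x0 - s, y0 - t) + f (x0 + s, y0 + t)
  + f (x0 - s, y0 + t) + f (x0 + s, y0 - t).

Definition LC_A : set R := [set s | L1 leb1 (fun t => symm s t)].
Definition LC_B : set R := [set t | L1 leb1 (fun s => symm s t)].

(* The null set s = 0 (resp. t = 0) is left out because 0^-1 = 0 here. *)
Definition LC (e1 e2 : R) : Prop :=
  exists a b : R, [/\ LC_A a, LC_B b,
    (\int[leb1]_(t in `[e2, +oo[) \int[leb1]_(s in `]0%R, e1])
        (qmod (s^-1 *: (symm s t - symm a t)))%:E < +oo)%E &
    (\int[leb1]_(s in `[e1, +oo[) \int[leb1]_(t in `]0%R, e2])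
        (qmod (t^-1 *: (symm s t - symm s b)))%:E < +oo)%E].
End LC.

Section eta.
Context {R : realType}.
Variables (f : R * R -> quat R) (x0 y0 : R).

Definition lim_pp : quat R := lim (f @ filter_prod x0^'+ y0^'+).
Definition lim_pm : quat R := lim (f @ filter_prod x0^'+ y0^'-).
Definition lim_mp : quat R := lim (f @ filter_prod x0^'- y0^'+).
Definition lim_mm : quat R := lim (f @ filter_prod x0^'- y0^'-).

(* [lim] is a total function: the average below is meaningful only under this
   predicate. *)
Definition quadrant_limits_exist : Prop :=
  [/\ cvg (f @ filter_prod x0^'+ y0^'+), cvg (f @ filter_prod x0^'+ y0^'-),
      cvg (f @ filter_prod x0^'- y0^'+) & cvg (f @ filter_prod x0^'- y0^'-)].

Definition eta : quat R := 4^-1 *: (lim_pp + lim_pm + lim_mp + lim_mm).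
End eta.

(* Main.v *)
From HB Require Import structures.
Require Import Defs.
From mathcomp Require Import all_boot all_order all_algebra.
From mathcomp Require Import all_classical all_reals all_analysis.
From mathcomp Require Import measurable_realfun.
From mathcomp Require Import ring lra.

(** Let [K_M(x) = sin(M x)/x].  Multiplied by exp(i u x0) on the left and by
    exp(j v y0) on the right, the transform becomes the integral of
    exp(-i u (s - x0)) f(s, t) exp(-j v (t - y0)).  Integrating in [u] over [-M, M]
    and in [v] over [-N, N] under the integral sign kills the sines, and with them
    all the terms in which i and j multiply f; what remains, in each of the
    four components g of f ([QFT_inversionE]), is the real integral
    [pi^-2 \int\int g(s, t) K_M(s - x0) K_N(t - y0) ds dt].  From here on everything
    is real.  The kernels are even, so this is an integral over the
    quadrant ]0, oo[ x ]0, oo[ of the symmetrization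
    [H(s, t) = g(x0-s, y0-t) + g(x0+s, y0+t) + g(x0-s, y0+t) + g(x0+s, y0-t)]
    ([Rintegral_fold2]), which is cut at s = e1 and t = e2 ([quadrant_cvg]).

    Far from both axes, H(s, t)/(s t) is integrable, and the Riemann-Lebesgue lemma
    makes the contribution vanish ([far_region]).  Near one axis only, the class LC
    says that (H(s, t) - H(a, t))/s is integrable; the remaining term H(a, t) does
    not depend on s and leads to a bounded integral of K_M times an integral in t
    that the Riemann-Lebesgue lemma sends to 0 ([mixed_region]).

    Near the origin H has bounded variation.  In one variable, the Dirichlet-Jordan
    theorem gives [\int_0^b h(t) K_N(t) dt --> (pi/2) h(0+)]: the second mean
    value theorem ([norm_Rintegral_dominated]) together with the boundedness of all
    the integrals of K_N controls the part where the variation of h is small.  The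
    argument only uses a bound on the variation, so it applies uniformly to a family
    h_M ([dirichlet_jordan_family]).  The functions
    [h_M(t) = \int_0^a H(s, t) K_M(s) ds] form such a family, because the variation
    on the rectangle makes t |-> H(., t) a curve of bounded variation in the space
    of functions of bounded variation ([BVF_curve], [BV_curve]).  Hence the
    contribution tends to (pi/2)^2 times H(0+, 0+), with M and N independent
    ([dirichlet_jordan2]).  After division by pi^2 this is a quarter of the sum of
    the four quadrant limits, which exist by the same control of the variation
    ([BV_corner_cvg]).

    A member of [L1] is only almost everywhere equal to a Borel function.  The
    passage from f to a Borel representative rests on the fact that the integral is
    insensitive to null sets even for functions that are not measurable
    ([ae_eq_integral_any]), whereas bounded variation is a property of f itself,
    used pointwise in the limits. *)

Import Order.TTheory GRing.Theory Num.Theory.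
Import numFieldNormedType.Exports.
Set Implicit Arguments.
Unset Strict Implicit.
Unset Printing Implicit Defensive.
Local Open Scope classical_set_scope.
Local Open Scope ring_scope.

(** * Integrals of arbitrary functions and null sets *)
Section ae_integral.
Context d (T : measurableType d) (R : realType).
Variable m : {measure set T -> \bar R}.
Local Open Scope ereal_scope.
Import HBNNSimple.

Let sup_sintegral (f : T -> \bar R) := ereal_sup [set sintegral m h |
  h in [set h : {nnsfun T >-> R} | forall x, (h x)%:E <= f x]].

Let sup_sintegral_le f g : {ae m, forall x, f x = g x} ->
  (forall x, 0 <= g x) -> sup_sintegral f <= sup_sintegral g.
Proof.
move=> [N [mN N0 subN]] g0; apply: ge_ereal_sup => _ [h /= hf <-].
have mCN : measurable (~` N) by exact: measurableC.
have hE x : proj_nnsfun h mCN x = (h \_ (~` N)) x by rewrite mrestrict.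
apply: ereal_sup_ubound; exists (proj_nnsfun h mCN).
  move=> x; rewrite hE patchE; have [xN|xN] := boolP (x \in ~` N) => //.
  suff <- : f x = g x by [].
  by apply: contrapT => fgx; move: xN; rewrite inE; apply; exact: subN.
have sintE (k : {nnsfun T >-> R}) : sintegral m k = \int[m]_x (k x)%:E.
  by rewrite integral_nnsfun// patch_setT.
rewrite !sintE; apply: ge0_ae_eq_integral => //.
- exact/measurable_EFinP.
- exact/measurable_EFinP.
- by move=> x _; rewrite lee_fin.
- by move=> x _; rewrite lee_fin.
exists N; split => // x /= /not_implyP[_ hx]; apply: contrapT => xN; apply: hx.
by rewrite mindicE mem_set// mulr1.
Qed.

Let sup_sintegral_eq f g : {ae m, forall x, f x = g x} ->
  (forall x, 0 <= f x) -> (forall x, 0 <= g x) ->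
  sup_sintegral f = sup_sintegral g.
Proof.
move=> fg f0 g0; apply/eqP; rewrite eq_le !sup_sintegral_le//.
by apply: filterS fg => x ->.
Qed.

(** Modifying an arbitrary, possibly non-measurable, function on a null set does
    not change its integral: a simple function below the positive part stays
    below it, with the same integral, once it is cut off on the null set. *)
Lemma ae_eq_integral_any (D : set T) (f g : T -> \bar R) :
  {ae m, forall x, D x -> f x = g x} ->
  \int[m]_(x in D) f x = \int[m]_(x in D) g x.
Proof.
move=> fg; have {}fg : {ae m, forall x, (f \_ D) x = (g \_ D) x}.
  apply: filterS fg => x fgx; rewrite !patchE.
  by case: ifPn => // /set_mem /fgx.
rewrite /integral; congr (_ - _); apply: sup_sintegral_eq => //.
  by apply: filterS fg => x; rewrite funeposE/= => ->; rewrite funeposE.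
by apply: filterS fg => x; rewrite funenegE/= => ->; rewrite funenegE.
Qed.

End ae_integral.

Lemma ae_eq_Rintegral_any d (T : measurableType d) (R : realType)
    (m : {measure set T -> \bar R}) (D : set T) (f g : T -> R) :
  {ae m, forall x, D x -> f x = g x} ->
  \int[m]_(x in D) f x = \int[m]_(x in D) g x.
Proof.
move=> fg; congr fine; apply: ae_eq_integral_any.
by apply: filterS fg => x fgx Dx; rewrite fgx.
Qed.

Lemma ae_imply d (T : measurableType d) (R : realType)
    (m : {measure set T -> \bar R}) (P Q : T -> Prop) :
  (forall x, P x -> Q x) -> {ae m, forall x, P x} -> {ae m, forall x, Q x}.
Proof.
move=> PQ [N [mN N0 subN]]; exists N; split => // x nQ; apply: subN => /= Px.
by apply: nQ; exact: PQ.
Qed.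

Lemma ae_imply2 d (T : measurableType d) (R : realType)
    (m : {measure set T -> \bar R}) (P Q S : T -> Prop) :
  (forall x, P x -> Q x -> S x) ->
  {ae m, forall x, P x} -> {ae m, forall x, Q x} -> {ae m, forall x, S x}.
Proof. exact: filterS2. Qed.

Lemma ae_imply4 d (T : measurableType d) (R : realType)
    (m : {measure set T -> \bar R}) (P1 P2 P3 P4 S : T -> Prop) :
  (forall x, P1 x -> P2 x -> P3 x -> P4 x -> S x) ->
  {ae m, forall x, P1 x} -> {ae m, forall x, P2 x} ->
  {ae m, forall x, P3 x} -> {ae m, forall x, P4 x} -> {ae m, forall x, S x}.
Proof.
move=> PS h1 h2 h3 h4; apply: filterS2 (filterI h1 h2) (filterI h3 h4).
by move=> x [? ?] [? ?]; exact: PS.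
Qed.

(** * Integrable functions *)
Section integrable_bounds.
Context d (T : measurableType d) (R : realType).
Variable m : {measure set T -> \bar R}.
Implicit Types (D : set T) (f g : T -> R).

Lemma integrable_le D f g : measurable D -> measurable_fun D f ->
  m.-integrable D (EFin \o g) -> (forall x, D x -> `|f x| <= g x) ->
  m.-integrable D (EFin \o f).
Proof.
move=> mD mf ig fg; apply: (le_integrable mD) ig => //.
  exact/measurable_EFinP.
by move=> x Dx /=; rewrite lee_fin (le_trans (fg _ Dx))// ler_norm.
Qed.

Lemma integrable_addr D f g : measurable D -> m.-integrable D (EFin \o f) ->
  m.-integrable D (EFin \o g) -> m.-integrable D (EFin \o (fun x => f x + g x)).
Proof. by move=> mD fi gi; have := integrableD mD fi gi; apply: eq_integrable. Qed.

Lemma integrable_subr D f g : measurable D -> m.-integrable D (EFin \o f) ->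
  m.-integrable D (EFin \o g) -> m.-integrable D (EFin \o (fun x => f x - g x)).
Proof. by move=> mD fi gi; have := integrableB mD fi gi; apply: eq_integrable. Qed.

Lemma integrable_scaler D (c : R) f : measurable D -> m.-integrable D (EFin \o f) ->
  m.-integrable D (EFin \o (fun x => c * f x)).
Proof. by move=> mD fi; have := integrableZl mD c fi; apply: eq_integrable. Qed.

Lemma integrable_restrictr D f : measurable D -> m.-integrable D (EFin \o f) ->
  m.-integrable setT (EFin \o (f \_ D)).
Proof. by move=> mD fi; rewrite -restrict_EFin; exact/(integrable_mkcond _ mD). Qed.

Lemma integrable_mul_bounded D f g (M : R) : measurable D ->
  measurable_fun D g -> (forall x, D x -> `|g x| <= M) ->
  m.-integrable D (EFin \o f) ->
  m.-integrable D (EFin \o (fun x => f x * g x)).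
Proof.
move=> mD mg gM fi; have mf := measurable_int _ fi.
have : m.-integrable D (fun x => M%:E * `|(f x)%:E|)%E.
  exact/integrableZl/integrable_abse.
apply: le_integrable => //.
  by apply/measurable_EFinP/measurable_funM => //; exact/measurable_EFinP.
move=> x Dx /=; rewrite !lee_fin normrM mulrC.
by rewrite (le_trans _ (ler_norm _))// ler_wpM2r// gM.
Qed.

Lemma le_normr_Rintegral_bound D f g : measurable D ->
  m.-integrable D (EFin \o f) -> m.-integrable D (EFin \o g) ->
  (forall x, D x -> `|f x| <= g x) ->
  `|\int[m]_(x in D) f x| <= \int[m]_(x in D) g x.
Proof.
move=> mD fi gi fg; apply: (le_trans (le_normr_Rintegral _ _)) => //.
by apply: le_Rintegral => //; exact: integrable_norm.
Qed.

Lemma integrable_cst_fin D (c : R) : measurable D -> (m D < +oo)%E ->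
  m.-integrable D (EFin \o cst c).
Proof.
by move=> mD Dfin; apply: (measurable_bounded_integrable mD Dfin) => //; exists `|c|; split; [exact: num_real | move=> x cx y _; exact: ltW].
Qed.

Lemma integrable_bounded D f (M : R) : measurable D -> (m D < +oo)%E ->
  measurable_fun D f -> (forall x, D x -> `|f x| <= M) ->
  m.-integrable D (EFin \o f).
Proof.
move=> mD Dfin mf fM.
by apply: (@integrable_le _ _ (cst M)) => //; exact: integrable_cst_fin.
Qed.

Lemma le_normr_Rintegral_cst D f (M : R) : measurable D -> (m D < +oo)%E ->
  measurable_fun D f -> (forall x, D x -> `|f x| <= M) ->
  `|\int[m]_(x in D) f x| <= M * fine (m D).
Proof.
move=> mD Dfin mf fM; rewrite -Rintegral_cst//.
apply: le_normr_Rintegral_bound => //; last exact: integrable_cst_fin.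
exact: (integrable_bounded (M := M)).
Qed.

End integrable_bounds.

Section itv_measure.
Context {R : realType}.
Notation mu := (@lebesgue_measure R).

Lemma lebesgue_itv_lty (b0 b1 : bool) (a b : R) :
  (mu [set` Interval (BSide b0 a) (BSide b1 b)] < +oo)%E.
Proof. by rewrite lebesgue_measure_itv/=; case: ifP => //; rewrite -EFinD ltry. Qed.

Lemma fine_lebesgue_itv (b0 b1 : bool) (a b : R) : a <= b ->
  fine (mu [set` Interval (BSide b0 a) (BSide b1 b)]) = b - a.
Proof.
rewrite le_eqVlt => /predU1P[->|ab].
  by rewrite lebesgue_measure_itv/= lte_fin ltxx subrr.
by rewrite lebesgue_measure_itv/= lte_fin ab.
Qed.

Lemma Rintegral_itvoc_split (f : R -> R) (a b c : R) : a <= c -> c <= b ->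
  mu.-integrable `]a, b] (EFin \o f) ->
  \int[mu]_(x in `]a, b]) f x =
  \int[mu]_(x in `]a, c]) f x + \int[mu]_(x in `]c, b]) f x.
Proof.
move=> ac cb fi.
by rewrite -(Rintegral_itvB fi (x := c)) ?bnd_simp//; ring.
Qed.

End itv_measure.

(** * Product measure *)
Section product.
Context d1 d2 (T1 : measurableType d1) (T2 : measurableType d2) (R : realType).
Variables (m1 : {sigma_finite_measure set T1 -> \bar R})
          (m2 : {sigma_finite_measure set T2 -> \bar R}).

(** The measures of the sections of a null set of the product integrate to 0. *)
Lemma ae_prod2 (P : T1 * T2 -> Prop) : {ae (m1 \x m2)%E, forall p, P p} ->
  {ae m2, forall y, {ae m1, forall x, P (x, y)}}.
Proof.
move=> [N [mN N0 subN]].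
have mNy y : measurable (ysection N y) by exact: measurable_ysection.
have : (\int[m2]_y `|m1 (ysection N y)| = 0)%E.
  under eq_integral do rewrite gee0_abs//.
  rewrite -[LHS]/((m1 \x^ m2)%E N) -N0; apply/esym.
  by apply: product_measure_unique => //= *; rewrite product_measure2E.
move=> /ae_eq_integral_abs => /(_ measurableT (measurable_fun_ysection m1 mN)).
apply: filterS => y /= /(_ I) Ny0.
exists (ysection N y); split => // x /= nP.
by rewrite /ysection/= inE; exact: subN.
Qed.

Variables (A : set T1) (B : set T2).
Hypotheses (mA : measurable A) (mB : measurable B).

Let prod_restrict (f : T1 * T2 -> R) x y :
  ((EFin \o f) \_ (A `*` B)) (x, y) =
  if (x \in A) && (y \in B) then (f (x, y))%:E else 0%E.
Proof.
rewrite patchE /=; have [xA|xA] := boolP (x \in A); have [yB|yB] := boolP (y \in B).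
- by rewrite mem_set//; split; exact: set_mem.
- by rewrite memNset//; move=> [/= _ /mem_set]; apply/negP.
- by rewrite memNset//; move=> [/= /mem_set + _]; apply/negP.
- by rewrite memNset//; move=> [/= /mem_set + _]; apply/negP.
Qed.

Variable f : T1 * T2 -> R.
Hypothesis fi : (m1 \x m2)%E.-integrable (A `*` B) (EFin \o f).

Let mAB : measurable (A `*` B). Proof. exact: measurableX. Qed.
Let fi' : (m1 \x m2)%E.-integrable setT ((EFin \o f) \_ (A `*` B)).
Proof. exact/(integrable_mkcond _ mAB). Qed.

Let sectionG y : B y ->
  fubini_G m1 ((EFin \o f) \_ (A `*` B)) y = (\int[m1]_(x in A) (f (x, y))%:E)%E.
Proof.
move=> By; rewrite /fubini_G [RHS]integral_mkcond; apply: eq_integral => x _ /=.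
by rewrite prod_restrict patchE (mem_set By) andbT.
Qed.

Let sectionF x : A x ->
  fubini_F m2 ((EFin \o f) \_ (A `*` B)) x = (\int[m2]_(y in B) (f (x, y))%:E)%E.
Proof.
move=> Ax; rewrite /fubini_F [RHS]integral_mkcond; apply: eq_integral => y _ /=.
by rewrite prod_restrict patchE (mem_set Ax).
Qed.

Lemma ae_integrable_section2 :
  {ae m2, forall y, B y -> m1.-integrable A (EFin \o (fun x => f (x, y)))}.
Proof.
apply: (ae_imply _ (ae_integrable2 fi')) => y yi By.
apply/(integrable_mkcond _ mA); apply: eq_integrable yi => // x _.
by rewrite prod_restrict patchE (mem_set By) andbT.
Qed.

(** Fubini's theorem for the real-valued integral.  The inner integral has no
    meaning on the sections that are not integrable, but they form a null set. *)
Lemma Rintegral_prod2 :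
  \int[(m1 \x m2)%E]_(p in A `*` B) f p =
  \int[m2]_(y in B) \int[m1]_(x in A) f (x, y).
Proof.
rewrite /Rintegral integral_mkcond -integral21_prod_meas1//=.
congr fine; rewrite [RHS]integral_mkcond; apply: ae_eq_integral_any.
apply: (ae_imply _ ae_integrable_section2) => y yi _.
rewrite patchE; case: ifPn => yB.
  rewrite fineK; first by rewrite sectionG//; exact: set_mem.
  exact: integrable_fin_num (yi (set_mem yB)).
rewrite /fubini_G integral0_eq// => x _.
by rewrite prod_restrict (negbTE yB) andbF.
Qed.

Lemma Rintegral_prod1 :
  \int[(m1 \x m2)%E]_(p in A `*` B) f p =
  \int[m1]_(x in A) \int[m2]_(y in B) f (x, y).
Proof.
rewrite /Rintegral integral_mkcond -integral12_prod_meas1//=.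
congr fine; rewrite [RHS]integral_mkcond; apply: ae_eq_integral_any.
have := ae_integrable1 fi'; apply: filterS => x xi _.
rewrite patchE; case: ifPn => xA.
  rewrite fineK; first by rewrite sectionF//; exact: set_mem.
  suff: m2.-integrable B (fun y => (f (x, y))%:E) by exact: integrable_fin_num.
  apply/(integrable_mkcond _ mB); apply: eq_integrable xi => // y _.
  by rewrite prod_restrict patchE xA.
rewrite /fubini_F integral0_eq// => y _.
by rewrite prod_restrict (negbTE xA).
Qed.

Lemma integrable_Rintegral_section2 :
  m2.-integrable B (fun y => (\int[m1]_(x in A) f (x, y))%:E).
Proof.
have Gi : m2.-integrable setT (fubini_G m1 ((EFin \o f) \_ (A `*` B))).
  have mf := measurable_int _ fi'.
  apply/integrableP; split; first exact: (measurable_fubini_G fi').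
  have H := (@integrable21ltyP _ _ _ _ _ m1 m2 _ mf).1 fi'.
  apply: (le_lt_trans _ H).
  apply: ge0_le_integral => //.
  - by apply: measurableT_comp => //; exact: (measurable_fubini_G fi').
  - apply: (measurable_fun_fubini_tonelli_G (abse \o _)) => //=.
    exact: measurableT_comp.
  - by move=> y _; apply: le_abse_integral => //; exact: measurableT_comp.
have GiB := integrableS measurableT mB (@subsetT _ B) Gi.
apply: (le_integrable mB _ _ GiB).
  apply: (eq_measurable_fun (EFin \o (fine \o fubini_G m1 ((EFin \o f) \_ (A `*` B))))).
    by move=> y /set_mem By /=; rewrite sectionG.
  apply/measurable_EFinP/measurable_funTS; apply: measurableT_comp => //.
  exact: measurable_int Gi.
move=> y By /=; rewrite sectionG// /Rintegral.
by case: (integral _ _ _) => [r| |] //=; rewrite ?lexx// normr0 leey.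
Qed.

End product.

(** * Measure-preserving maps *)
Section measure_preserving.
Context d1 d2 (X : measurableType d1) (Y : measurableType d2) (R : realType).
Variables (m1 : {measure set X -> \bar R}) (m2 : {measure set Y -> \bar R}).
Variable phi : X -> Y.
Hypotheses (mphi : measurable_fun [set: X] phi)
           (pphi : forall A, measurable A -> m2 A = m1 (phi @^-1` A)).

Lemma ae_preimage (P : Y -> Prop) :
  {ae m2, forall y, P y} -> {ae m1, forall x, P (phi x)}.
Proof.
move=> [N [mN N0 subN]]; exists (phi @^-1` N); split.
- by rewrite -[X in measurable X]setTI; exact: mphi.
- by rewrite -pphi.
- by move=> x nP; exact: subN.
Qed.

Lemma integrable_comp_preserving (f : Y -> R) :
  m2.-integrable setT (EFin \o f) -> m1.-integrable setT (EFin \o (f \o phi)).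
Proof.
move=> /integrableP[mf fi]; apply/integrableP; split.
  exact: (measurableT_comp mf mphi).
have := @ge0_integral_pushforward _ _ _ _ R phi mphi m1 setT
  (fun y => `|(f y)%:E|)%E measurableT.
rewrite preimage_setT /= => H; rewrite -H//; last first.
  by apply: (@measurableT_comp _ _ _ _ _ _ abse) mf.
apply: le_lt_trans fi; rewrite le_eqVlt; apply/orP; left; apply/eqP.
by apply: eq_measure_integral => A mA _; exact/esym/pphi.
Qed.

Lemma Rintegral_comp_preserving (D : set Y) (f : Y -> R) : measurable D ->
  m2.-integrable setT (EFin \o f) ->
  \int[m2]_(y in D) f y = \int[m1]_(x in phi @^-1` D) f (phi x).
Proof.
move=> mD fi; have [mf _] := integrableP _ _ _ fi.
have fphi := integrable_comp_preserving fi.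
have mpD : measurable (phi @^-1` D).
  by rewrite -[X in measurable X]setTI; exact: mphi.
congr fine; rewrite -[RHS]/(\int[m1]_(x in phi @^-1` D) ((EFin \o f) \o phi) x)%E.
rewrite -(integral_pushforward mphi mf) //.
  by apply: eq_measure_integral => A mA _; exact: pphi.
by apply: integrableS fphi.
Qed.

End measure_preserving.

Section lebesgue_preserving.
Context {R : realType}.
Notation mu := (@lebesgue_measure R).
Notation mR := (measurableTypeR R).

Lemma lebesgue_translate (c : R) (A : set mR) : measurable A ->
  mu A = mu ((fun x => c + x) @^-1` A).
Proof.
have mphi : measurable_fun [set: mR] ((fun x => c + x) : mR -> mR).
  exact: measurable_funD.
apply: (@lebesgue_measure_unique R (pushforward mu
  ((fun x => c + x) : mR -> mR))) => _ [[a b] _ <-] /=.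
set L := (LHS); rewrite /pushforward {}/L; have -> : (fun x => c + x) @^-1` `]a, b]%classic =
    `]a - c, b - c]%classic.
  by apply/seteqP; split => x /=; rewrite !in_itv/= ltrBlDl lerBrDl.
by rewrite !lebesgue_measure_itv/= !lte_fin ltrD2r; case: ifP => // _;
  rewrite -!EFinD; congr EFin; ring.
Qed.

Lemma lebesgue_reflect (c : R) (A : set mR) : measurable A ->
  mu A = mu ((fun x => c - x) @^-1` A).
Proof.
have mphi : measurable_fun [set: mR] ((fun x => c - x) : mR -> mR).
  exact: measurable_funB.
apply: (@lebesgue_measure_unique R (pushforward mu
  ((fun x => c - x) : mR -> mR))) => _ [[a b] _ <-] /=.
set L := (LHS); rewrite /pushforward {}/L; have -> : (fun x => c - x) @^-1` `]a, b]%classic =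
    `[c - b, c - a[%classic.
  apply/seteqP; split => x /=; rewrite !in_itv/= => /andP[? ?];
    by apply/andP; split; lra.
rewrite !lebesgue_measure_itv/= !lte_fin ltrD2l ltrN2; case: ifP => // _.
by rewrite -!EFinD; congr EFin; ring.
Qed.

Definition lebesgue_preserving (u : mR -> mR) :=
  measurable_fun [set: mR] u /\
  forall A : set mR, measurable A -> mu A = mu (u @^-1` A).

Lemma lebesgue_preserving_translate c :
  lebesgue_preserving ((fun x => c + x) : mR -> mR).
Proof. by split; [exact: measurable_funD|exact: lebesgue_translate]. Qed.

Lemma lebesgue_preserving_reflect c :
  lebesgue_preserving ((fun x => c - x) : mR -> mR).
Proof. by split; [exact: measurable_funB|exact: lebesgue_reflect]. Qed.

Section product_map.
Variables u v : mR -> mR.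
Hypotheses (pu : lebesgue_preserving u) (pv : lebesgue_preserving v).
Let uv (p : mR * mR) : mR * mR := (u p.1, v p.2).

Lemma measurable_pair_map : measurable_fun [set: mR * mR] uv.
Proof.
by apply/measurable_fun_pairP; split;
  [apply: (measurableT_comp pu.1); exact: measurable_fst
  |apply: (measurableT_comp pv.1); exact: measurable_snd].
Qed.

Lemma lebesgue2_pair_map (A : set (mR * mR)) : measurable A ->
  (mu \x mu)%E A = (mu \x mu)%E (uv @^-1` A).
Proof.
have mphi := measurable_pair_map.
rewrite -[RHS]/(pushforward (mu \x mu)%E uv A).
move: A; apply: product_measure_unique => // A B mA mB.
transitivity ((mu \x mu)%E (uv @^-1` (A `*` B))) => //.
have -> : uv @^-1` (A `*` B) = (u @^-1` A) `*` (v @^-1` B) by [].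
rewrite product_measure1E//.
- by have [_ hu] := pu; have [_ hv] := pv; congr (_ * _)%E; apply/esym;
    [exact: hu|exact: hv].
- by rewrite -[X in measurable X]setTI; exact: pu.1.
- by rewrite -[X in measurable X]setTI; exact: pv.1.
Qed.

End product_map.

Let swap (p : mR * mR) : mR * mR := (p.2, p.1).

Lemma lebesgue2_swap (A : set (mR * mR)) : measurable A ->
  (mu \x mu)%E A = (mu \x mu)%E (swap @^-1` A).
Proof.
have mphi : measurable_fun [set: mR * mR] swap.
  by apply/measurable_fun_pairP; split; [exact: measurable_snd|exact: measurable_fst].
rewrite -[RHS]/(pushforward (mu \x mu)%E swap A).
move: A; apply: product_measure_unique => // A B mA mB.
transitivity ((mu \x mu)%E (swap @^-1` (A `*` B))) => //.
have -> : swap @^-1` (A `*` B) = B `*` A.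
  by apply/seteqP; split => -[x y] [].
by rewrite product_measure1E// muleC.
Qed.

End lebesgue_preserving.

(** * Bounded variation and oscillating kernels *)
Section second_mean_value.
Context {R : realType}.
Notation mu := (@lebesgue_measure R).
Notation mR := (measurableTypeR R).
Implicit Types (a b c B C V : R) (h k phi D : R -> R).

Definition nondecreasing_in a b (k : R -> R) :=
  forall x y, a < x -> x <= y -> y <= b -> k x <= k y.

(** The function [phi] plays the part of the total variation of [h], counted
    from an arbitrary origin.  This form of bounded variation on the half-open
    interval is stable under sums and pointwise limits without any manipulation
    of partitions. *)
Definition dominated a b (h phi : R -> R) :=
  forall x y, a < x -> x <= y -> y <= b -> `|h y - h x| <= phi y - phi x.

(** The superlevel sets are intervals. *)
Lemma nondecreasing_in_measurable a b k : nondecreasing_in a b k ->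
  measurable_fun (`]a, b]%classic : set mR) k.
Proof.
move=> kmono; apply: (measurability (@RGenCInfty.G R)) => [|/= _ [_] [r] -> <-].
  exact: RGenCInfty.measurableE.
apply: is_interval_measurable => s t [/=].
rewrite !in_itv/= !andbT => /andP[as_ sb] rs [/andP[at_ tb] rt] u /andP[su ut].
have au : a < u by exact: lt_le_trans su.
have ub : u <= b by exact: le_trans tb.
by split => /=; rewrite !in_itv/= ?au ?ub// andbT (le_trans rs)// kmono.
Qed.

Lemma dominated_measurable a b h phi : dominated a b h phi ->
  measurable_fun (`]a, b]%classic : set mR) h.
Proof.
move=> hphi; have -> : h = (fun x => (phi x + h x) - phi x).
  by apply/funext => x; rewrite addrAC subrr add0r.
apply: measurable_funB; apply: nondecreasing_in_measurable => x y ax xy yb.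
  have := hphi _ _ ax xy yb; rewrite ler_norml => /andP[]; lra.
by rewrite -subr_ge0 (le_trans _ (hphi _ _ ax xy yb)).
Qed.

Lemma measurable_fun_fstX (A B : set mR) (g : R -> R) : measurable A -> measurable B ->
  measurable_fun A g -> measurable_fun (A `*` B) (fun p : mR * mR => g p.1).
Proof.
move=> mA mB mg; apply: (measurable_comp mA _ mg).
  by move=> _ [[x y] [/= Ax _] <-].
by apply: measurable_funTS; exact: measurable_fst.
Qed.

Lemma lebesgue2_itv_lty a b c d :
  ((mu \x mu)%E (`]a, b] `*` `]c, d]) < +oo)%E.
Proof. by rewrite product_measure1E// lte_mul_pinfty// ?ge0_fin_numE ?lebesgue_itv_lty. Qed.

Lemma lebesgue_itv1_null (c : R) : {ae mu, forall x, x != c}.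
Proof.
exists [set c]; split => //; first exact: lebesgue_measure_set1.
by move=> x /= /negP; rewrite negbK => /eqP.
Qed.

(** Up to its right end point, a superlevel set of a nonincreasing function is an
    initial segment of the interval. *)
Lemma Rintegral_level_set a b C k D y : a <= b ->
  nondecreasing_in a b (fun x => - k x) ->
  (forall c, a <= c -> c <= b -> `|\int[mu]_(x in `]a, c]) D x| <= C) ->
  `|\int[mu]_(x in `]a, b]) (D x * (if y < k x then 1 else 0))| <= C.
Proof.
move=> ab kmono DC.
pose S := [set x | x \in `]a, b] /\ y < k x].
have [c [ac cb cS]] : exists c, [/\ a <= c, c <= b &
    forall x, x \in `]a, b] -> x != c -> (y < k x) = (x <= c)].
  have [[s Ss]|S0] := pselect (S !=set0); last first.
    exists a; split => // x xab _; apply/idP/idP => [yk|].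
      by exfalso; apply: S0; exists x.
    by move: xab; rewrite in_itv/= => /andP[ax _]; rewrite leNgt ax.
  have Sub : has_sup S.
    split; first by exists s.
    by exists b => x [/=]; rewrite in_itv/= => /andP[].
  have cub x : S x -> x <= sup S by move=> Sx; exact: ub_le_sup Sub.2 _ Sx.
  have [/=] := Ss; rewrite in_itv/= => /andP[as_ sb] _.
  exists (sup S); split.
  - by rewrite (le_trans (ltW as_))// cub.
  - by apply: ge_sup; [exists s|move=> x [/=]; rewrite in_itv/= => /andP[]].
  - move=> x xab xc; apply/idP/idP => [yk|xle]; first exact: cub.
    have xlt : x < sup S by rewrite lt_neqAle xc.
    have [t [tab yt] xt] := sup_gt (ex_intro _ s Ss) xlt.
    move: xab tab; rewrite !in_itv/= => /andP[ax _] /andP[_ tb].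
    by rewrite (lt_le_trans yt)// -lerN2 kmono// ltW.
have -> : \int[mu]_(x in `]a, b]) (D x * (if y < k x then 1 else 0)) =
    \int[mu]_(x in `]a, c]) D x; last exact: DC.
have -> : `]a, c]%classic = `]a, b]%classic `&` `]a, c]%classic.
  apply/esym/setIidr; apply: subset_itvl; rewrite bnd_simp//.
rewrite [RHS]Rintegral_mkcondr; apply: ae_eq_Rintegral_any.
apply: (ae_imply _ (lebesgue_itv1_null c)) => x xc xab.
rewrite patchE cS//; move: xab => /=; rewrite in_itv/= => /andP[ax xb].
have -> : (x \in `]a, c]%classic) = (x <= c).
  by apply/idP/idP => [/set_mem/=|xc']; [|apply/mem_set => /=];
    rewrite in_itv/= ax.
by case: ifP; rewrite ?mulr1 ?mulr0.
Qed.

(** The second mean value theorem as an inequality: the layer cake formula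
    [k x = \int_0^V 1_(y < k x) dy] and Fubini's theorem write [\int k D] as an
    integral over [0 < y <= V] of integrals of [D] over initial segments. *)
Lemma norm_Rintegral_nonincreasing a b C V B k D : a <= b -> 0 <= V ->
  nondecreasing_in a b (fun x => - k x) ->
  (forall x, x \in `]a, b] -> 0 <= k x <= V) ->
  measurable_fun (`]a, b]%classic : set mR) D ->
  (forall x, x \in `]a, b] -> `|D x| <= B) ->
  (forall c, a <= c -> c <= b -> `|\int[mu]_(x in `]a, c]) D x| <= C) ->
  `|\int[mu]_(x in `]a, b]) (k x * D x)| <= C * V.
Proof.
move=> ab V0 kmono kV mD DB DC.
have mk : measurable_fun (`]a, b]%classic : set mR) k.
  rewrite (_ : k = (fun x => - (- k x))); last by apply/funext => x; rewrite opprK.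
  by apply: measurable_funN; exact: nondecreasing_in_measurable.
pose F (p : mR * mR) : R := D p.1 * (if p.2 < k p.1 then 1 else 0).
have mF : measurable_fun (`]a, b] `*` `]0, V]) F.
  apply: measurable_funM; first exact: (measurable_fun_fstX (g := D)).
  apply: measurable_fun_if => //; first exact: measurableX.
  apply: measurable_fun_ltr; last exact: (measurable_fun_fstX (g := k)).
  by apply: measurable_funTS; exact: measurable_snd.
have Fi : (mu \x mu)%E.-integrable (`]a, b] `*` `]0, V]) (EFin \o F).
  apply: (integrable_bounded (M := B)) => //.
  - exact: measurableX.
  - exact: lebesgue2_itv_lty.
  - move=> -[x y] [/= xab _]; rewrite /F/=; case: ifP => _; first by rewrite mulr1 DB.
    by rewrite mulr0 normr0 (le_trans _ (DB _ xab)).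
have -> : \int[mu]_(x in `]a, b]) (k x * D x) =
    \int[mu]_(x in `]a, b]) \int[mu]_(y in `]0, V]) F (x, y).
  apply: eq_Rintegral => x /set_mem xab; have /andP[k0 kxV] := kV _ xab.
  rewrite /F/= RintegralZl//; last first.
    apply: (integrable_bounded (M := 1)) => //; first exact: lebesgue_itv_lty.
      apply: measurable_fun_if => //; apply: measurable_fun_ltr => //.
    by move=> y _; case: ifP; rewrite ?normr1 ?normr0.
  rewrite mulrC; congr (_ * _).
  transitivity (\int[mu]_(y in `]0, V] `&` `]-oo, k x[) (cst 1 y)).
    have -> : `]0, V]%classic `&` `]-oo, k x[%classic = `]0, k x[%classic.
      apply/seteqP; split => y /=; rewrite !in_itv/=.
        by move=> [/andP[-> _] ->].
      by move=> /andP[y0 yk]; rewrite y0 yk (le_trans (ltW yk)).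
    by rewrite Rintegral_cst// fine_lebesgue_itv// subr0 mul1r.
  rewrite Rintegral_mkcondr; apply: eq_Rintegral => y _; rewrite patchE.
  by rewrite mem_setE in_itv/=.
rewrite -Rintegral_prod1// Rintegral_prod2//.
rewrite -[leRHS]/(C * V) -[X in C * X]subr0 -(@fine_lebesgue_itv R false false 0 V)//.
rewrite -Rintegral_cst//; apply: le_normr_Rintegral_bound => //.
- exact: integrable_Rintegral_section2 Fi.
- by apply: integrable_cst_fin => //; exact: lebesgue_itv_lty.
- by move=> y _; exact: Rintegral_level_set.
Qed.

(** By the Jordan decomposition, the second mean value theorem extends to
    functions of bounded variation. *)
Lemma norm_Rintegral_dominated a b C V B h phi D : a <= b -> 0 <= V ->
  dominated a b h phi -> (forall x, x \in `]a, b] -> phi b - phi x <= V) ->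
  measurable_fun (`]a, b]%classic : set mR) D ->
  (forall x, x \in `]a, b] -> `|D x| <= B) ->
  (forall c, a <= c -> c <= b -> `|\int[mu]_(x in `]a, c]) D x| <= C) ->
  `|\int[mu]_(x in `]a, b]) (h x * D x)| <= C * (`|h b| + 2 * V).
Proof.
move=> ab V0 hphi phiV mD DB DC.
(* [h = h b - p + q], where [p] and [q] are nonincreasing and vanish at [b]. *)
pose p x := (phi b + h b) / 2 - (phi x + h x) / 2.
pose q x := (phi b - h b) / 2 - (phi x - h x) / 2.
have hE x : h x * D x = (h b * D x - p x * D x) + q x * D x.
  by rewrite /p /q; field.
have Di : mu.-integrable `]a, b] (EFin \o D).
  by apply: (integrable_bounded (M := B)) => //; exact: lebesgue_itv_lty.
have pmono : nondecreasing_in a b (fun x => - p x).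
  move=> x y ax xy yb; have := hphi _ _ ax xy yb; rewrite ler_norml /p => /andP[].
  lra.
have qmono : nondecreasing_in a b (fun x => - q x).
  move=> x y ax xy yb; have := hphi _ _ ax xy yb; rewrite ler_norml /q => /andP[].
  lra.
have pV x : x \in `]a, b] -> 0 <= p x <= V.
  move=> xab; have := phiV _ xab; move: xab; rewrite in_itv/= => /andP[ax xb].
  by have := hphi _ _ ax xb (lexx _); rewrite ler_norml /p => /andP[]; lra.
have qV x : x \in `]a, b] -> 0 <= q x <= V.
  move=> xab; have := phiV _ xab; move: xab; rewrite in_itv/= => /andP[ax xb].
  by have := hphi _ _ ax xb (lexx _); rewrite ler_norml /q => /andP[]; lra.
have ki k : nondecreasing_in a b (fun x => - k x) ->
    (forall x, x \in `]a, b] -> 0 <= k x <= V) ->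
    mu.-integrable `]a, b] (EFin \o (fun x => k x * D x)).
  move=> kmono kV; apply: (integrable_bounded (M := V * B)) => //.
  - exact: lebesgue_itv_lty.
  - apply: measurable_funM => //.
    rewrite (_ : k = (fun x => - (- k x))); last by apply/funext => x; rewrite opprK.
    by apply: measurable_funN; exact: nondecreasing_in_measurable.
  - move=> x xab; rewrite normrM ler_pM ?DB//.
    by have /andP[k0 kV'] := kV _ xab; rewrite ger0_norm.
have pi := ki _ pmono pV; have qi := ki _ qmono qV.
have hDi : mu.-integrable `]a, b] (EFin \o (fun x => h b * D x)).
  exact: integrable_scaler.
under eq_Rintegral do rewrite hE.
rewrite RintegralD//; last first.
  exact: integrable_subr.
rewrite RintegralB// RintegralZl//.
have -> : C * (`|h b| + 2 * V) = `|h b| * C + C * V + C * V by ring.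
rewrite (le_trans (ler_normD _ _))// lerD//.
  rewrite (le_trans (ler_normB _ _))// lerD//.
    by rewrite normrM ler_wpM2l// DC.
  exact: (@norm_Rintegral_nonincreasing _ _ _ _ B).
exact: (@norm_Rintegral_nonincreasing _ _ _ _ B).
Qed.

End second_mean_value.

(** * The kernel sin(Mx)/x *)
Section kernel.
Context {R : realType}.
Notation mu := (@lebesgue_measure R).
Notation mR := (measurableTypeR R).

Lemma Rintegral_FTC (F f : R -> R) (a b : R) : a <= b ->
  (forall x : R, is_derive x 1 F (f x)) -> continuous f ->
  \int[mu]_(x in `]a, b]) f x = F b - F a.
Proof.
rewrite le_eqVlt => /predU1P[->|ab] dF cf.
  by rewrite set_itv_ge ?bnd_simp// Rintegral_set0 subrr.
have cF : continuous F.
  move=> x; apply/differentiable_continuous/derivable1_diffP.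
  by have := dF x => -[].
have cf' : {within `[a, b], continuous f} by exact: continuous_subspaceT.
have fi : mu.-integrable `[a, b] (EFin \o f).
  by apply: continuous_compact_integrable => //; exact: segment_compact.
rewrite Rintegral_itv_obnd_cbnd; last first.
  by apply: integrableS fi => //; exact: subset_itv_oc_cc.
rewrite /Rintegral (continuous_FTC2 (F := F))// -?EFinB//.
  split; first by move=> x _; have := dF x => -[].
    exact: cvg_at_right_filter (cF a).
  exact: cvg_at_left_filter (cF b).
by move=> x _; rewrite derive1E; have := dF x => -[].
Qed.

Lemma normr_sin_le (x : R) : `|sin x| <= `|x|.
Proof.
wlog x0 : x / 0 <= x.
  move=> H; have [|x0] := leP 0 x; first exact: H.
  by rewrite -normrN -sinN -(normrN x) H// oppr_ge0 ltW.
have [c _] := @MVT_segment R sin cos 0 x x0 (fun y _ => is_derive_sin y)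
  (continuous_subspaceT (@continuous_sin R)).
by rewrite sin0 !subr0 => ->; rewrite normrM ler_piMl// cos_max.
Qed.

Lemma continuous_sinM (M : R) : continuous (fun x : R => sin (M * x)).
Proof.
move=> x; apply: (@continuous_comp _ _ _ ( *%R M) sin).
  exact: mulrl_continuous.
exact: continuous_sin.
Qed.

Lemma continuous_cosM (M : R) : continuous (fun x : R => cos (M * x)).
Proof.
move=> x; apply: (@continuous_comp _ _ _ ( *%R M) cos).
  exact: mulrl_continuous.
exact: continuous_cos.
Qed.

Lemma measurable_sin : measurable_fun [set: R] (@sin R).
Proof. by apply: continuous_measurable_fun; exact: continuous_sin. Qed.

Lemma measurable_cos : measurable_fun [set: R] (@cos R).
Proof. by apply: continuous_measurable_fun; exact: continuous_cos. Qed.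

Lemma measurable_inv : measurable_fun [set: R] (@GRing.inv R).
Proof.
have -> : (@GRing.inv R) = (fun x => if x == 0 then 0 else x^-1).
  by apply/funext => x; case: eqP => // ->; rewrite invr0.
apply: measurable_fun_if => //; first exact: measurable_fun_eqr.
apply: (measurable_funS (E := [set x : R | x != 0])).
- exact: open_measurable.
- by move=> x [_ /= /negbT].
- apply: open_continuous_measurable_fun => //; apply/in_setP => x /= x0.
  exact: inv_continuous.
Qed.

Lemma Rintegral_cosM (x M : R) : x != 0 -> 0 <= M ->
  \int[mu]_(u in `]0, M]) cos (x * u) = sin (x * M) / x.
Proof.
move=> x0 M0.
have dF (u : R) : is_derive u 1 (fun u => sin (x * u) / x) (cos (x * u)).
  by apply: is_derive_eq; rewrite /GRing.scale/=; field.
rewrite (Rintegral_FTC M0 dF); last exact: continuous_cosM.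
by rewrite mulr0 sin0 mul0r subr0.
Qed.

Lemma Rintegral_sinM (M a b : R) : M != 0 -> a <= b ->
  \int[mu]_(u in `]a, b]) sin (M * u) = (cos (M * a) - cos (M * b)) / M.
Proof.
move=> M0 ab.
have dF (u : R) : is_derive u 1 (fun u => - (cos (M * u) / M)) (sin (M * u)).
  by apply: is_derive_eq; rewrite /GRing.scale/=; field.
rewrite (Rintegral_FTC ab dF); last exact: continuous_sinM.
by field.
Qed.

Lemma norm_Rintegral_sinM (M a b : R) : 0 < M -> a <= b ->
  `|\int[mu]_(u in `]a, b]) sin (M * u)| <= 2 / M.
Proof.
move=> M0 ab; rewrite Rintegral_sinM ?gt_eqF// normrM normfV (gtr0_norm M0).
apply: ler_wpM2r; first by rewrite invr_ge0 ltW.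
by rewrite (le_trans (ler_normB _ _))// [leRHS](_ : 2 = 1 + 1)// lerD ?cos_max.
Qed.

(** The value at the origin makes [sinK M x] the integral of [cos (x * u)] over
    [0 < u <= M] for every [x]. *)
Definition sinK (M x : R) : R := if x == 0 then M else sin (M * x) / x.

Lemma sinKE (M x : R) : x != 0 -> sinK M x = sin (M * x) / x.
Proof. by rewrite /sinK => /negbTE ->. Qed.

Lemma Rintegral_cos_sinK (x M : R) : 0 <= M ->
  \int[mu]_(u in `]0, M]) cos (x * u) = sinK M x.
Proof.
move=> M0; rewrite /sinK; case: eqVneq => [->|x0].
  under eq_Rintegral do rewrite mul0r cos0.
  by rewrite Rintegral_cst// fine_lebesgue_itv// subr0 mul1r.
by rewrite Rintegral_cosM// [x * M]mulrC.
Qed.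

Lemma sinKN (M x : R) : sinK M (- x) = sinK M x.
Proof.
rewrite /sinK oppr_eq0; case: eqP => // _.
by rewrite mulrN sinN invrN mulrN mulNr opprK.
Qed.

Lemma normr_sinK_le (M x : R) : 0 <= M -> `|sinK M x| <= M.
Proof.
move=> M0; rewrite /sinK; case: eqVneq => [_|x0]; first by rewrite ger0_norm.
rewrite normrM normfV ler_pdivrMr ?normr_gt0//.
by rewrite (le_trans (normr_sin_le _))// normrM ger0_norm.
Qed.

Lemma measurable_sinK (M : R) : measurable_fun [set: mR] (sinK M).
Proof.
apply: measurable_fun_if => //; first exact: measurable_fun_eqr.
apply: measurable_funTS; apply: measurable_funM; last exact: measurable_inv.
apply: continuous_measurable_fun; exact: continuous_sinM.
Qed.

Lemma integrable_sinK (M a b : R) : 0 <= M ->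
  mu.-integrable `]a, b] (EFin \o sinK M).
Proof.
move=> M0; apply: (integrable_bounded (M := M)) => //.
- exact: lebesgue_itv_lty.
- exact: (measurable_funTS (measurable_sinK M)).
- by move=> x _; exact: normr_sinK_le.
Qed.

(** On the right of [a] the factor [1 / x] decreases from [1 / a]. *)
Lemma norm_Rintegral_sinK_far (M a b : R) : 0 < M -> 0 < a -> a <= b ->
  `|\int[mu]_(x in `]a, b]) sinK M x| <= 2 / (M * a).
Proof.
move=> M0 a0 ab; rewrite invfM mulrA.
rewrite (@eq_Rintegral _ _ _ mu _ (fun x : R => x^-1 * sin (M * x))); last first.
  move=> x /set_mem/=; rewrite in_itv/= => /andP[ax _].
  by rewrite sinKE ?gt_eqF ?(lt_trans a0)// mulrC.
apply: (@norm_Rintegral_nonincreasing _ _ _ (2 / M) a^-1 1) => //.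
- by rewrite invr_ge0 ltW.
- move=> x y ax xy _; rewrite lerN2 lef_pV2// posrE (lt_trans a0)//.
  exact: lt_le_trans xy.
- move=> x; rewrite in_itv/= => /andP[ax _].
  by rewrite invr_ge0 lef_pV2 ?posrE ?(ltW ax) ?(ltW (lt_trans a0 ax))// (lt_trans a0).
- apply: measurable_funTS; apply: continuous_measurable_fun; exact: continuous_sinM.
- by move=> x _; exact: sin_max.
- by move=> c ac cb; exact: norm_Rintegral_sinM.
Qed.

(** Over a subset of ]0, 1 / M] the integral is at most 1 because the kernel is
    at most [M]; beyond [1 / M] the previous bound gives 2. *)
Lemma norm_Rintegral_sinK (M a b : R) : 0 < M -> 0 <= a -> a <= b ->
  `|\int[mu]_(x in `]a, b]) sinK M x| <= 3.
Proof.
move=> M0 a0 ab; pose c := Num.max a (Num.min b M^-1).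
have ac : a <= c by rewrite /c le_max lexx.
have cb : c <= b by rewrite /c ge_max ab ge_min lexx.
have M1 : 0 < M^-1 by rewrite invr_gt0.
rewrite (Rintegral_itvoc_split ac cb); last exact/integrable_sinK/ltW.
rewrite (_ : 3 = 1 + 2)// (le_trans (ler_normD _ _))// lerD//.
  apply: (@le_trans _ _ (M * (c - a))).
    rewrite -(@fine_lebesgue_itv R false false a c)//.
    apply: le_normr_Rintegral_cst => //.
    - exact: lebesgue_itv_lty.
    - exact: (measurable_funTS (measurable_sinK M)).
    - by move=> x _; exact/normr_sinK_le/ltW.
  rewrite -ler_pdivlMl// mulr1 /c.
  have [bM|Mb] := leP b M^-1; first by rewrite max_r//; lra.
  by have [aM|Ma] := leP a M^-1; [lra|rewrite subrr ltW].
have [bM|Mb] := leP b M^-1.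
  have -> : c = b by rewrite /c min_l// max_r.
  by rewrite set_itv_ge ?bnd_simp// Rintegral_set0 normr0.
have Mc : M^-1 <= c by rewrite /c min_r ?(ltW Mb)// le_max lexx orbT.
have c0 : 0 < c by exact: lt_le_trans Mc.
apply: (le_trans (norm_Rintegral_sinK_far M0 c0 cb)).
rewrite ler_pdivrMr ?mulr_gt0// ler_peMr// -ler_pdivrMl//.
by rewrite mulr1.
Qed.

End kernel.

(** * Riemann-Lebesgue lemma and Dirichlet integral *)
Section riemann_lebesgue.
Context {R : realType}.
Notation mu := (@lebesgue_measure R).
Notation mR := (measurableTypeR R).

Lemma continuous_uniform_segment (g : R -> R) (a b e : R) :
  continuous g -> 0 < e ->
  exists2 d, 0 < d &
    forall x y, a <= x <= b -> `|x - y| < d -> `|g x - g y| < e.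
Proof.
move=> cg e0; have /compact_near_coveringP := @segment_compact R a b.
move=> /(_ R 0^'+ (fun d x => forall y, `|x - y| < d -> `|g x - g y| < e) _).
have H x : `[a, b]%classic x -> \forall x' \near x & d \near 0^'+,
    forall y, `|x' - y| < d -> `|g x' - g y| < e.
  move=> _; have /cvgrPdist_lt/(_ (e / 2)) := cg x.
  rewrite divr_gt0// => /(_ isT)/nbhs_ballP[r /= r0 rg].
  exists (ball x (r / 2), [set d | d < r / 2]); first split => /=.
  - by apply: nbhsx_ballx; rewrite divr_gt0.
  - by apply: nbhs_right_lt; rewrite divr_gt0.
  move=> [x' d] [/= xx' dr] y x'y.
  have gx' : `|g x - g x'| < e / 2.
    by apply: rg; apply: lt_trans xx' _; rewrite ltr_pdivrMr// ltr_pMr// ltr1n.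
  have gy : `|g x - g y| < e / 2.
    apply: rg; rewrite /ball/= -(subrKA x') (le_lt_trans (ler_normD _ _))//.
    by rewrite [ltRHS]splitr ltrD// (lt_trans x'y).
  rewrite -(subrKA (g x)) (le_lt_trans (ler_normD _ _))//.
  by rewrite [ltRHS]splitr ltrD// distrC.
move=> /(_ H) near_d.
have /filter_ex[d [d0 dP]] : \forall d \near (0:R)^'+,
    0 < d /\ (`[a, b]%classic `<=` fun x => forall y, `|x - y| < d -> `|g x - g y| < e).
  by apply: filterI => //; exact: nbhs_right_gt.
by exists d => // x y xab; apply: dP => /=; rewrite in_itv.
Qed.

(** On each piece of a fine subdivision [g] is replaced by its value at the left
    end, and the integral of [sin (M * x)] over a piece is at most [2 / M]. *)
Lemma riemann_lebesgue_continuous (g : R -> R) (a b e : R) :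
  a <= b -> continuous g -> 0 < e ->
  \forall M \near +oo, `|\int[mu]_(x in `]a, b]) (g x * sin (M * x))| <= e.
Proof.
move=> ab cg e0.
have [B gB] : exists B : R, forall x, x \in `[a, b] -> `|g x| <= B.
  have [c _ cmax] := @EVT_max R (fun x => `|g x|) a b ab
    (continuous_subspaceT (fun x => continuous_comp (cg x) (@norm_continuous _ _ _))).
  by exists `|g c|.
have B0 : 0 <= B by rewrite (le_trans _ (gB a _))// in_itv/= lexx.
pose e' := e / 2 / (b - a + 1).
have ba1 : 0 < b - a + 1 by rewrite ltr_wpDl// subr_ge0.
have e'0 : 0 < e' by rewrite !divr_gt0.
have [d d0 dg] := @continuous_uniform_segment g a b e' cg e'0.
pose n := (Num.truncn ((b - a) / d)).+1.
pose L := (b - a) / n%:R.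
have L0 : 0 <= L by rewrite divr_ge0// subr_ge0.
have Ld : L < d.
  by rewrite /L ltr_pdivrMr// mulrC -ltr_pdivrMr// truncnS_gt.
pose X i := a + i%:R * L.
have X0 : X 0%N = a by rewrite /X mul0r addr0.
have nL : n%:R * L = b - a by rewrite /L mulrC divfK ?pnatr_eq0.
have Xn : X n = b by rewrite /X nL addrC subrK.
have XS i : X i.+1 = X i + L by rewrite /X -natr1 mulrDl mul1r addrA.
have aX i : a <= X i by rewrite lerDl mulr_ge0.
have Xb i : (i <= n)%N -> X i <= b.
  by move=> ni; rewrite -Xn lerD2l ler_wpM2r// ler_nat.
have gs_int M c e1 : mu.-integrable `]c, e1] (EFin \o (fun x => g x * sin (M * x))).
  apply: (@integrableS _ _ _ mu `[c, e1]) => //; first exact: subset_itv_oc_cc.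
  apply: continuous_compact_integrable; first exact: segment_compact.
  apply: continuous_subspaceT => x; apply: cvgM; first exact: cg.
  exact: continuous_sinM.
have key M i : 0 < M -> (i <= n)%N ->
    `|\int[mu]_(x in `]a, X i]) (g x * sin (M * x))| <=
      i%:R * (e' * L + B * (2 / M)).
  move=> M0; elim: i => [_|i IH ni].
    by rewrite X0 set_itv_ge ?bnd_simp// Rintegral_set0 normr0 mul0r.
  have XX : X i <= X i.+1 by rewrite XS lerDl.
  rewrite (@Rintegral_itvoc_split _ _ a _ (X i))// -natr1 mulrDl mul1r.
  rewrite (le_trans (ler_normD _ _))// lerD ?IH 1?ltnW//.
  have sin_int : mu.-integrable `]X i, X i.+1] (EFin \o (fun x => sin (M * x))).
    apply: (@integrableS _ _ _ mu `[X i, X i.+1]) => //; first exact: subset_itv_oc_cc.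
    apply: continuous_compact_integrable; first exact: segment_compact.
    by apply: continuous_subspaceT; exact: continuous_sinM.
  under eq_Rintegral do rewrite -[g _](subrK (g (X i))) mulrDl.
  rewrite RintegralD//; last 2 first.
  - apply: (@eq_integrable _ _ _ mu _ _ (EFin \o (fun x => g x * sin (M * x) -
      g (X i) * sin (M * x)))) => //.
      by move=> x _ /=; rewrite mulrBl.
    by apply: integrable_subr => //; exact: integrable_scaler.
  - exact: integrable_scaler.
  rewrite (le_trans (ler_normD _ _))// lerD//.
    rewrite [X in _ <= _ * X](_ : L = X i.+1 - X i); last by rewrite XS addrAC subrr add0r.
    rewrite -(@fine_lebesgue_itv R false false (X i) (X i.+1))//.
    apply: le_normr_Rintegral_cst => //; first exact: lebesgue_itv_lty.
      apply: measurable_funTS; apply: measurable_funM.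
        apply: measurable_funB => //; apply: continuous_measurable_fun; exact: cg.
      apply: continuous_measurable_fun; exact: continuous_sinM.
    move=> x /=; rewrite in_itv/= XS => /andP[Xx xX].
    rewrite normrM -[leRHS]mulr1 ler_pM// ?sin_max// ltW// distrC.
    apply: dg; first by rewrite aX Xb// ltnW.
    rewrite distrC ger0_norm ?subr_ge0 ?(ltW Xx)// (le_lt_trans _ Ld)//.
    by rewrite lerBlDl.
  rewrite RintegralZl// normrM ler_pM//.
    by rewrite gB// in_itv/= aX Xb// ltnW.
  exact: norm_Rintegral_sinM.
near=> M.
have M0 : 0 < M by near: M; exact: nbhs_pinfty_gt.
rewrite -[X in `]a, X]]Xn (le_trans (key M n M0 (leqnn _)))//.
rewrite mulrDr [leRHS]splitr lerD//.
  rewrite mulrCA nL /e' mulrAC ler_pdivrMr//.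
  by rewrite ler_wpM2l// ?lerDl// divr_ge0// ltW.
rewrite !mulrA ler_pdivrMr// -ler_pdivrMl ?divr_gt0//.
Unshelve. all: by end_near. Qed.

Lemma Rintegral_dominated_cvg0 d (T : measurableType d)
    (m : {measure set T -> \bar R}) (D : set T) (f_ : nat -> T -> R) (g : T -> R) :
  measurable D -> (forall n, measurable_fun D (f_ n)) ->
  {ae m, forall x, D x -> f_ ^~ x @ \oo --> (0 : R)} ->
  m.-integrable D (EFin \o g) ->
  {ae m, forall x n, D x -> `|f_ n x| <= g x} ->
  \int[m]_(x in D) f_ n x @[n --> \oo] --> (0 : R).
Proof.
move=> mD mf f0 gi fg.
have f0' : {ae m, forall x, D x -> (fun n => (EFin \o f_ n) x) @ \oo --> (0%E : \bar R)}.
  apply: (ae_imply _ f0) => x H Dx; apply: cvg_EFin; first exact: nearW.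
  exact: H.
have [_ _] := @dominated_convergence _ _ _ m D mD (fun n => EFin \o f_ n) (cst 0%E)
  (EFin \o g) (fun n => (measurable_EFinP _ _).2 (mf n)) (measurable_cst _)
  f0' gi
  (ae_imply (fun x H n Dx => H n Dx) fg).
rewrite integral0 => H; apply: (@fine_cvg R _ _ _ _ 0); exact: H.
Qed.

Lemma integrable_tail (h : R -> R) (e : R) :
  mu.-integrable setT (EFin \o h) -> 0 < e ->
  exists2 k : R, 0 <= k &
    \int[mu]_x `|h x - (h \_ `]- k, k]) x| <= e.
Proof.
move=> hi e0; have mh : measurable_fun [set: mR] h.
  by apply/measurable_EFinP; exact: measurable_int hi.
have := @Rintegral_dominated_cvg0 _ mR mu setT
  (fun n x => `|h x - (h \_ `]- n%:R, n%:R]) x|) (fun x => `|h x|) measurableT.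
have mhk (k : R) : measurable_fun [set: mR] (h \_ `]- k, k]).
  apply/(measurable_restrictT _ _).1 => //; exact: measurable_funTS.
move=> /(_ (fun n => measurableT_comp (@normr_measurable R setT)
  (measurable_funB mh (mhk n%:R)))).
have cv : {ae mu, forall x : mR, setT x ->
    (fun n => `|h x - (h \_ `]- n%:R, n%:R]) x|) @ \oo --> (0 : R)}.
  apply: aeW => x _; apply: cvg_near_cst; near=> n.
  rewrite patchE mem_set ?subrr ?normr0//= in_itv/=.
  have : `|x| < n%:R by near: n; exact: nbhs_infty_gtr.
  by rewrite ltr_norml => /andP[-> /ltW].
move=> /(_ cv (integrable_norm hi)); have bd : {ae mu, forall (x : mR) n, setT x ->
    `| `|h x - (h \_ `]- n%:R, n%:R]) x| | <= `|h x|}.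
  apply: aeW => x n _; rewrite normr_id patchE; case: ifP => _.
    by rewrite subrr normr0.
  by rewrite subr0.
move=> /(_ bd)/cvgrPdist_le/(_ e e0)[n _ /(_ n (leqnn n))] /=.
rewrite sub0r normrN => H; exists n%:R => //; apply: le_trans H; exact: ler_norm.
Unshelve. all: by end_near. Qed.

(** The function is truncated to a bounded interval, and there approximated in
    mean by a continuous function. *)
Lemma riemann_lebesgue (h : R -> R) : mu.-integrable setT (EFin \o h) ->
  \int[mu]_x (h x * sin (M * x)) @[M --> +oo] --> (0 : R).
Proof.
move=> hi; apply/cvgrPdist_le => e e0.
have e30 : 0 < e / 3 by rewrite divr_gt0.
have [k k0 hk] := integrable_tail hi e30.
have kk : - k <= k by rewrite (le_trans _ k0)// oppr_le0.
have mh : measurable_fun [set: mR] h.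
  by apply/measurable_EFinP; exact: measurable_int hi.
have hki : mu.-integrable `]- k, k] (EFin \o h).
  exact: (integrableS measurableT).
have [g_ [cg gi]] := approximation_continuous_integrable (measurable_itv _)
  (lebesgue_itv_lty false false (- k) k) hki.
move=> /fine_cvgP[_]; move=> /cvgrPdist_lt/(_ _ e30) gcv.
have [n _ /(_ n (leqnn n)) /= gn] := gcv.
rewrite sub0r normrN in gn.
set g := g_ n in gn.
have ms M : measurable_fun [set: mR] (fun x => sin (M * x)).
  by apply: continuous_measurable_fun; exact: continuous_sinM.
have mulsin (f : R -> R) (D : set mR) M : measurable D -> mu.-integrable D (EFin \o f) ->
    mu.-integrable D (EFin \o (fun x => f x * sin (M * x))).
  move=> mD fi; apply: (integrable_mul_bounded (M := 1)) => //.
    exact: (measurable_funTS (ms M)).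
  by move=> x _; exact: sin_max.
have rhk : mu.-integrable setT (EFin \o (h \_ `]- k, k])).
  exact: integrable_restrictr.
have hhk : mu.-integrable setT (EFin \o (fun x => h x - (h \_ `]- k, k]) x)).
  exact: integrable_subr.
have hg : mu.-integrable `]- k, k] (EFin \o (fun x => h x - g x)).
  by apply: integrable_subr => //; exact: gi.
near=> M; rewrite sub0r normrN.
have -> : \int[mu]_x (h x * sin (M * x)) =
   \int[mu]_x ((h x - (h \_ `]- k, k]) x) * sin (M * x)) +
   (\int[mu]_(x in `]- k, k]) ((h x - g x) * sin (M * x)) +
    \int[mu]_(x in `]- k, k]) (g x * sin (M * x))).
  rewrite -RintegralD//; try by apply: mulsin => //; exact: gi.
  under [X in _ = _ + X]eq_Rintegral do rewrite -mulrDl subrK.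
  have -> : \int[mu]_(x in `]- k, k]) (h x * sin (M * x)) =
      \int[mu]_x ((h \_ `]- k, k]) x * sin (M * x)).
    rewrite Rintegral_mkcond; apply: eq_Rintegral => x _.
    by rewrite !patchE; case: ifP => // _; rewrite mul0r.
  rewrite -RintegralD//; try by apply: mulsin => //; exact: gi.
  by apply: eq_Rintegral => x _; rewrite -mulrDl subrK.
have -> : e = e / 3 + (e / 3 + e / 3) by field.
rewrite (le_trans (ler_normD _ _))// lerD//.
  apply: le_trans hk; apply: le_normr_Rintegral_bound => //.
  - exact: mulsin.
  - exact: integrable_norm.
  - by move=> x _; rewrite normrM ler_piMr// sin_max.
rewrite (le_trans (ler_normD _ _))// lerD//.
  apply: (@le_trans _ _ (\int[mu]_(x in `]- k, k]) `|h x - g x|)).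
    apply: le_normr_Rintegral_bound => //.
    - exact: mulsin.
    - exact: integrable_norm.
    - by move=> x _; rewrite normrM ler_piMr// sin_max.
  exact: (le_trans (ler_norm _) (ltW gn)).
near: M; exact: (riemann_lebesgue_continuous kk (cg n) e30).
Unshelve. all: by end_near. Qed.

Lemma riemann_lebesgue_in (D : set mR) (h : R -> R) : measurable D ->
  mu.-integrable D (EFin \o h) ->
  \int[mu]_(x in D) (h x * sin (M * x)) @[M --> +oo] --> (0 : R).
Proof.
move=> mD hi.
have := riemann_lebesgue (integrable_restrictr mD hi); apply: cvg_trans.
apply: near_eq_cvg; near=> M; rewrite [RHS]Rintegral_mkcond.
by apply: eq_Rintegral => x _; rewrite !patchE; case: ifP => // _; rewrite mul0r.
Unshelve. all: by end_near. Qed.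

End riemann_lebesgue.

Section dirichlet_integral.
Context {R : realType}.
Notation mu := (@lebesgue_measure R).
Notation mR := (measurableTypeR R).

Let itv_pi (x : R) : `]0, pi]%classic x -> 0 < x <= pi.
Proof. by rewrite /= in_itv. Qed.

Let sin_half_gt0 (x : R) : 0 < x <= pi -> 0 < sin (x / 2).
Proof.
move=> /andP[x0 xpi]; apply: sin_gt0_pi; rewrite divr_gt0//=.
by rewrite ltr_pdivrMr// (le_lt_trans xpi)// ltr_pMr ?pi_gt0// ltr1n.
Qed.

Lemma Rintegral_cos_nat_pi n :
  \int[mu]_(x in `]0, pi]) cos (n.+1%:R * x) = 0 :> R.
Proof.
rewrite Rintegral_cosM ?pnatr_eq0 ?pi_ge0//.
have sin_npi k : sin (k%:R * pi) = 0 :> R.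
  elim: k => [|k IH]; first by rewrite mul0r sin0.
  by rewrite -natr1 mulrDl mul1r sinDpi IH oppr0.
by rewrite sin_npi mul0r.
Qed.

Let dirichlet_kernel n (x : R) := sin ((n%:R + 2^-1) * x) / (2 * sin (x / 2)).

Let dirichlet_kernelS n (x : R) : 0 < x <= pi ->
  dirichlet_kernel n.+1 x = dirichlet_kernel n x + cos (n.+1%:R * x).
Proof.
move=> /sin_half_gt0 s0; rewrite /dirichlet_kernel.
have -> : (n.+1%:R + 2^-1) * x = n.+1%:R * x + x / 2 by field.
have -> : (n%:R + 2^-1) * x = n.+1%:R * x - x / 2 by rewrite -natr1; field.
by rewrite sinD sinB; field; rewrite gt_eqF.
Qed.

(** The kernel is [1 / 2 + cos x + ... + cos (n x)], a form in which the
    singularity at 0 has disappeared. *)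
Let dirichlet_kernel_bound n : exists B : R, forall x, 0 < x <= pi ->
  `|dirichlet_kernel n x| <= B.
Proof.
elim: n => [|n [B HB]].
  exists 2^-1 => x /sin_half_gt0 s0; rewrite /dirichlet_kernel add0r [2^-1 * x]mulrC.
  rewrite (_ : _ / _ = 2^-1) ?ger0_norm// ?invr_ge0//.
  by field; rewrite gt_eqF.
exists (B + 1) => x xpi; rewrite dirichlet_kernelS// (le_trans (ler_normD _ _))//.
by rewrite lerD ?HB ?cos_max.
Qed.

Let measurable_dirichlet_kernel n : measurable_fun [set: mR] (dirichlet_kernel n).
Proof.
apply: measurable_funM.
  apply: continuous_measurable_fun; exact: continuous_sinM.
apply: (measurableT_comp measurable_inv); apply: measurable_funM => //.
apply: (measurableT_comp measurable_sin); exact: measurable_funM.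
Qed.

Let integrable_dirichlet_kernel n :
  mu.-integrable `]0, pi] (EFin \o dirichlet_kernel n).
Proof.
have [B HB] := dirichlet_kernel_bound n.
apply: (integrable_bounded (M := B)) => //; first exact: lebesgue_itv_lty.
  exact: (measurable_funTS (measurable_dirichlet_kernel n)).
Qed.

Let Rintegral_dirichlet_kernel n :
  \int[mu]_(x in `]0, pi]) dirichlet_kernel n x = pi / 2.
Proof.
elim: n => [|n IH].
  transitivity (\int[mu]_(x in `]0, pi]) (cst 2^-1 x : R)).
    apply: eq_Rintegral => x /set_mem/itv_pi/sin_half_gt0 s0.
    by rewrite /dirichlet_kernel/= add0r [2^-1 * x]mulrC; field; rewrite gt_eqF.
  by rewrite Rintegral_cst// fine_lebesgue_itv ?pi_ge0// subr0 mulrC.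
rewrite (@eq_Rintegral _ _ _ mu _
  (fun x => dirichlet_kernel n x + cos (n.+1%:R * x))); last first.
  by move=> x /set_mem/itv_pi; exact: dirichlet_kernelS.
rewrite RintegralD// ?IH ?Rintegral_cos_nat_pi ?addr0//.
apply: (integrable_bounded (M := 1)) => //; first exact: lebesgue_itv_lty.
  apply: measurable_funTS; apply: continuous_measurable_fun; exact: continuous_cosM.
by move=> x _; exact: cos_max.
Qed.

Lemma mul_cos_le_sin (y : R) : 0 <= y <= pi -> y * cos y <= sin y.
Proof.
move=> /andP[y0 ypi].
have df (x : R) : is_derive x 1 (fun x => sin x - x * cos x) (x * sin x).
  by apply: is_derive_eq; rewrite /GRing.scale/=; ring.
have cf : continuous (fun x : R => sin x - x * cos x).
  move=> x; apply: differentiable_continuous; apply/derivable1_diffP.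
  by have := df x => -[].
have [c] := @MVT_segment R _ _ 0 y y0 (fun x _ => df x) (continuous_subspaceT cf).
rewrite in_itv/= => /andP[c0 cy]; rewrite sin0 mul0r !subr0 -subr_ge0 => ->.
by rewrite !mulr_ge0// sin_ge0_pi// c0 (le_trans cy).
Qed.

(** With [y = x / 2], the difference is [(sin y - y) / (2 y sin y)], and
    [y cos y <= sin y <= y] bounds it by [(1 - cos y) / (2 sin y)]. *)
Let denominator_bound (x : R) : 0 < x <= pi ->
  `|x^-1 - (2 * sin (x / 2))^-1| <= 2^-1.
Proof.
move=> xpi; have s0 := sin_half_gt0 xpi; have /andP[x0 xlepi] := xpi.
pose y := x / 2; have y0 : 0 < y by rewrite divr_gt0.
have xE : x = 2 * y by rewrite /y mulrC divfK.
rewrite -/y in s0 *; rewrite xE.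
have ypi : y <= pi / 2 by rewrite /y ler_pM2r.
have cy : 0 <= cos y.
  apply: cos_ge0_pihalf; rewrite ypi andbT (le_trans _ (ltW y0))// oppr_le0.
  by rewrite divr_ge0 ?pi_ge0.
have sy : sin y <= y.
  by have := normr_sin_le y; rewrite (gtr0_norm s0) (gtr0_norm y0).
have ycy : y * cos y <= sin y.
  apply: mul_cos_le_sin; rewrite ltW//= (le_trans ypi)//.
  by rewrite ler_pdivrMr// ler_peMr ?pi_ge0// ler1n.
have -> : (2 * y)^-1 - (2 * sin y)^-1 = - ((y - sin y) / (2 * y * sin y)).
  by field; rewrite !gt_eqF.
rewrite normrN ger0_norm; last first.
  by rewrite divr_ge0 ?subr_ge0// !mulr_ge0// ltW.
rewrite ler_pdivrMr ?mulr_gt0//.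
have -> : 2^-1 * (2 * y * sin y) = y * sin y by field.
apply: (@le_trans _ _ (y * (1 - cos y))); first by lra.
rewrite ler_pM2l//.
have := cos2Dsin2 y; have := cos_le1 y; nra.
Qed.

(** The kernels [sinK (n + 1/2)] and [sin ((n + 1/2) x) / (2 sin (x / 2))] differ
    by [sin ((n + 1/2) x)] times a bounded function, whose integral vanishes in
    the limit by the Riemann-Lebesgue lemma; the integral of the latter kernel
    is [pi / 2] for every [n]. *)
Let half_integer_dirichlet :
  \int[mu]_(x in `]0, pi]) sinK (n%:R + 2^-1) x @[n --> \oo] --> (pi / 2 : R).
Proof.
pose r (x : R) := x^-1 - (2 * sin (x / 2))^-1.
have mr : measurable_fun [set: mR] r.
  apply: measurable_funB; first exact: measurable_inv.
  apply: (measurableT_comp measurable_inv); apply: measurable_funM => //.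
  apply: (measurableT_comp measurable_sin); exact: measurable_funM.
have ri : mu.-integrable `]0, pi] (EFin \o r).
  apply: (integrable_bounded (M := 2^-1)) => //; first exact: lebesgue_itv_lty.
    exact: measurable_funTS.
have rl := riemann_lebesgue_in (measurable_itv _) ri.
have half_oo : (n%:R + 2^-1 : R) @[n --> \oo] --> +oo.
  apply/cvgryPge => A; near=> n; rewrite (@le_trans _ _ n%:R) ?lerDl//.
  by near: n; exact: nbhs_infty_ger.
have {}rl := cvg_comp _ _ half_oo rl.
rewrite -[pi / 2]add0r.
have -> : (fun n => \int[mu]_(x in `]0, pi]) sinK (n%:R + 2^-1) x) =
   (fun n => \int[mu]_(x in `]0, pi]) (r x * sin ((n%:R + 2^-1) * x)) + pi / 2).
  apply/funext => n; rewrite -(Rintegral_dirichlet_kernel n) -RintegralD//.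
    apply: eq_Rintegral => x /set_mem/itv_pi xpi; have s0 := sin_half_gt0 xpi.
    have /andP[x0 _] := xpi; rewrite sinKE ?gt_eqF// /r /dirichlet_kernel.
    by field; rewrite !gt_eqF.
  apply: (integrable_mul_bounded (M := 1)) => //.
    apply: measurable_funTS; apply: continuous_measurable_fun; exact: continuous_sinM.
  by move=> x _; exact: sin_max.
by apply: cvgD; [exact: rl|exact: cvg_cst].
Unshelve. all: by end_near. Qed.

(** Since [sinK M x] is the integral of [cos (x u)] over [0 < u <= M], Fubini
    exchanges the parameter [M] with the bound [pi]. *)
Let Rintegral_sinK_pi (M : R) : 0 <= M ->
  \int[mu]_(x in `]0, pi]) sinK M x = \int[mu]_(u in `]0, M]) sinK pi u.
Proof.
move=> M0; pose F (p : mR * mR) : R := cos (p.1 * p.2).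
have Fi : (mu \x mu)%E.-integrable (`]0, pi] `*` `]0, M]) (EFin \o F).
  apply: (integrable_bounded (M := 1)) => //.
  - exact: measurableX.
  - exact: lebesgue2_itv_lty.
  - apply: measurable_funTS; apply: (measurableT_comp measurable_cos).
    by apply: measurable_funM; [exact: measurable_fst|exact: measurable_snd].
  - by move=> x _; exact: cos_max.
transitivity (\int[mu]_(x in `]0, pi]) \int[mu]_(u in `]0, M]) F (x, u)).
  by apply: eq_Rintegral => x _; rewrite Rintegral_cos_sinK.
rewrite -Rintegral_prod1// Rintegral_prod2//.
apply: eq_Rintegral => u _; rewrite /F/=.
by under eq_Rintegral do rewrite mulrC; rewrite Rintegral_cos_sinK// pi_ge0.
Qed.

(** The integral over ]0, pi] is, by the exchange above, that of [sinK pi] over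
    ]0, M], which converges along the half-integers and has a small oscillation
    far away.  The part of the integral that lies outside any neighbourhood of 0
    tends to 0, so that every other end point gives the same limit. *)
Lemma Rintegral_sinK_cvg (a : R) : 0 < a ->
  \int[mu]_(x in `]0, a]) sinK M x @[M --> +oo] --> (pi / 2 : R).
Proof.
move=> a0; have pi0 := pi_gt0 R.
suff Ipi : \int[mu]_(x in `]0, pi]) sinK M x @[M --> +oo] --> (pi / 2 : R).
  pose m := Num.min a pi; have m0 : 0 < m by rewrite lt_min a0.
  have tail b : m <= b ->
      \int[mu]_(x in `]m, b]) sinK M x @[M --> +oo] --> (0 : R).
    move=> mb; apply/cvgrPdist_le => e e0; near=> M.
    have M0 : 0 < M by near: M; exact: nbhs_pinfty_gt.
    rewrite sub0r normrN (le_trans (norm_Rintegral_sinK_far M0 m0 mb))//.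
    rewrite ler_pdivrMr ?mulr_gt0// mulrCA -ler_pdivrMr ?mulr_gt0//.
  have Im : \int[mu]_(x in `]0, m]) sinK M x @[M --> +oo] --> (pi / 2 : R).
    have mpi : m <= pi by rewrite ge_min lexx orbT.
    rewrite -[pi / 2]subr0.
    apply: (cvg_trans _ (cvgB Ipi (tail _ mpi))); apply: near_eq_cvg; near=> M.
    have M0 : 0 <= M by near: M; exact: nbhs_pinfty_ge.
    transitivity (\int[mu]_(x in `]0, pi]) sinK M x - \int[mu]_(x in `]m, pi]) sinK M x) => //.
    by rewrite (Rintegral_itvoc_split (ltW m0) mpi) ?addrK//; exact: integrable_sinK.
  have ma : m <= a by rewrite ge_min lexx.
  rewrite -[pi / 2]addr0.
  apply: (cvg_trans _ (cvgD Im (tail _ ma))); apply: near_eq_cvg; near=> M.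
  have M0 : 0 <= M by near: M; exact: nbhs_pinfty_ge.
  transitivity (\int[mu]_(x in `]0, m]) sinK M x + \int[mu]_(x in `]m, a]) sinK M x) => //.
  by rewrite (Rintegral_itvoc_split (ltW m0) ma)//; exact: integrable_sinK.
apply/cvgrPdist_le => e e0.
have e20 : 0 < e / 2 by rewrite divr_gt0.
have [N _ HN] := (cvgrPdist_le _ _).1 half_integer_dirichlet _ e20.
(* A half-integer [m] so large that [2 / (pi * m) <= e / 2]. *)
pose n := maxn N (Num.truncn (pi^-1 * ((e / 2)^-1 * 2))).+1.
pose m : R := n%:R + 2^-1.
have m0 : 0 < m by rewrite ltr_wpDl.
have mE : 2 / (pi * m) <= e / 2.
  rewrite ler_pdivrMr ?mulr_gt0// -ler_pdivrMl// mulrC -ler_pdivrMl//.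
  rewrite mulrC (le_trans (ltW (truncnS_gt _)))// /m ler_wpDr//.
  by rewrite ler_nat leq_maxr.
near=> M; have mM : m <= M by near: M; exact: (nbhs_pinfty_ge (num_real m)).
have M0 : 0 <= M by rewrite (le_trans (ltW m0)).
rewrite Rintegral_sinK_pi// (Rintegral_itvoc_split (ltW m0) mM); last first.
  by apply: integrable_sinK; exact: pi_ge0.
rewrite -Rintegral_sinK_pi ?(ltW m0)// opprD addrA (le_trans (ler_normB _ _))//.
rewrite [leRHS]splitr lerD//; first by apply: HN; rewrite /= leq_maxl.
exact: (le_trans (norm_Rintegral_sinK_far pi0 m0 mM)).
Unshelve. all: by end_near. Qed.

End dirichlet_integral.

(** * The two-dimensional Dirichlet-Jordan theorem *)
Section dirichlet_jordan.
Context {R : realType}.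
Notation mu := (@lebesgue_measure R).
Notation mR := (measurableTypeR R).

Definition variation_at_most (a b : R) (h : R -> R) (V : R) :=
  exists2 phi, dominated a b h phi & forall x, a < x -> x <= b -> phi b - phi x <= V.

Lemma near_prod_fst (P : R -> Prop) (F G : set_system R) : Filter G ->
  (\forall x \near F, P x) -> \forall p \near filter_prod F G, P p.1.
Proof.
by move=> FG FP; exists (P, setT); [split => //; exact: filterT|move=> [x y] []].
Qed.

Lemma near_prod_snd (P : R -> Prop) (F G : set_system R) : Filter F ->
  (\forall x \near G, P x) -> \forall p \near filter_prod F G, P p.2.
Proof.
by move=> FF GP; exists (setT, P); [split => //; exact: filterT|move=> [x y] []].
Qed.

Lemma dominated_sub (a b a' b' : R) (h phi : R -> R) : a <= a' -> b' <= b ->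
  dominated a b h phi -> dominated a' b' h phi.
Proof.
move=> aa bb H x y ax xy yb; apply: H => //; first exact: le_lt_trans ax.
exact: le_trans bb.
Qed.

Lemma dominated_norm_le (a b V : R) (h phi : R -> R) : dominated a b h phi ->
  (forall x, a < x -> x <= b -> phi b - phi x <= V) ->
  forall x, a < x -> x <= b -> `|h x| <= `|h b| + V.
Proof.
move=> hphi phiV x ax xb; rewrite -[h x](subrK (h b)) addrC.
rewrite (le_trans (ler_normD _ _))// lerD2l distrC.
by rewrite (le_trans (hphi _ _ ax xb (lexx _)))// phiV.
Qed.

Lemma integrable_dominated_sinK (a b V M : R) (h phi : R -> R) : 0 <= M ->
  dominated a b h phi -> (forall x, a < x -> x <= b -> phi b - phi x <= V) ->
  mu.-integrable `]a, b] (EFin \o (fun x => h x * sinK M x)).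
Proof.
move=> M0 hphi phiV; apply: (integrable_bounded (M := (`|h b| + V) * M)) => //.
- exact: lebesgue_itv_lty.
- apply: measurable_funM; first exact: dominated_measurable hphi.
  exact: (measurable_funTS (measurable_sinK M)).
- move=> x /=; rewrite in_itv/= => /andP[ax xb]; rewrite normrM ler_pM//.
    exact: (dominated_norm_le hphi phiV).
  exact: normr_sinK_le.
Qed.

Lemma norm_Rintegral_sinK_dominated (a b C V M : R) (h phi : R -> R) :
  0 < M -> a <= b -> 0 <= V ->
  dominated a b h phi -> (forall x, a < x -> x <= b -> phi b - phi x <= V) ->
  (forall c, a <= c -> c <= b -> `|\int[mu]_(x in `]a, c]) sinK M x| <= C) ->
  `|\int[mu]_(x in `]a, b]) (h x * sinK M x)| <= C * (`|h b| + 2 * V).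
Proof.
move=> M0 ab V0 hphi phiV KC.
apply: (@norm_Rintegral_dominated _ _ _ _ _ M _ phi) => //.
- by move=> x; rewrite in_itv/= => /andP[]; exact: phiV.
- exact: (measurable_funTS (measurable_sinK M)).
- by move=> x _; exact/normr_sinK_le/ltW.
Qed.

(** A nondecreasing function bounded below near [0] has little variation on a
    small interval whose end point [0] is removed. *)
Lemma dominated_small_variation (b V e : R) (h phi : R -> R) : 0 < b -> 0 < e ->
  dominated 0 b h phi -> (forall x : R, 0 < x -> x <= b -> phi b - phi x <= V) ->
  \forall d \near 0^'+, forall x : R, 0 < x -> x <= d -> phi d - phi x <= e.
Proof.
move=> b0 e0 hphi phiV.
have mono x y : 0 < x -> x <= y -> y <= b -> phi x <= phi y.
  by move=> x0 xy yb; rewrite -subr_ge0 (le_trans _ (hphi _ _ x0 xy yb)).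
pose S := [set phi x | x in `]0, b]].
have Sinf : has_inf S.
  split; first by exists (phi b), b => //=; rewrite in_itv/= b0 lexx.
  exists (phi b - V); move=> _ [x /= + <-]; rewrite in_itv/= => /andP[x0 xb].
  by rewrite lerBlDr -lerBlDl phiV.
have [_ [d /= + <-]] := inf_adherent e0 Sinf; rewrite in_itv/= => /andP[d0 db] dS.
near=> d' => x x0 xd'.
have d'd : d' <= d by near: d'; exact: nbhs_right_le.
have d'0 : 0 < d' by near: d'; exact: nbhs_right_gt.
have : inf S <= phi x.
  apply: ge_inf; first by case: Sinf.
  by exists x => //=; rewrite in_itv/= x0 (le_trans xd')// (le_trans d'd).
have := mono _ _ d'0 d'd db; lra.
Unshelve. all: by end_near. Qed.

(** The Dirichlet-Jordan theorem for a family [h M] whose variation is controlled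
    uniformly in [M], the parameters of the family and of the kernel tending to
    infinity independently.  On ]d, b] the contribution is [O(1 / N)].  On ]0, d]
    the variation is small, so that [h M] may be replaced by the constant [h M d],
    which tends to [l d], a value close to [l0]. *)
Lemma dirichlet_jordan_family (b B V l0 : R) (h : R -> R -> R) (phi l : R -> R) :
  0 < b -> 0 <= V ->
  (forall M : R, 0 < M -> dominated 0 b (h M) phi) ->
  (forall x : R, 0 < x -> x <= b -> phi b - phi x <= V) ->
  (forall M : R, 0 < M -> `|h M b| <= B) ->
  (forall t : R, 0 < t -> t <= b -> h M t @[M --> +oo] --> l t) ->
  l t @[t --> 0^'+] --> l0 ->
  (fun MN : R * R => \int[mu]_(t in `]0, b]) (h MN.1 t * sinK MN.2 t))
    @ filter_prod (pinfty_nbhs R) (pinfty_nbhs R) --> l0 * (pi / 2).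
Proof.
move=> b0 V0 hphi phiV hB hl ll0; apply/cvgrPdist_le => e e0.
(* The errors below add up to [(`|l0| + 3 + 3 + 6 + 1) * e1]. *)
pose c := 13 + `|l0|; have c0 : 0 < c by rewrite ltr_wpDr.
pose e1 := e / c; have e10 : 0 < e1 by rewrite divr_gt0.
have small := @dominated_small_variation b V e1 _ phi b0 e10 (hphi 1 ltr01) phiV.
have /cvgrPdist_le/(_ _ e10) ll := ll0.
have /filter_ex[d [[d0 db] [dsmall dl]]] : \forall d \near (0 : R)^'+,
    (0 < d /\ d <= b) /\ ((forall x : R, 0 < x -> x <= d -> phi d - phi x <= e1) /\
      `|l0 - l d| <= e1).
  near=> d; split; split.
  - by near: d; exact: nbhs_right_gt.
  - by near: d; exact: nbhs_right_le.
  - by near: d.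
  - by near: d.
have /cvgrPdist_le/(_ _ e10) hd := hl d d0 db.
have /cvgrPdist_le/(_ _ e10) Kd := Rintegral_sinK_cvg d0.
near=> p.
have M0 : 0 < p.1 by near: p; apply: (near_prod_fst (P := fun M => 0 < M)); exact: nbhs_pinfty_gt.
have N0 : 0 < p.2 by near: p; apply: (near_prod_snd (P := fun N => 0 < N)); exact: nbhs_pinfty_gt.
have hM : `|l d - h p.1 d| <= e1.
  by near: p; apply: (near_prod_fst (P := fun M => `|l d - h M d| <= e1)).
have KN : `|pi / 2 - \int[mu]_(x in `]0, d]) sinK p.2 x| <= e1.
  near: p; exact: (near_prod_snd (P := fun N =>
    `|pi / 2 - \int[mu]_(x in `]0, d]) sinK N x| <= e1)).
have NB : (B + 2 * V) * 2 / d / e1 <= p.2.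
  near: p; apply: (near_prod_snd (P := fun N => (B + 2 * V) * 2 / d / e1 <= N)).
  exact: (nbhs_pinfty_ge (num_real _)).
have N0' := ltW N0.
have hpd := hphi _ M0.
have hpd0 := dominated_sub (lexx 0) db hpd.
have hpdb := dominated_sub (ltW d0) (lexx b) hpd.
have phidV x : d < x -> x <= b -> phi b - phi x <= V.
  by move=> dx; apply: phiV; exact: lt_trans dx.
have phi0V x : 0 < x -> x <= d -> phi d - phi x <= V.
  move=> x0 xd; rewrite (le_trans _ (phiV _ x0 (le_trans xd db)))// lerD2r.
  by rewrite -subr_ge0 (le_trans _ (hpd _ _ d0 db (lexx _))).
rewrite (Rintegral_itvoc_split (ltW d0) db); last first.
  exact: integrable_dominated_sinK hpd phiV.
set I2 := \int[mu]_(x in `]d, b]) _.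
have I2e : `|I2| <= e1.
  apply: (le_trans (norm_Rintegral_sinK_dominated N0 db V0 hpdb phidV
    (fun c dc _ => norm_Rintegral_sinK_far N0 d0 dc))).
  rewrite mulrAC ler_pdivrMr ?mulr_gt0// mulrC.
  move: NB; rewrite ler_pdivrMr// ler_pdivrMr// => NB.
  have -> : e1 * (p.2 * d) = p.2 * e1 * d by ring.
  by apply: le_trans NB; rewrite ler_wpM2r// lerD2r hB.
pose g x := h p.1 x - h p.1 d.
have gd : dominated 0 d g phi.
  by move=> x y x0 xy yd; rewrite /g opprB addrA subrK hpd0.
have gi := integrable_dominated_sinK N0' gd phi0V.
have Ki : mu.-integrable `]0, d] (EFin \o (fun x => h p.1 d * sinK p.2 x)).
  by apply: integrable_scaler => //; exact: integrable_sinK.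
have -> : \int[mu]_(x in `]0, d]) (h p.1 x * sinK p.2 x) =
   \int[mu]_(x in `]0, d]) (g x * sinK p.2 x) +
   h p.1 d * \int[mu]_(x in `]0, d]) sinK p.2 x.
  rewrite -RintegralZl//; last exact: integrable_sinK.
  rewrite -RintegralD//; apply: eq_Rintegral => x _.
  by rewrite /g mulrBl subrK.
set I1 := \int[mu]_(x in `]0, d]) (g x * _); set Kn := Rintegral _ _ _.
have I1e : `|I1| <= 6 * e1.
  apply: (le_trans (norm_Rintegral_sinK_dominated N0 (ltW d0) (ltW e10) gd dsmall
    (fun c c0 _ => norm_Rintegral_sinK N0 (lexx _) c0))).
  by have -> : g d = 0 by [rewrite /g subrr]; rewrite normr0 add0r mulrA -natrM.
have Kn3 : `|Kn| <= 3 := norm_Rintegral_sinK N0 (lexx 0) (ltW d0).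
rewrite -/Kn in KN.
have -> : l0 * (pi / 2) - (I1 + h p.1 d * Kn + I2) =
   l0 * (pi / 2 - Kn) + ((l0 - l d) * Kn + (l d - h p.1 d) * Kn) - I1 - I2 by ring.
have -> : e = `|l0| * e1 + (e1 * 3 + e1 * 3) + 6 * e1 + e1.
  rewrite (_ : _ + e1 = e1 * c); last by rewrite /c; ring.
  by rewrite /e1 divfK ?gt_eqF.
do 2 (rewrite (le_trans (ler_normB _ _))// lerD//).
rewrite (le_trans (ler_normD _ _))// lerD//; first by rewrite normrM ler_wpM2l.
by rewrite (le_trans (ler_normD _ _))// lerD// normrM ler_pM.
Unshelve. all: by end_near. Qed.

Lemma dirichlet_jordan (b V l0 : R) (h : R -> R) : 0 < b -> 0 <= V ->
  variation_at_most 0 b h V -> h t @[t --> 0^'+] --> l0 ->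
  \int[mu]_(t in `]0, b]) (h t * sinK N t) @[N --> +oo] --> l0 * (pi / 2).
Proof.
move=> b0 V0 [phi hphi phiV] hl0.
have J : (fun MN : R * R => \int[mu]_(t in `]0, b]) (h t * sinK MN.2 t))
    @ filter_prod (pinfty_nbhs R) (pinfty_nbhs R) --> l0 * (pi / 2).
  apply: (@dirichlet_jordan_family b `|h b| V l0 (fun _ => h) phi h) => // t _ _.
  exact: cvg_cst.
have diag : (fun N : R => (N, N)) @ +oo --> filter_prod (pinfty_nbhs R) (pinfty_nbhs R).
  exact: (cvg_pair cvg_id cvg_id).
exact: (cvg_comp _ _ diag J).
Qed.

(** Bounded variation of [H] on a rectangle, in the form that integration in one
    variable at a time calls for: the curve [t |-> H ^~ t] has bounded variation,
    measured by [psi], for the norm of functions of bounded variation. *)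
Definition BV_curve (a b : R) (H : R -> R -> R) (psi : R -> R) :=
  forall t t', 0 < t -> t <= t' -> t' <= b ->
    (forall s, 0 < s -> s <= a -> `|H s t' - H s t| <= psi t' - psi t) /\
    variation_at_most 0 a (fun s => H s t' - H s t) (psi t' - psi t).

(** The inner integrals form a family of functions of [t] to which the
    one-dimensional theorem applies: the second mean value theorem turns the
    control of the curve [t |-> H ^~ t] into a control of their variation that
    does not depend on the parameter of the inner kernel. *)
Theorem dirichlet_jordan2 (a b V l0 : R) (H : R -> R -> R) (psi l : R -> R) :
  0 < a -> 0 < b -> 0 <= V -> BV_curve a b H psi ->
  (forall t : R, 0 < t -> t <= b -> psi b - psi t <= V) ->
  (forall t : R, 0 < t -> t <= b -> exists2 V' : R, 0 <= V' & variation_at_most 0 a (H ^~ t) V') ->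
  (forall t : R, 0 < t -> t <= b -> H s t @[s --> 0^'+] --> l t) ->
  l t @[t --> 0^'+] --> l0 ->
  (fun MN : R * R => \int[mu]_(t in `]0, b])
     ((\int[mu]_(s in `]0, a]) (H s t * sinK MN.1 s)) * sinK MN.2 t))
    @ filter_prod (pinfty_nbhs R) (pinfty_nbhs R) --> l0 * (pi / 2) * (pi / 2).
Proof.
move=> a0 b0 V0 Hpsi psiV HV Hl ll0.
have [V' V'0 [phi Hphi phiV]] := HV b b0 (lexx b).
(* An increment of the inner integral is at most
   [3 * (`|H a t' - H a t| + 2 * (psi t' - psi t)) <= 9 * (psi t' - psi t)]. *)
apply: (@dirichlet_jordan_family b (3 * (`|H a b| + 2 * V')) (9 * V) _
   (fun M t => \int[mu]_(s in `]0, a]) (H s t * sinK M s)) (fun t => 9 * psi t)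
   (fun t => l t * (pi / 2))) => //.
- by rewrite mulr_ge0.
- move=> M M0 t t' t0 tt' t'b; have [Hst [phi' Hphi' phiV']] := Hpsi _ _ t0 tt' t'b.
  have psi0 : 0 <= psi t' - psi t by exact: le_trans (Hst a a0 (lexx a)).
  have tb := le_trans tt' t'b; have t'0 := lt_le_trans t0 tt'.
  have [V1 _ [phi1 H1 phiV1]] := HV t t0 tb.
  have [V2 _ [phi2 H2 phiV2]] := HV t' t'0 t'b.
  have i1 := integrable_dominated_sinK (ltW M0) H1 phiV1.
  have i2 := integrable_dominated_sinK (ltW M0) H2 phiV2.
  rewrite -RintegralB//.
  under eq_Rintegral do rewrite -mulrBl.
  apply: (le_trans (norm_Rintegral_sinK_dominated M0 (ltW a0) psi0 Hphi' phiV'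
    (fun c c0 _ => norm_Rintegral_sinK M0 (lexx _) c0))).
  have := Hst a a0 (lexx a); lra.
- by move=> t t0 tb; have := psiV t t0 tb; lra.
- move=> M M0; apply: (norm_Rintegral_sinK_dominated M0 (ltW a0) V'0 Hphi phiV) => c c0 _.
  exact: norm_Rintegral_sinK.
- by move=> t t0 tb; have [Vt Vt0 HVt] := HV t t0 tb; apply: dirichlet_jordan HVt _ => //; exact: Hl.
- by apply: cvgMl.
Qed.

End dirichlet_jordan.

(** * Bounded variation on a rectangle *)
Section bounded_variation_rectangle.
Context {R : realType}.

Lemma itv_partition_merge (a b : R) (s t : seq R) :
  itv_partition a b s -> itv_partition a b t -> a < b ->
  exists u, [/\ itv_partition a b u, subseq s u & subseq t u].
Proof.
move=> [sa /eqP sb] [ta /eqP tb] ab.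
have bnd r x : path <%R a r -> last a r = b -> x \in r -> a < x <= b.
  move=> ra rb xr; have /= /allP ar := order_path_min lt_trans ra.
  have rp : itv_partition a b r by split => //; exact/eqP.
  have := @itv_partition_nth_le _ _ a b r (index x r).+1.
  by rewrite ltnS index_mem xr => /(_ isT rp)/=; rewrite nth_index// ar.
pose v := sort <=%R (undup [seq x <- s ++ t | x < b]).
have mem_v x : (x \in v) = ((x \in s) || (x \in t)) && (x < b).
  by rewrite mem_sort mem_undup mem_filter mem_cat andbC.
have v_sorted : sorted <%R v by rewrite sort_lt_sorted undup_uniq.
have v_bnd x : x \in v -> a < x < b.
  rewrite mem_v => /andP[/orP[xs|xt] xb].
    by have /andP[-> _] := bnd _ _ sa sb xs.
  by have /andP[-> _] := bnd _ _ ta tb xt.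
have v_path : path <%R a v.
  rewrite path_sortedE; last exact: lt_trans.
  by rewrite v_sorted andbT; apply/allP => x /v_bnd /andP[].
have u_path : path <%R a (rcons v b).
  rewrite rcons_path v_path/=; have := mem_last a v.
  by rewrite inE => /predU1P[->//|/v_bnd/andP[]].
have sub r : path <%R a r -> last a r = b ->
    (forall x, x \in r -> (x \in s) || (x \in t)) -> subseq r (rcons v b).
  move=> ra rb rst; suff -> : r = [seq x <- rcons v b | x \in r] by exact: filter_subseq.
  apply: lt_sorted_eq; first exact: path_sorted ra.
    apply: sorted_filter; first exact: lt_trans.
    exact: path_sorted u_path.
  move=> x; rewrite mem_filter mem_rcons inE; apply/idP/andP => [xr|[]//]; split=> //.
  have /andP[_] := bnd _ _ ra rb xr; rewrite le_eqVlt => /predU1P[->|xb].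
    by rewrite eqxx.
  by rewrite mem_v xb rst ?orbT.
exists (rcons v b); split.
- by split => //; rewrite last_rcons.
- by apply: sub => // x ->.
- by apply: sub => // x ->; rewrite orbT.
Qed.

(** The left end point is included here, unlike in [dominated], so that the
    interval can be cut and reflected about an inner point. *)
Definition dominated_on (a b : R) (h phi : R -> R) :=
  forall x y, a <= x -> x <= y -> y <= b -> `|h y - h x| <= phi y - phi x.

(** The total variation counted from [a] serves as [phi]. *)
Lemma variation_dominated (a b V : R) (h : R -> R) : a <= b ->
  (forall s, itv_partition a b s -> variation a b h s <= V) ->
  exists2 phi, dominated_on a b h phi & phi b - phi a <= V.
Proof.
move=> ab hV.
have bv : bounded_variation a b h by exists V => _ [s sp <-]; exact: hV.
have tv_fin x y : a <= x -> x <= y -> y <= b -> total_variation x y h \is a fin_num.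
  move=> ax xy yb; apply/bounded_variationP => //.
  apply: (bounded_variationl xy yb); apply: bounded_variationr bv => //.
  exact: le_trans yb.
exists (fun x => fine (total_variation a x h)).
  move=> x y ax xy yb; rewrite (total_variationD h ax xy) fineD ?tv_fin//;
    last exact: le_trans yb.
  by rewrite addrAC subrr add0r -lee_fin fineK ?tv_fin// total_variation_ge.
rewrite total_variationxx subr0 -lee_fin fineK ?tv_fin//.
by apply: ge_ereal_sup => _ [_ [s sp <-] <-]; rewrite lee_fin hV.
Qed.

Section strips.
Variables (a1 b1 a2 b2 : R) (g : R * R -> R).
Hypotheses (ab1 : a1 < b1) (ab2 : a2 < b2).

Let strip (s : seq R) (y y' : R) := variation a1 b1 (fun x => g (x, y') - g (x, y)) s.

(** A recursive form of the sum over consecutive points, with which a point is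
    easily appended to a subdivision. *)
Fixpoint path_sum (w : R -> R -> R) (x : R) (t : seq R) : R :=
  if t is y :: t' then w x y + path_sum w y t' else 0.

Lemma path_sum_rcons w x t z :
  path_sum w x (rcons t z) = path_sum w x t + w (last x t) z.
Proof.
by elim: t x => [|y t IH] x /=; [rewrite addr0 add0r|rewrite IH addrA].
Qed.

Lemma le_path_sum w w' x t : (forall y y', w y y' <= w' y y') ->
  path_sum w x t <= path_sum w' x t.
Proof. by move=> ww'; elim: t x => [|y t IH] x //=; rewrite lerD. Qed.

Lemma path_sumE w x z t :
  path_sum w x t = \sum_(0 <= j < size t) w (nth z (x :: t) j) (nth z (x :: t) j.+1).
Proof.
elim: t x => [|y t IH] x /=; first by rewrite big_nil.
by rewrite big_nat_recl//= IH.
Qed.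

Lemma variation2_path_sum s t :
  variation2 a1 b1 a2 b2 g s t = path_sum (strip s) a2 t.
Proof.
rewrite (path_sumE _ _ b2) /variation2 exchange_big/=; apply: eq_bigr => j _.
rewrite /strip /variation; apply: eq_bigr => i _ /=.
by congr `|_|; ring.
Qed.

Variable B : R.
Hypothesis gB : forall s t, itv_partition a1 b1 s -> itv_partition a2 b2 t ->
  variation2 a1 b1 a2 b2 g s t <= B.

Let strip_ge0 s y y' : 0 <= strip s y y'. Proof. exact: variation_ge0. Qed.

Let sums (c : R) : set R := [set r | exists s t,
  [/\ itv_partition a1 b1 s, itv_partition a2 c t & r = path_sum (strip s) a2 t]].

Let sums_has_sup c : a2 <= c -> c <= b2 -> has_sup (sums c).
Proof.
move=> ac cb; split.
  move: ac; rewrite le_eqVlt => /predU1P[<-|ac].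
    by exists 0, [:: b1], [::]; split => //; exact: itv_partition1.
  exists (path_sum (strip [:: b1]) a2 [:: c]), [:: b1], [:: c].
  by split => //; exact: itv_partition1.
exists B => _ [s [t [sp tp ->]]].
have /predU1P[cb'|cb'] : (c == b2) || (c < b2) by rewrite -le_eqVlt.
  by rewrite -variation2_path_sum; apply: gB => //; rewrite -cb'.
apply: (@le_trans _ _ (path_sum (strip s) a2 (rcons t b2))).
  by rewrite path_sum_rcons lerDl.
rewrite -variation2_path_sum; apply: gB => //.
case: tp => tp /eqP tc; split; last by rewrite last_rcons.
by rewrite rcons_path tp tc.
Qed.

(** The supremum of the variations over the nets of [a1, b1] x [a2, c], as a
    function of [c], serves as [psi]: appending a strip to a net adds the
    variation of the strip.  The subdivisions of [a1, b1] used by the net and by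
    the strip are first merged. *)
Lemma strip_superadditive : exists psi : R -> R,
  forall y y' s, a2 <= y -> y <= y' -> y' <= b2 -> itv_partition a1 b1 s ->
    strip s y y' <= psi y' - psi y.
Proof.
exists (fun c => sup (sums c)) => y y' s ay yy' yb sp.
have yb2 := le_trans yy' yb; have ay' := le_trans ay yy'.
move: yy'; rewrite le_eqVlt => /predU1P[<-|yy'].
  rewrite subrr /strip /variation big1// => i _ /=.
  by rewrite !subrr normr0.
rewrite lerBrDl -lerBrDr; apply: ge_sup; first by have [] := sums_has_sup ay yb2.
move=> _ [s' [t [s'p tp ->]]]; rewrite lerBrDr.
have [u [up s'u su]] := itv_partition_merge s'p sp ab1.
apply: (@le_trans _ _ (path_sum (strip u) a2 (rcons t y'))); last first.
  apply: ub_le_sup; first by have [] := sums_has_sup ay' yb.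
  exists u, (rcons t y'); split => //.
  case: tp => tp /eqP tc; split; last by rewrite last_rcons.
  by rewrite rcons_path tp tc.
have -> : path_sum (strip u) a2 (rcons t y') = path_sum (strip u) a2 t + strip u y y'.
  by rewrite path_sum_rcons; case: tp => _ /eqP ->.
rewrite lerD//; last exact: variation_subseq.
by apply: le_path_sum => z z'; exact: variation_subseq.
Qed.

End strips.

(** The variation of the curve is that of the section over [s0] plus that of the
    net, because the increment at any [s] differs from the increment at [s0] by a
    variation over a strip.  Likewise each section over [t] differs from the
    section over [t0] by a function of bounded variation. *)
Lemma BVF_curve (a1 b1 a2 b2 : R) (g : R * R -> R) : a1 < b1 -> a2 < b2 ->
  BVF a1 b1 a2 b2 g ->
  (exists psi : R -> R, forall t t', a2 <= t -> t <= t' -> t' <= b2 ->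
    (forall s, a1 <= s -> s <= b1 -> `|g (s, t') - g (s, t)| <= psi t' - psi t) /\
    exists2 phi, dominated_on a1 b1 (fun s => g (s, t') - g (s, t)) phi &
      phi b1 - phi a1 <= psi t' - psi t) /\
  (forall t, a2 <= t -> t <= b2 -> exists phi, dominated_on a1 b1 (fun s => g (s, t)) phi).
Proof.
move=> ab1 ab2 [[B gB] [s0 s0ab [Bs gs0]] [t0 t0ab [Bt gt0]]].
have [psi psiP] := strip_superadditive ab1 gB.
have [th thP _] := variation_dominated (ltW ab2)
  (fun s sp => gs0 _ (variations_variation _ sp)).
have [ph phP _] := variation_dominated (ltW ab1)
  (fun s sp => gt0 _ (variations_variation _ sp)).
move: s0ab t0ab; rewrite !in_itv/= => /andP[as0 s0b] /andP[at0 t0b].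
have Hstrip t t' : a2 <= t -> t <= t' -> t' <= b2 ->
    exists2 phi, dominated_on a1 b1 (fun s => g (s, t') - g (s, t)) phi &
      phi b1 - phi a1 <= psi t' - psi t.
  move=> at_ tt' t'b; apply: variation_dominated; first exact: ltW.
  by move=> s sp; exact: psiP.
split.
  exists (fun t => th t + psi t) => t t' at_ tt' t'b.
  have [phi phiP phiV] := Hstrip _ _ at_ tt' t'b.
  have th0 := thP _ _ at_ tt' t'b.
  split.
    move=> s as_ sb; have : `|(g (s, t') - g (s, t)) - (g (s0, t') - g (s0, t))| <=
        phi b1 - phi a1.
      have phimono x y : a1 <= x -> x <= y -> y <= b1 -> phi x <= phi y.
        by move=> ax xy yb; rewrite -subr_ge0 (le_trans _ (phiP _ _ ax xy yb)).
      have [ss0|s0s] := leP s s0.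
        rewrite distrC (le_trans (phiP _ _ as_ ss0 s0b))//.
        by rewrite lerB// phimono// (le_trans as0).
      rewrite (le_trans (phiP _ _ as0 (ltW s0s) sb))//.
      by rewrite lerB// phimono// (le_trans as0).
    move=> H; rewrite -[X in `|X|](subrK (g (s0, t') - g (s0, t))).
    rewrite (le_trans (ler_normD _ _))//.
    move: th0 phiV H => /=; lra.
  exists phi => //; apply: (le_trans phiV).
  have := le_trans (normr_ge0 _) th0; lra.
move=> t at_ tb; have [tt0|t0t] := leP t t0.
  have [phi phiP _] := Hstrip _ _ at_ tt0 t0b.
  exists (fun s => ph s + phi s) => x y ax xy yb.
  have -> : g (y, t) - g (x, t) = (g (y, t0) - g (x, t0)) -
      ((g (y, t0) - g (y, t)) - (g (x, t0) - g (x, t))) by ring.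
  rewrite (le_trans (ler_normB _ _))//.
  have := phP _ _ ax xy yb; have := phiP _ _ ax xy yb; lra.
have [phi phiP _] := Hstrip _ _ at0 (ltW t0t) tb.
exists (fun s => ph s + phi s) => x y ax xy yb.
have -> : g (y, t) - g (x, t) = (g (y, t0) - g (x, t0)) +
    ((g (y, t) - g (y, t0)) - (g (x, t) - g (x, t0))) by ring.
rewrite (le_trans (ler_normD _ _))//.
have := phP _ _ ax xy yb; have := phiP _ _ ax xy yb; lra.
Qed.

End bounded_variation_rectangle.

(** * Contribution of each region of the quadrant *)
Section regions.
Context {R : realType}.
Notation mu := (@lebesgue_measure R).
Notation mu2 := (mu \x mu)%E.
Notation mR := (measurableTypeR R).
Notation oo2 := (filter_prod (pinfty_nbhs R) (pinfty_nbhs R)).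
Implicit Types (A B : set mR) (U : mR * mR -> R).

Let measurable_sinM1 (M : R) : measurable_fun [set: mR * mR] (fun p => sin (M * p.1)).
Proof.
apply: (measurableT_comp measurable_sin).
by apply: measurable_funM => //; exact: measurable_fst.
Qed.

Let measurable_sinM2 (M : R) : measurable_fun [set: mR * mR] (fun p => sin (M * p.2)).
Proof.
apply: (measurableT_comp measurable_sin).
by apply: measurable_funM => //; exact: measurable_snd.
Qed.

Lemma measurable_sinK1 (M : R) : measurable_fun [set: mR * mR] (fun p => sinK M p.1).
Proof. by apply: (measurableT_comp (measurable_sinK M)); exact: measurable_fst. Qed.

Lemma measurable_sinK2 (M : R) : measurable_fun [set: mR * mR] (fun p => sinK M p.2).
Proof. by apply: (measurableT_comp (measurable_sinK M)); exact: measurable_snd. Qed.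

Lemma near_oo2_fst (P : R -> Prop) :
  (\forall M \near +oo, P M) -> \forall p \near oo2, P p.1.
Proof. exact: near_prod_fst. Qed.

Lemma near_oo2_snd (P : R -> Prop) :
  (\forall M \near +oo, P M) -> \forall p \near oo2, P p.2.
Proof. exact: near_prod_snd. Qed.

(** For almost every [y] the inner integral tends to 0 by the one-dimensional
    lemma, and it is dominated by an integrable function of [y]; the bound so
    obtained holds for all values of the second parameter. *)
Lemma riemann_lebesgue2 A B U : measurable A -> measurable B ->
  mu2.-integrable (A `*` B) (EFin \o U) ->
  (fun MN : R * R =>
     \int[mu2]_(p in A `*` B) (U p * (sin (MN.1 * p.1) * sin (MN.2 * p.2)))) @ oo2 --> (0 : R).
Proof.
move=> mA mB Ui; have mAB : measurable (A `*` B) by exact: measurableX.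
have UMi M : mu2.-integrable (A `*` B) (EFin \o (fun p => U p * sin (M * p.1))).
  apply: (integrable_mul_bounded (M := 1)) => //; first exact: measurable_funTS.
  by move=> x _; exact: sin_max.
have UMNi M N : mu2.-integrable (A `*` B)
    (EFin \o (fun p => U p * (sin (M * p.1) * sin (N * p.2)))).
  apply: (integrable_mul_bounded (M := 1)) => //.
    by apply: measurable_funTS; exact: measurable_funM.
  by move=> x _; rewrite normrM -[leRHS]mulr1 ler_pM// sin_max.
pose J M y := \int[mu]_(x in A) (U (x, y) * sin (M * x)).
have JE M N : \int[mu2]_(p in A `*` B) (U p * (sin (M * p.1) * sin (N * p.2))) =
    \int[mu]_(y in B) (J M y * sin (N * y)).
  rewrite Rintegral_prod2//; apply: ae_eq_Rintegral_any.
  apply: (ae_imply _ (ae_integrable_section2 mA mB (UMi M))) => y yi By /=.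
  by under eq_Rintegral do rewrite mulrA; rewrite RintegralZr//; exact: yi.
have Ji M : mu.-integrable B (EFin \o J M) := integrable_Rintegral_section2 mA mB (UMi M).
suff H : \int[mu]_(y in B) `|J M y| @[M --> +oo] --> (0 : R).
  apply/cvgrPdist_le => e e0.
  have /cvgrPdist_le/(_ e e0) He := H.
  apply: filterS (near_oo2_fst He) => -[M N] /=; rewrite !sub0r !normrN => HM.
  apply: le_trans HM; rewrite JE; apply: le_trans (ler_norm _).
  apply: le_normr_Rintegral_bound => //.
  - apply: (integrable_mul_bounded (M := 1)) => //.
      by apply: measurable_funTS; apply: continuous_measurable_fun; exact: continuous_sinM.
    by move=> x _; exact: sin_max.
  - exact: integrable_norm.
  - by move=> y _; rewrite normrM ler_piMr// sin_max.
apply/cvg_pinftyP => u uoo.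
have nUi : mu2.-integrable (A `*` B) (EFin \o (fun p => `|U p|)) by exact: integrable_norm.
apply: (@Rintegral_dominated_cvg0 _ _ _ mu B (fun n y => `|J (u n) y|)
  (fun y => \int[mu]_(x in A) `|U (x, y)|)) => //.
- move=> n; apply: measurableT_comp => //.
  by apply/measurable_EFinP; exact: measurable_int (Ji _).
- apply: (ae_imply _ (ae_integrable_section2 mA mB Ui)) => y yi By.
  have := riemann_lebesgue_in mA (yi By) => /cvg_pinftyP/(_ u uoo) H.
  by rewrite -(normr0 R); exact: cvg_norm H.
- exact: (integrable_Rintegral_section2 (f := fun p => `|U p|) mA mB nUi).
- apply: (ae_imply _ (ae_integrable_section2 mA mB Ui)) => y yi n By.
  have yi' := yi By.
  rewrite normr_id; apply: le_normr_Rintegral_bound => //.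
  + apply: (integrable_mul_bounded (M := 1)) => //.
      by apply: measurable_funTS; apply: continuous_measurable_fun; exact: continuous_sinM.
    by move=> x _; exact: sin_max.
  + exact: integrable_norm.
  + by move=> x _; rewrite normrM ler_piMr// sin_max.
Qed.

Lemma integrable_mul_sinK2 A B U (M N : R) : measurable A -> measurable B ->
  0 <= M -> 0 <= N -> mu2.-integrable (A `*` B) (EFin \o U) ->
  mu2.-integrable (A `*` B) (EFin \o (fun p => U p * (sinK M p.1 * sinK N p.2))).
Proof.
move=> mA mB M0 N0 Ui; apply: (integrable_mul_bounded (M := M * N)) => //.
- exact: measurableX.
- apply: measurable_funTS; apply: measurable_funM.
    exact: measurable_sinK1.
  exact: measurable_sinK2.
- by move=> x _; rewrite normrM ler_pM// normr_sinK_le.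
Qed.

Let oy_gt (a x : R) : `]a, +oo[%classic x -> a < x.
Proof. by rewrite /= in_itv/= andbT. Qed.

Let norm_inv_oy (a x : R) : 0 < a -> a < x -> `|x^-1| <= a^-1.
Proof.
move=> a0 ax; have x0 := lt_trans a0 ax.
by rewrite ger0_norm ?invr_ge0 ?(ltW x0)// lef_pV2 ?posrE// ltW.
Qed.

Let near_oo2_gt0 : \forall MN \near oo2, 0 < MN.1 /\ 0 < MN.2.
Proof.
near=> MN; split; near: MN.
- by apply: (near_oo2_fst (P := fun M => 0 < M)); exact: nbhs_pinfty_gt.
- by apply: (near_oo2_snd (P := fun M => 0 < M)); exact: nbhs_pinfty_gt.
Unshelve. all: by end_near. Qed.

(** Both variables stay away from 0, so that [U / (x y)] is integrable. *)
Lemma far_region (a b : R) U : 0 < a -> 0 < b ->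
  mu2.-integrable (`]a, +oo[ `*` `]b, +oo[) (EFin \o U) ->
  (fun MN : R * R => \int[mu2]_(p in `]a, +oo[ `*` `]b, +oo[)
     (U p * (sinK MN.1 p.1 * sinK MN.2 p.2))) @ oo2 --> (0 : R).
Proof.
move=> a0 b0 Ui.
have mAB : measurable (`]a, +oo[%classic `*` `]b, +oo[%classic : set (mR * mR)).
  exact: measurableX.
have qi : mu2.-integrable (`]a, +oo[ `*` `]b, +oo[)
    (EFin \o (fun p : mR * mR => U p * (p.1^-1 * p.2^-1))).
  apply: (integrable_mul_bounded (M := a^-1 * b^-1)) => //.
    apply: measurable_funTS; apply: measurable_funM;
      apply: (measurableT_comp measurable_inv).
      exact: measurable_fst.
    exact: measurable_snd.
  move=> [x y] [/= /oy_gt ax /oy_gt by_]; rewrite normrM ler_pM//; exact: norm_inv_oy.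
have := riemann_lebesgue2 (measurable_itv _) (measurable_itv _) qi.
apply: cvg_trans; apply: near_eq_cvg; apply: filterS near_oo2_gt0 => -[M N] _ /=.
apply: eq_Rintegral => -[x y] /set_mem[/= /oy_gt ax /oy_gt by_].
have x0 := lt_trans a0 ax; have y0 := lt_trans b0 by_.
by rewrite !sinKE ?gt_eqF//; field; rewrite !gt_eqF.
Qed.

(** Once [G], which depends on the large variable only, is subtracted, what
    remains is integrable even after division by the small variable; the
    contribution of [G] itself is a product of one-dimensional integrals, one
    bounded and the other covered by the Riemann-Lebesgue lemma. *)
Lemma mixed_region (a b : R) U (G : mR -> R) : 0 < a -> 0 < b ->
  mu2.-integrable (`]0, a] `*` `]b, +oo[) (EFin \o U) ->
  mu.-integrable `]b, +oo[ (EFin \o G) ->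
  mu2.-integrable (`]0, a] `*` `]b, +oo[)
    (EFin \o (fun p : mR * mR => p.1^-1 * (U p - G p.2))) ->
  (fun MN : R * R => \int[mu2]_(p in `]0, a] `*` `]b, +oo[)
     (U p * (sinK MN.1 p.1 * sinK MN.2 p.2))) @ oo2 --> (0 : R).
Proof.
move=> a0 b0 Ui Gi qi.
set A := `]0, a]%classic; set B := `]b, +oo[%classic.
have mA : measurable (A : set mR) by exact: measurable_itv.
have mB : measurable (B : set mR) by exact: measurable_itv.
have mAB : measurable (A `*` B : set (mR * mR)) by exact: measurableX.
have q'i : mu2.-integrable (A `*` B)
    (EFin \o (fun p : mR * mR => p.1^-1 * (U p - G p.2) * p.2^-1)).
  apply: (integrable_mul_bounded (M := b^-1)) => //.
    apply: measurable_funTS; apply: (measurableT_comp measurable_inv).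
    exact: measurable_snd.
  by move=> [x y] [/= _ /oy_gt by_]; exact: norm_inv_oy.
have Gyi : mu.-integrable B (EFin \o (fun y => G y * y^-1)).
  apply: (integrable_mul_bounded (M := b^-1)) => //.
    by apply: measurable_funTS; exact: measurable_inv.
  by move=> y /oy_gt by_; exact: norm_inv_oy.
have I1 := riemann_lebesgue2 mA mB q'i.
have I2 := riemann_lebesgue_in mB Gyi.
have {}I2 : (fun MN : R * R => (\int[mu]_(x in A) sinK MN.1 x) *
    \int[mu]_(y in B) (G y * y^-1 * sin (MN.2 * y))) @ oo2 --> (0 : R).
  apply/cvgrPdist_le => e e0.
  have e30 : 0 < e / 3 by rewrite divr_gt0.
  have /cvgrPdist_le/(_ _ e30) He := I2.
  apply: filterS2 near_oo2_gt0 (near_oo2_snd He) => -[M N] [/= M0 _].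
  rewrite !sub0r !normrN normrM => HN.
  rewrite (_ : e = 3 * (e / 3)); last by field.
  by rewrite ler_pM// norm_Rintegral_sinK// ltW.
rewrite -(addr0 (0 : R)); apply: cvg_trans (cvgD I1 I2); apply: near_eq_cvg.
apply: filterS near_oo2_gt0 => -[M N] /= [/ltW M0 /ltW N0].
transitivity (\int[mu2]_(p in A `*` B) (p.1^-1 * (U p - G p.2) * p.2^-1 *
  (sin (M * p.1) * sin (N * p.2))) + (\int[mu]_(x in A) sinK M x) *
  \int[mu]_(y in B) (G y * y^-1 * sin (N * y))) => //.
have i1 : mu2.-integrable (A `*` B) (EFin \o (fun p : mR * mR =>
    p.1^-1 * (U p - G p.2) * p.2^-1 * (sin (M * p.1) * sin (N * p.2)))).
  apply: (integrable_mul_bounded (M := 1)) => //.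
    by apply: measurable_funTS; exact: measurable_funM.
  by move=> x _; rewrite normrM -[leRHS]mulr1 ler_pM// sin_max.
have i2 := integrable_mul_sinK2 mA mB M0 N0 Ui.
have GE p : (A `*` B) p -> G p.2 * sinK N p.2 * sinK M p.1 =
    U p * (sinK M p.1 * sinK N p.2) -
    p.1^-1 * (U p - G p.2) * p.2^-1 * (sin (M * p.1) * sin (N * p.2)).
  move=> [/=]; rewrite /A/= in_itv/= => /andP[x0 _] /oy_gt yb.
  have y0 := lt_trans b0 yb.
  by rewrite !sinKE ?gt_eqF//; field; rewrite !gt_eqF.
have i3 : mu2.-integrable (A `*` B)
    (EFin \o (fun p : mR * mR => G p.2 * sinK N p.2 * sinK M p.1)).
  apply: eq_integrable (integrable_subr mAB i2 i1) => // p /set_mem Ap /=.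
  by rewrite GE.
have -> : (\int[mu]_(x in A) sinK M x) * \int[mu]_(y in B) (G y * y^-1 * sin (N * y)) =
    \int[mu2]_(p in A `*` B) (G p.2 * sinK N p.2 * sinK M p.1).
  rewrite Rintegral_prod2//= -RintegralZl//; last first.
    apply: (integrable_mul_bounded (M := 1)) => //.
      by apply: measurable_funTS; apply: continuous_measurable_fun; exact: continuous_sinM.
    by move=> x _; exact: sin_max.
  apply: eq_Rintegral => y /set_mem/oy_gt yb; rewrite RintegralZl//; last first.
    exact: integrable_sinK.
  by rewrite sinKE ?gt_eqF ?(lt_trans b0)//; ring.
rewrite -RintegralD//; apply: eq_Rintegral => p /set_mem Ap.
by rewrite GE// addrCA subrr addr0.
Qed.

(** By Fubini's theorem the integral is iterated, and on almost every section [U]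
    may be replaced by [H], to which the two-dimensional Dirichlet-Jordan theorem
    applies. *)
Lemma near_region (a b V l0 : R) U (H : R -> R -> R) (psi l : R -> R) :
  0 < a -> 0 < b -> 0 <= V -> BV_curve a b H psi ->
  (forall t : R, 0 < t -> t <= b -> psi b - psi t <= V) ->
  (forall t : R, 0 < t -> t <= b -> exists2 V' : R, 0 <= V' & variation_at_most 0 a (H ^~ t) V') ->
  (forall t : R, 0 < t -> t <= b -> H s t @[s --> 0^'+] --> l t) ->
  l t @[t --> 0^'+] --> l0 ->
  mu2.-integrable (`]0, a] `*` `]0, b]) (EFin \o U) ->
  {ae mu2, forall p : mR * mR, H p.1 p.2 = U p} ->
  (fun MN : R * R => \int[mu2]_(p in `]0, a] `*` `]0, b])
     (U p * (sinK MN.1 p.1 * sinK MN.2 p.2))) @ oo2 --> l0 * (pi / 2) * (pi / 2).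
Proof.
move=> a0 b0 V0 Hpsi psiV HV Hl ll0 Ui HU.
have := dirichlet_jordan2 a0 b0 V0 Hpsi psiV HV Hl ll0.
apply: cvg_trans; apply: near_eq_cvg; apply: filterS near_oo2_gt0.
move=> -[M N] /= [/ltW M0 /ltW N0].
rewrite [RHS]Rintegral_prod2//; last exact: integrable_mul_sinK2.
apply: ae_eq_Rintegral_any; apply: (ae_imply _ (ae_prod2 HU)) => t tH tb /=.
have [V' _ [phi Hphi phiV]] : exists2 V' : R, 0 <= V' & variation_at_most 0 a (H ^~ t) V'.
  by move: tb => /=; rewrite in_itv/= => /andP[]; exact: HV.
rewrite -RintegralZr//; last exact: integrable_dominated_sinK Hphi phiV.
by apply: ae_eq_Rintegral_any; apply: (ae_imply _ tH) => s /= -> _; rewrite mulrA.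
Qed.

End regions.

(** * The quadrant *)
Section quadrant.
Context {R : realType}.
Notation mu := (@lebesgue_measure R).
Notation mu2 := (mu \x mu)%E.
Notation mR := (measurableTypeR R).
Notation oo2 := (filter_prod (pinfty_nbhs R) (pinfty_nbhs R)).
Implicit Types (A B : set mR) (U : mR * mR -> R).

Lemma integrable_swap A B U : measurable A -> measurable B ->
  mu2.-integrable (A `*` B) (EFin \o U) ->
  mu2.-integrable (B `*` A) (EFin \o (fun p => U (p.2, p.1))).
Proof.
move=> mA mB Ui.
have mAB : measurable (A `*` B) by exact: measurableX.
have mBA : measurable (B `*` A) by exact: measurableX.
have mswap : measurable_fun [set: mR * mR] (fun p : mR * mR => (p.2, p.1)).
  by apply/measurable_fun_pairP; split; [exact: measurable_snd|exact: measurable_fst].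
have := integrable_comp_preserving mswap lebesgue2_swap (integrable_restrictr mAB Ui).
move=> Ui'; apply/(integrable_mkcond _ mBA); apply: eq_integrable Ui' => // -[x y] _ /=.
rewrite !patchE/=.
have -> : ((y, x) \in A `*` B) = ((x, y) \in B `*` A).
  by apply/idP/idP => /set_mem[/= ? ?]; apply/mem_set.
by case: ifP.
Qed.

Lemma Rintegral_swap A B U : measurable A -> measurable B ->
  mu2.-integrable (A `*` B) (EFin \o U) ->
  \int[mu2]_(p in A `*` B) U p = \int[mu2]_(p in B `*` A) U (p.2, p.1).
Proof.
move=> mA mB Ui; rewrite Rintegral_prod2// Rintegral_prod1//.
exact: integrable_swap.
Qed.

Lemma cvg_oo2_swap : (fun p : R * R => (p.2, p.1)) @ oo2 --> oo2.
Proof.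
move=> P [[A B] /= [FA FB] AB]; exists (B, A) => //= -[x y] [/= Bx Ay].
exact: (AB (y, x)).
Qed.

Lemma setXUl A B (C : set mR) : (A `|` B) `*` C = (A `*` C) `|` (B `*` C).
Proof. by apply/seteqP; split => -[x y] /=; tauto. Qed.

Lemma setXUr A B (C : set mR) : C `*` (A `|` B) = (C `*` A) `|` (C `*` B).
Proof. by apply/seteqP; split => -[x y] /=; tauto. Qed.

Lemma mixed_region_swap (a b : R) U (G : mR -> R) : 0 < a -> 0 < b ->
  mu2.-integrable (`]a, +oo[ `*` `]0, b]) (EFin \o U) ->
  mu.-integrable `]a, +oo[ (EFin \o G) ->
  mu2.-integrable (`]a, +oo[ `*` `]0, b])
    (EFin \o (fun p : mR * mR => p.2^-1 * (U p - G p.1))) ->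
  (fun MN : R * R => \int[mu2]_(p in `]a, +oo[ `*` `]0, b])
     (U p * (sinK MN.1 p.1 * sinK MN.2 p.2))) @ oo2 --> (0 : R).
Proof.
move=> a0 b0 Ui Gi qi.
have mA : measurable (`]a, +oo[%classic : set mR) by exact: measurable_itv.
have mB : measurable (`]0, b]%classic : set mR) by exact: measurable_itv.
have := mixed_region b0 a0 (integrable_swap mA mB Ui) Gi (integrable_swap mA mB qi).
move=> /(cvg_comp _ _ cvg_oo2_swap); apply: cvg_trans; apply: near_eq_cvg.
have M0 := near_oo2_fst (nbhs_pinfty_ge (num_real (0 : R))).
have N0 := near_oo2_snd (nbhs_pinfty_ge (num_real (0 : R))).
apply: filterS2 M0 N0 => -[M N] /= M0 N0.
rewrite [RHS]Rintegral_swap//; last exact: integrable_mul_sinK2.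
by apply: eq_Rintegral => p _ /=; rewrite [sinK N _ * _]mulrC.
Qed.

Lemma itv0y_split (a : R) : 0 < a ->
  `]0, +oo[%classic = `]0, a]%classic `|` `]a, +oo[%classic :> set R.
Proof.
move=> a0; apply/seteqP; split => x /=; rewrite !in_itv/= !andbT.
  by move=> ->; have [|] := leP x a; [left|right].
by move=> [/andP[]//|]; exact: lt_trans.
Qed.

(** The quadrant is cut at [a] and [b] into four rectangles, only one of which
    contributes to the limit. *)
Theorem quadrant_cvg (a b V l0 : R) U (H : R -> R -> R) (psi l : R -> R)
    (Ga Gb : mR -> R) :
  0 < a -> 0 < b -> 0 <= V -> BV_curve a b H psi ->
  (forall t : R, 0 < t -> t <= b -> psi b - psi t <= V) ->
  (forall t : R, 0 < t -> t <= b -> exists2 V' : R, 0 <= V' & variation_at_most 0 a (H ^~ t) V') ->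
  (forall t : R, 0 < t -> t <= b -> H s t @[s --> 0^'+] --> l t) ->
  l t @[t --> 0^'+] --> l0 ->
  mu2.-integrable (`]0, +oo[ `*` `]0, +oo[) (EFin \o U) ->
  {ae mu2, forall p : mR * mR, H p.1 p.2 = U p} ->
  mu.-integrable `]b, +oo[ (EFin \o Ga) ->
  mu2.-integrable (`]0, a] `*` `]b, +oo[)
    (EFin \o (fun p : mR * mR => p.1^-1 * (U p - Ga p.2))) ->
  mu.-integrable `]a, +oo[ (EFin \o Gb) ->
  mu2.-integrable (`]a, +oo[ `*` `]0, b])
    (EFin \o (fun p : mR * mR => p.2^-1 * (U p - Gb p.1))) ->
  (fun MN : R * R => \int[mu2]_(p in `]0, +oo[ `*` `]0, +oo[)
     (U p * (sinK MN.1 p.1 * sinK MN.2 p.2))) @ oo2 --> l0 * (pi / 2) * (pi / 2).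
Proof.
move=> a0 b0 V0 Hpsi psiV HV Hl ll0 Ui HU Gai qai Gbi qbi.
have mQ : measurable (`]0, +oo[ `*` `]0, +oo[ : set (mR * mR)).
  by apply: measurableX; exact: measurable_itv.
have sub A B : measurable A -> measurable B -> A `<=` `]0, +oo[ -> B `<=` `]0, +oo[ ->
    mu2.-integrable (A `*` B) (EFin \o U).
  move=> mA mB AQ BQ; apply: integrableS Ui => //; first exact: measurableX.
  by move=> [x y] [/= /AQ ? /BQ ?].
have sa0 (c : R) : `]0, c]%classic `<=` `]0, +oo[%classic.
  by move=> x /=; rewrite !in_itv/= => /andP[->].
have say (c : R) : 0 < c -> `]c, +oo[%classic `<=` `]0, +oo[%classic.
  by move=> c0 x /=; rewrite !in_itv/= !andbT; exact: lt_trans.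
have I1 := near_region a0 b0 V0 Hpsi psiV HV Hl ll0
  (sub _ _ (measurable_itv _) (measurable_itv _) (@sa0 _) (@sa0 _)) HU.
have I2 := mixed_region a0 b0
  (sub _ _ (measurable_itv _) (measurable_itv _) (@sa0 _) (say _ b0)) Gai qai.
have I3 := mixed_region_swap a0 b0
  (sub _ _ (measurable_itv _) (measurable_itv _) (say _ a0) (@sa0 _)) Gbi qbi.
have I4 := far_region a0 b0
  (sub _ _ (measurable_itv _) (measurable_itv _) (say _ a0) (say _ b0)).
rewrite (_ : l0 * _ * _ = l0 * (pi / 2) * (pi / 2) + 0 + (0 + 0)); last by rewrite !addr0.
apply: cvg_trans (cvgD (cvgD I1 I2) (cvgD I3 I4)); apply: near_eq_cvg.
have M0 := near_oo2_fst (nbhs_pinfty_ge (num_real (0 : R))).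
have N0 := near_oo2_snd (nbhs_pinfty_ge (num_real (0 : R))).
apply: filterS2 M0 N0 => -[M N] /= M0 N0.
set K := fun p : mR * mR => U p * (sinK M p.1 * sinK N p.2).
have Ki A B : measurable A -> measurable B -> A `<=` `]0, +oo[ -> B `<=` `]0, +oo[ ->
    mu2.-integrable (A `*` B) (EFin \o K).
  by move=> mA mB AQ BQ; apply: integrable_mul_sinK2 => //; exact: sub.
have split2 A : measurable A -> A `<=` `]0, +oo[ ->
    \int[mu2]_(p in A `*` `]0, +oo[) K p =
    \int[mu2]_(p in A `*` `]0, b]) K p + \int[mu2]_(p in A `*` `]b, +oo[) K p.
  move=> mA AQ; rewrite (itv0y_split b0) setXUr Rintegral_setU//.
  - by apply: measurableX => //; exact: measurable_itv.
  - by apply: measurableX => //; exact: measurable_itv.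
  - by rewrite -setXUr -itv0y_split//; apply: Ki.
  - apply/disj_set2P; rewrite -subset0 => -[x y] [[/= _ +] [/= _ +]].
    by rewrite !in_itv/= andbT => /andP[_ yb] by_; move: (le_lt_trans yb by_); rewrite ltxx.
have QE : `]0, +oo[ `*` `]0, +oo[ =
    (`]0, a] `*` `]0, +oo[) `|` (`]a, +oo[ `*` `]0, +oo[) :> set (mR * mR).
  by rewrite -setXUl -itv0y_split.
rewrite QE Rintegral_setU//.
- rewrite -[RHS]/(\int[mu2]_(p in `]0, a] `*` `]0, +oo[) K p +
    \int[mu2]_(p in `]a, +oo[ `*` `]0, +oo[) K p).
  by rewrite !split2//; exact: say.
- by apply: measurableX => //; exact: measurable_itv.
- by apply: measurableX => //; exact: measurable_itv.
- by rewrite -QE; exact: Ki.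
- apply/disj_set2P; rewrite -subset0 => -[x y] [[/= + _] [/= + _]].
  by rewrite !in_itv/= andbT => /andP[_ xa] ax; move: (le_lt_trans xa ax); rewrite ltxx.
Qed.

End quadrant.

(** * Symmetrization about a point *)
Section fold.
Context {R : realType}.
Notation mu := (@lebesgue_measure R).
Notation mu2 := (mu \x mu)%E.
Notation mR := (measurableTypeR R).

Lemma Rintegral_fold (l : mR -> R) (c : R) : mu.-integrable setT (EFin \o l) ->
  \int[mu]_x l x = \int[mu]_(x in `]0, +oo[) (l (c - x) + l (c + x)).
Proof.
move=> li.
have S (D : set mR) : measurable D -> mu.-integrable D (EFin \o l).
  by move=> mD; exact: integrableS li.
have [mr pr] := lebesgue_preserving_reflect c.
have [mt pt] := lebesgue_preserving_translate c.
have lr := integrable_comp_preserving mr pr li.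
have lt := integrable_comp_preserving mt pt li.
have -> : [set: mR] = `]-oo, c[%classic `|` `[c, +oo[%classic.
  apply/seteqP; split => x //= _; rewrite !in_itv/= andbT.
  by have [|] := leP c x; [right|left].
rewrite Rintegral_setU//; last 2 first.
- apply: S; apply: measurableU; exact: measurable_itv.
- apply/disj_set2P; rewrite -subset0 => x [/=]; rewrite !in_itv/= andbT.
  by move=> xc /(lt_le_trans xc); rewrite ltxx.
rewrite -Rintegral_itv_obnd_cbnd; last exact: (S _ (measurable_itv _)).
rewrite (Rintegral_comp_preserving mr pr (D := `]-oo, c[%classic) (measurable_itv _) li).
rewrite (Rintegral_comp_preserving mt pt (D := `]c, +oo[%classic) (measurable_itv _) li).
have -> : (fun x : mR => c - x) @^-1` `]-oo, c[%classic = `]0, +oo[%classic.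
  by apply/seteqP; split => x /=; rewrite !in_itv/= andbT ltrBlDr ltrDl.
have -> : (fun x : mR => c + x) @^-1` `]c, +oo[%classic = `]0, +oo[%classic.
  by apply/seteqP; split => x /=; rewrite !in_itv/= !andbT ltrDl.
apply/esym; apply: RintegralD; first exact: measurable_itv.
- by apply: integrableS lr => //; exact: measurable_itv.
- by apply: integrableS lt => //; exact: measurable_itv.
Qed.

Definition fold2 (F : R * R -> R) (x0 y0 : R) (p : R * R) : R :=
  F (x0 - p.1, y0 - p.2) + F (x0 + p.1, y0 + p.2)
  + F (x0 - p.1, y0 + p.2) + F (x0 + p.1, y0 - p.2).

Let Q : set (mR * mR) := `]0, +oo[ `*` `]0, +oo[.
Let mQ : measurable Q. Proof. by apply: measurableX; exact: measurable_itv. Qed.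

Lemma integrable_pair_map (u v : mR -> mR) (L : mR * mR -> R) :
  lebesgue_preserving u -> lebesgue_preserving v ->
  mu2.-integrable setT (EFin \o L) ->
  mu2.-integrable setT (EFin \o (fun p => L (u p.1, v p.2))).
Proof.
move=> pu pv.
exact: (integrable_comp_preserving (measurable_pair_map pu pv) (lebesgue2_pair_map pu pv)).
Qed.

Lemma integrable_fold2 (L : mR * mR -> R) (x0 y0 : R) :
  mu2.-integrable setT (EFin \o L) -> mu2.-integrable setT (EFin \o fold2 L x0 y0).
Proof.
move=> Li.
have r := lebesgue_preserving_reflect; have t := lebesgue_preserving_translate.
have i1 := integrable_pair_map (r _ x0) (r _ y0) Li.
have i2 := integrable_pair_map (t _ x0) (t _ y0) Li.
have i3 := integrable_pair_map (r _ x0) (t _ y0) Li.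
have i4 := integrable_pair_map (t _ x0) (r _ y0) Li.
exact: (integrable_addr _ (integrable_addr _ (integrable_addr _ i1 i2) i3) i4).
Qed.

(** The kernels are even about [x0] and [y0], so that only the sum over the four
    reflections matters. *)
Lemma Rintegral_fold2 (L : mR * mR -> R) (x0 y0 : R) :
  mu2.-integrable setT (EFin \o L) ->
  \int[mu2]_p L p = \int[mu2]_(p in Q) fold2 L x0 y0 p.
Proof.
move=> Li.
have pid : lebesgue_preserving (id : mR -> mR) by split => //; exact: measurable_id.
have r := lebesgue_preserving_reflect x0; have t := lebesgue_preserving_translate x0.
pose Lx (p : mR * mR) := L (x0 - p.1, p.2) + L (x0 + p.1, p.2).
have Lxi : mu2.-integrable setT (EFin \o Lx).
  exact: integrable_addr (integrable_pair_map r pid Li) (integrable_pair_map t pid Li).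
have mA : measurable (`]0, +oo[%classic : set mR) by exact: measurable_itv.
have subT (A B : set mR) L' : measurable A -> measurable B ->
    mu2.-integrable setT (EFin \o L') -> mu2.-integrable (A `*` B) (EFin \o L').
  by move=> ? ? L'i; apply: integrableS L'i => //; exact: measurableX.
have TT : [set: mR * mR] = setT `*` setT by apply/seteqP; split.
have LiX : mu2.-integrable (setT `*` setT) (EFin \o L) by exact: subT.
pose J y := \int[mu]_(x in `]0, +oo[) Lx (x, y).
have Ji : mu.-integrable setT (EFin \o J).
  by apply: (integrable_Rintegral_section2 mA measurableT); exact: subT.
transitivity (\int[mu]_y J y).
  rewrite TT (Rintegral_prod2 measurableT measurableT LiX); apply: ae_eq_Rintegral_any.
  apply: (ae_imply _ (ae_integrable_section2 measurableT measurableT LiX)) => y yi _.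
  by rewrite (Rintegral_fold x0 (yi I)).
rewrite (Rintegral_fold y0 Ji) Rintegral_prod2//; last exact/subT/integrable_fold2.
pose pr := lebesgue_preserving_reflect y0; pose pt := lebesgue_preserving_translate y0.
have Ir := subT _ _ _ mA mA (integrable_pair_map pid pr Lxi).
have It := subT _ _ _ mA mA (integrable_pair_map pid pt Lxi).
apply: ae_eq_Rintegral_any.
apply: (ae_imply2 _ (ae_integrable_section2 mA mA It)
  (ae_integrable_section2 mA mA Ir)) => y yt yr y0y.
rewrite /J -RintegralD//; [|exact: yr|exact: yt].
by apply: eq_Rintegral => x _; rewrite /Lx /fold2 /=; ring.
Qed.

End fold.

(** * Quaternion algebra *)
Section quaternion_algebra.
Context {R : realType}.
Implicit Types (p q r : quat R).

Definition qI : quat R := Quat 0 1 0 0.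
Definition qJ : quat R := Quat 0 0 1 0.

Lemma quatP p q : [/\ qre p = qre q, qi p = qi q, qj p = qj q & qk p = qk q] -> p = q.
Proof.
move=> [h0 h1 h2 h3]; apply/rowP => -[[|[|[|[|//]]]] h].
- by move: h0; rewrite /qre; congr (p 0 _ = q 0 _); apply/val_inj; rewrite /= inordK.
- by move: h1; rewrite /qi; congr (p 0 _ = q 0 _); apply/val_inj; rewrite /= inordK.
- by move: h2; rewrite /qj; congr (p 0 _ = q 0 _); apply/val_inj; rewrite /= inordK.
- by move: h3; rewrite /qk; congr (p 0 _ = q 0 _); apply/val_inj; rewrite /= inordK.
Qed.

Lemma qmulA : associative (@qmul R).
Proof. by move=> p q r; apply: quatP; rewrite /qmul !(qreE, qiE, qjE, qkE); split; ring. Qed.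

Lemma expiD (x y : R) : expi (x + y) = expi x *q expi y.
Proof.
by apply: quatP; rewrite /expi /qmul !(qreE, qiE, qjE, qkE) cosD sinD; split; ring.
Qed.

Lemma expjD (x y : R) : expj (x + y) = expj x *q expj y.
Proof.
by apply: quatP; rewrite /expj /qmul !(qreE, qiE, qjE, qkE) cosD sinD; split; ring.
Qed.

(** Multiplication by a constant is linear over the reals; in this form it
    commutes with the integration of the components. *)
Lemma qmul_coefl p (n : 'I_4) : exists a b c d : R, forall q,
  (p *q q) 0 n = a * qre q + b * qi q + c * qj q + d * qk q.
Proof.
case: n => -[|[|[|[|//]]]] h.
- by exists (qre p), (- qi p), (- qj p), (- qk p) => q; rewrite mxE/=; ring.
- by exists (qi p), (qre p), (- qk p), (qj p) => q; rewrite mxE/=; ring.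
- by exists (qj p), (qk p), (qre p), (- qi p) => q; rewrite mxE/=; ring.
- by exists (qk p), (- qj p), (qi p), (qre p) => q; rewrite mxE/=; ring.
Qed.

Lemma qmul_coefr p (n : 'I_4) : exists a b c d : R, forall q,
  (q *q p) 0 n = a * qre q + b * qi q + c * qj q + d * qk q.
Proof.
case: n => -[|[|[|[|//]]]] h.
- by exists (qre p), (- qi p), (- qj p), (- qk p) => q; rewrite mxE/=; ring.
- by exists (qi p), (qre p), (qk p), (- qj p) => q; rewrite mxE/=; ring.
- by exists (qj p), (- qk p), (qre p), (qi p) => q; rewrite mxE/=; ring.
- by exists (qk p), (qj p), (- qi p), (qre p) => q; rewrite mxE/=; ring.
Qed.

Lemma qmul_expi (x : R) q n :
  (expi x *q q) 0 n = cos x * q 0 n + sin x * (qI *q q) 0 n.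
Proof.
suff -> : expi x *q q = cos x *: q + sin x *: (qI *q q) by rewrite !mxE.
by apply: quatP; rewrite {1 3 5 7}/qmul !(qreE, qiE, qjE, qkE);
  rewrite /qre /qi /qj /qk !mxE/= !inordK//= !(qreE, qiE, qjE, qkE);
  split; rewrite /qre /qi /qj /qk; ring.
Qed.

Lemma qmul_expj (x : R) q n :
  (q *q expj x) 0 n = cos x * q 0 n + sin x * (q *q qJ) 0 n.
Proof.
suff -> : q *q expj x = cos x *: q + sin x *: (q *q qJ) by rewrite !mxE.
by apply: quatP; rewrite {1 3 5 7}/qmul !(qreE, qiE, qjE, qkE);
  rewrite /qre /qi /qj /qk !mxE/= !inordK//= !(qreE, qiE, qjE, qkE);
  split; rewrite /qre /qi /qj /qk; ring.
Qed.

End quaternion_algebra.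

Section quaternion_integral.
Context d (T : measurableType d) (R : realType).
Variables (m : {measure set T -> \bar R}) (D : set T).
Hypothesis mD : measurable D.
Implicit Types (G : T -> quat R).

Definition qintegrable G := forall n : 'I_4, m.-integrable D (EFin \o (fun x => G x 0 n)).

Let integrable_lin G a b c e : qintegrable G -> m.-integrable D (EFin \o (fun x =>
  a * qre (G x) + b * qi (G x) + c * qj (G x) + e * qk (G x))).
Proof.
move=> Gi; repeat apply: integrable_addr => //; apply: integrable_scaler => //; exact: Gi.
Qed.

Let Rintegral_lin G a b c e : qintegrable G ->
  \int[m]_(x in D) (a * qre (G x) + b * qi (G x) + c * qj (G x) + e * qk (G x)) =
  a * qre (qintegral m D G) + b * qi (qintegral m D G) + c * qj (qintegral m D G)
  + e * qk (qintegral m D G).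
Proof.
move=> Gi; have s (r : R) n : m.-integrable D (EFin \o (fun x => r * G x 0 n)).
  exact: integrable_scaler.
rewrite RintegralD//; [|by repeat apply: integrable_addr => //; exact: s|exact: s].
rewrite RintegralD//; [|by repeat apply: integrable_addr => //; exact: s|exact: s].
rewrite RintegralD//; [|exact: s|exact: s].
rewrite !RintegralZl//; try exact: Gi.
by rewrite /qintegral /qre /qi /qj /qk !mxE.
Qed.

Lemma qintegrable_mull p G : qintegrable G -> qintegrable (fun x => p *q G x).
Proof.
move=> Gi n; have [a [b [c [e pE]]]] := qmul_coefl p n.
by under [X in EFin \o X]funext do rewrite pE; exact: integrable_lin.
Qed.

Lemma qintegrable_mulr p G : qintegrable G -> qintegrable (fun x => G x *q p).
Proof.
move=> Gi n; have [a [b [c [e pE]]]] := qmul_coefr p n.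
by under [X in EFin \o X]funext do rewrite pE; exact: integrable_lin.
Qed.

Lemma qintegral_mull p G : qintegrable G ->
  p *q qintegral m D G = qintegral m D (fun x => p *q G x).
Proof.
move=> Gi; apply/rowP => n; have [a [b [c [e pE]]]] := qmul_coefl p n.
by rewrite pE mxE -Rintegral_lin//; apply: eq_Rintegral => x _; rewrite pE.
Qed.

Lemma qintegral_mulr p G : qintegrable G ->
  qintegral m D G *q p = qintegral m D (fun x => G x *q p).
Proof.
move=> Gi; apply/rowP => n; have [a [b [c [e pE]]]] := qmul_coefr p n.
by rewrite pE mxE -Rintegral_lin//; apply: eq_Rintegral => x _; rewrite pE.
Qed.

Lemma qintegrable_expi (X : T -> R) G : measurable_fun D X -> qintegrable G ->
  qintegrable (fun x => expi (X x) *q G x).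
Proof.
move=> mX Gi n; under [X in EFin \o X]funext do rewrite qmul_expi mulrC [sin _ * _]mulrC.
apply: integrable_addr => //; apply: (integrable_mul_bounded (M := 1)) => //.
- by apply: measurableT_comp => //; exact: measurable_cos.
- by move=> x _; exact: cos_max.
- by apply: measurableT_comp => //; exact: measurable_sin.
- by move=> x _; exact: sin_max.
- exact: qintegrable_mull.
Qed.

Lemma qintegrable_expj (X : T -> R) G : measurable_fun D X -> qintegrable G ->
  qintegrable (fun x => G x *q expj (X x)).
Proof.
move=> mX Gi n; under [X in EFin \o X]funext do rewrite qmul_expj mulrC [sin _ * _]mulrC.
apply: integrable_addr => //; apply: (integrable_mul_bounded (M := 1)) => //.
- by apply: measurableT_comp => //; exact: measurable_cos.
- by move=> x _; exact: cos_max.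
- by apply: measurableT_comp => //; exact: measurable_sin.
- by move=> x _; exact: sin_max.
- exact: qintegrable_mulr.
Qed.

End quaternion_integral.

(** * Truncated inversion integrals *)
Section truncated_inversion.
Context {R : realType}.
Notation mu := (@lebesgue_measure R).
Notation mu2 := (mu \x mu)%E.
Notation mR := (measurableTypeR R).
Notation mR2 := (mR * mR)%type.

Lemma Rintegral_cos_sym (x M : R) : 0 <= M ->
  \int[mu]_(u in `[- M, M]) cos (x * u) = 2 * sinK M x.
Proof.
move=> M0; have NM : - M <= M by lra.
rewrite -Rintegral_itv_obnd_cbnd; last first.
  apply: (integrable_bounded (M := 1)) => //; first exact: lebesgue_itv_lty.
    by apply: measurable_funTS; apply: continuous_measurable_fun; exact: continuous_cosM.
  by move=> u _; exact: cos_max.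
rewrite /sinK; case: eqVneq => [->|x0].
  under eq_Rintegral do rewrite mul0r cos0.
  by rewrite Rintegral_cst// fine_lebesgue_itv//; ring.
have dF (u : R) : is_derive u 1 (fun u => sin (x * u) / x) (cos (x * u)).
  by apply: is_derive_eq; rewrite /GRing.scale/=; field.
rewrite (Rintegral_FTC NM dF); last exact: continuous_cosM.
by rewrite mulrN sinN mulNr opprK [x * M]mulrC; ring.
Qed.

Lemma Rintegral_sin_sym (x M : R) : 0 <= M ->
  \int[mu]_(u in `[- M, M]) sin (x * u) = 0.
Proof.
move=> M0; have NM : - M <= M by lra.
rewrite -Rintegral_itv_obnd_cbnd; last first.
  apply: (integrable_bounded (M := 1)) => //; first exact: lebesgue_itv_lty.
    by apply: measurable_funTS; apply: continuous_measurable_fun; exact: continuous_sinM.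
  by move=> u _; exact: sin_max.
have [->|x0] := eqVneq x 0.
  under eq_Rintegral do rewrite mul0r sin0.
  by rewrite Rintegral_cst// mul0r.
by rewrite Rintegral_sinM// mulrN cosN subrr mul0r.
Qed.

Section fubini_cos_sin.
Context d (T : measurableType d).
Variable m : {sigma_finite_measure set T -> \bar R}.

(** The frequency ranges over a bounded interval, so that a function integrable in
    space remains integrable as a function of space and frequency. *)
Lemma integrable_fst_itv (a : T -> R) (M : R) : m.-integrable setT (EFin \o a) ->
  (m \x mu)%E.-integrable (setT `*` `[- M, M]) (EFin \o (fun p => a p.1)).
Proof.
move=> ai; have mB : measurable (`[- M, M]%classic : set mR) by exact: measurable_itv.
have mTB : measurable ([set: T] `*` (`[- M, M]%classic : set mR)) by exact: measurableX.
have ma : measurable_fun setT a by apply/measurable_EFinP; exact: measurable_int ai.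
pose g (p : T * mR) := (a p.1 * \1_(`[- M, M]%classic : set mR) p.2)%R.
have mg : measurable_fun setT g.
  apply: measurable_funM; first by apply: (measurableT_comp ma); exact: measurable_fst.
  by apply: (measurableT_comp (measurable_indic mB)); exact: measurable_snd.
suff : (m \x mu)%E.-integrable setT (EFin \o g).
  move=> gi; apply: eq_integrable (integrableS measurableT mTB (@subsetT _ _) gi) => //.
  move=> [x y] /set_mem[/= _ yB]; rewrite /g/= indicE mem_set ?mulr1//.
apply/(@integrable21ltyP _ _ _ _ _ m mu (EFin \o g) ).
  exact/measurable_EFinP.
have -> : (\int[mu]_y \int[m]_x `|(EFin \o g) (x, y)| =
    \int[mu]_y ((\int[m]_x `|(a x)%:E|) * (\1_(`[- M, M]%classic : set mR) y)%:E))%E.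
  apply: eq_integral => y _.
  rewrite -ge0_integralZr//; last first.
    by apply: measurableT_comp => //; exact/measurable_EFinP.
  apply: eq_integral => x _ /=.
  by rewrite /g/= normrM EFinM; congr (_ * (_)%:E)%E; rewrite ger0_norm.
rewrite ge0_integralZl//; last 2 first.
- by apply/measurable_EFinP; exact: measurable_indic.
- exact: integral_ge0.
rewrite integral_indic// setIT lte_mul_pinfty//; first exact: integral_ge0.
- by rewrite ge0_fin_numE; [have /integrableP[] := ai|exact: integral_ge0].
- exact: lebesgue_itv_lty.
Qed.

Variables (X a b : T -> R) (M : R).
Hypotheses (M0 : 0 <= M) (mX : measurable_fun setT X).
Hypotheses (ai : m.-integrable setT (EFin \o a)) (bi : m.-integrable setT (EFin \o b)).

(** Exchanging the integrals, the sines disappear because the interval is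
    symmetric, and the cosines give the kernel. *)
Lemma fubini_cos_sin :
  \int[mu]_(u in `[- M, M]) \int[m]_p (cos (X p * u) * a p + sin (X p * u) * b p) =
  \int[m]_p (2 * sinK M (X p) * a p).
Proof.
have mB : measurable (`[- M, M]%classic : set mR) by exact: measurable_itv.
have mTB : measurable ([set: T] `*` (`[- M, M]%classic : set mR)) by exact: measurableX.
have mXu : measurable_fun setT (fun p : T * mR => X p.1 * p.2).
  apply: measurable_funM; last exact: measurable_snd.
  by apply: (measurableT_comp mX); exact: measurable_fst.
have gi : (m \x mu)%E.-integrable (setT `*` `[- M, M]) (EFin \o (fun p : T * mR =>
    a p.1 * cos (X p.1 * p.2) + b p.1 * sin (X p.1 * p.2))).
  apply: integrable_addr => //.
    apply: (integrable_mul_bounded (M := 1)) (integrable_fst_itv M ai) => //.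
      by apply: measurable_funTS; apply: (measurableT_comp _ mXu); exact: measurable_cos.
    by move=> p _; exact: cos_max.
  apply: (integrable_mul_bounded (M := 1)) (integrable_fst_itv M bi) => //.
    by apply: measurable_funTS; apply: (measurableT_comp _ mXu); exact: measurable_sin.
  by move=> p _; exact: sin_max.
transitivity (\int[(m \x mu)%E]_(p in setT `*` `[- M, M])
    (a p.1 * cos (X p.1 * p.2) + b p.1 * sin (X p.1 * p.2))).
  rewrite (Rintegral_prod2 measurableT mB gi).
  apply: eq_Rintegral => u _; apply: eq_Rintegral => p _ /=.
  by rewrite mulrC [sin _ * _]mulrC.
rewrite (Rintegral_prod1 measurableT mB gi); apply: eq_Rintegral => p _ /=.
have ci : mu.-integrable `[- M, M] (EFin \o (fun u => cos (X p * u))).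
  apply: (integrable_bounded (M := 1)) => //; first exact: lebesgue_itv_lty.
    by apply: measurable_funTS; apply: continuous_measurable_fun; exact: continuous_cosM.
  by move=> u _; exact: cos_max.
have si : mu.-integrable `[- M, M] (EFin \o (fun u => sin (X p * u))).
  apply: (integrable_bounded (M := 1)) => //; first exact: lebesgue_itv_lty.
    by apply: measurable_funTS; apply: continuous_measurable_fun; exact: continuous_sinM.
  by move=> u _; exact: sin_max.
rewrite RintegralD//; [|exact: integrable_scaler|exact: integrable_scaler].
by rewrite !RintegralZl// Rintegral_cos_sym// Rintegral_sin_sym//; ring.
Qed.

End fubini_cos_sin.

(** A name for the plane measure, which has to carry a structure of sigma-finite
    measure when the plane is one of the two factors of Fubini's theorem. *)
Definition plane_measure : set mR2 -> \bar R := mu2.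

HB.instance Definition _ := Measure.on plane_measure.

Let plane_sigma_finite : sigma_finite setT plane_measure.
Proof.
exists (fun n => `]- n%:R, n%:R] `*` `]- n%:R, n%:R]).
  apply/esym; rewrite -subTset => -[x y] _; pose z := Num.max `|x| `|y|.
  have z0 : 0 <= z by rewrite le_max normr_ge0.
  have zn := archi_boundP z0; exists (Num.bound z) => //=.
  have b (t : R) : `|t| <= z -> t \in `]- (Num.bound z)%:R, (Num.bound z)%:R].
    by move=> /le_lt_trans/(_ zn); rewrite ltr_norml in_itv/= => /andP[-> /ltW ->].
  by split; apply: b; rewrite le_max lexx ?orbT.
move=> n; split; first by apply: measurableX; exact: measurable_itv.
exact: lebesgue2_itv_lty.
Qed.

HB.instance Definition _ :=
  Measure_isSigmaFinite.Build _ _ _ plane_measure plane_sigma_finite.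

Lemma fubini_cos_sin2 (X a b : mR2 -> R) (M : R) : 0 <= M -> measurable_fun setT X ->
  mu2.-integrable setT (EFin \o a) -> mu2.-integrable setT (EFin \o b) ->
  \int[mu]_(u in `[- M, M]) \int[mu2]_p (cos (X p * u) * a p + sin (X p * u) * b p) =
  \int[mu2]_p (2 * sinK M (X p) * a p).
Proof. exact: (@fubini_cos_sin _ _ plane_measure). Qed.

Variables (f F : R * R -> quat R) (x0 y0 : R).
Hypothesis fF : {ae mu2, forall p : mR2, f p = F p}.
Hypothesis Fi : qintegrable mu2 [set: mR2] F.

Let mlin (x c : R) : measurable_fun [set: mR] (fun s : R => c * (s - x)).
Proof. by apply: measurable_funM => //; exact: measurable_funB. Qed.

Let mX (x c : R) : measurable_fun [set: mR2] (fun p : mR2 => c * (p.1 - x)).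
Proof. by apply: (measurableT_comp (mlin x c)); exact: measurable_fst. Qed.

Let mY (x c : R) : measurable_fun [set: mR2] (fun p : mR2 => c * (p.2 - x)).
Proof. by apply: (measurableT_comp (mlin x c)); exact: measurable_snd. Qed.

(** The outer exponentials are constants for the integration in space; taken
    inside, they recentre the inner exponentials at [(x0, y0)]. *)
Lemma QFT_translate (u v : R) :
  expi (u * x0) *q QFT f u v *q expj (v * y0) =
  qintegral mu2 [set: mR2]
    (fun p => expi (- u * (p.1 - x0)) *q (F p *q expj (- v * (p.2 - y0)))).
Proof.
have -> : QFT f u v = qintegral mu2 [set: mR2]
    (fun p => expi (- u * (p.1 - 0)) *q F p *q expj (- v * (p.2 - 0))).
  apply/rowP => n; rewrite !mxE; apply: ae_eq_Rintegral_any.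
  by apply: (ae_imply _ fF) => p -> _; rewrite !subr0 !mulNr.
rewrite qintegral_mull//; last exact/qintegrable_expj/qintegrable_expi.
rewrite qintegral_mulr//; last exact/qintegrable_mull/qintegrable_expj/qintegrable_expi.
congr qintegral; apply/funext => p; rewrite !qmulA -expiD -!qmulA -expjD.
by congr (expi _ *q (F p *q expj _)); ring.
Qed.

(** The exponential on the left is [cos (u X) - i sin (u X)] and the one on the
    right [cos (v Y) - sin (v Y) j].  Integration over symmetric intervals leaves
    [2 sinK M X] and [2 sinK N Y] times [F] itself, for which left and right no
    longer matter. *)
Theorem QFT_inversionE (M N : R) (n : 'I_4) : 0 <= M -> 0 <= N ->
  QFT_inversion f x0 y0 M N 0 n = (pi ^+ 2)^-1 *
    \int[mu2]_p (F p 0 n * (sinK M (p.1 - x0) * sinK N (p.2 - y0))).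
Proof.
move=> M0 N0; rewrite /QFT_inversion !mxE.
have mX1 : measurable_fun [set: mR2] (fun p : mR2 => p.1 - x0).
  by apply: measurable_funB => //; exact: measurable_fst.
have mY1 : measurable_fun [set: mR2] (fun p : mR2 => p.2 - y0).
  by apply: measurable_funB => //; exact: measurable_snd.
have FKi G : mu2.-integrable [set: mR2] (EFin \o G) ->
    mu2.-integrable [set: mR2] (EFin \o (fun p : mR2 => 2 * sinK M (p.1 - x0) * G p)).
  move=> Gi; under [X in EFin \o X]funext do rewrite mulrC.
  apply: (integrable_mul_bounded (M := 2 * M)) => //.
    by apply: measurable_funM => //; apply: (measurableT_comp (measurable_sinK M)).
  by move=> p _; rewrite normrM ger0_norm// ler_wpM2l// normr_sinK_le.
transitivity ((4 * pi ^+ 2)^-1 * \int[mu]_(v in `[- N, N])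
    \int[mu2]_p (2 * sinK M (p.1 - x0) * (F p *q expj (- v * (p.2 - y0))) 0 n)).
  congr (_ * _); apply: eq_Rintegral => v _; rewrite mxE.
  have Gi : qintegrable mu2 [set: mR2] (fun p => F p *q expj (- v * (p.2 - y0))).
    exact: qintegrable_expj.
  pose b p := - (qI *q (F p *q expj (- v * (p.2 - y0)))) 0 n.
  have bi : mu2.-integrable [set: mR2] (EFin \o b).
    rewrite (_ : b = fun p => -1 * (qI *q (F p *q expj (- v * (p.2 - y0)))) 0 n).
      by apply: integrable_scaler => //; exact: qintegrable_mull.
    by apply/funext => p; rewrite mulN1r.
  rewrite -(fubini_cos_sin2 M0 mX1 (Gi n) bi).
  apply: eq_Rintegral => u _; rewrite QFT_translate mxE; apply: eq_Rintegral => p _.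
  by rewrite qmul_expi mulNr cosN sinN /b [u * _]mulrC; ring.
rewrite invfM [4^-1 * _]mulrC -mulrA; congr (_ * _).
pose a p := 2 * sinK M (p.1 - x0) * F p 0 n.
pose b p := 2 * sinK M (p.1 - x0) * (- (F p *q qJ) 0 n).
have bi : mu2.-integrable [set: mR2] (EFin \o b).
  rewrite (_ : b = fun p => -1 * (2 * sinK M (p.1 - x0) * (F p *q qJ) 0 n)).
    by apply: integrable_scaler => //; apply: FKi; exact: qintegrable_mulr.
  by apply/funext => p; rewrite /b; ring.
transitivity (4^-1 * \int[mu2]_p (2 * sinK N (p.2 - y0) * a p)).
  congr (_ * _); rewrite -(fubini_cos_sin2 N0 mY1 (FKi _ (Fi n)) bi).
  apply: eq_Rintegral => v _; apply: eq_Rintegral => p _.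
  by rewrite qmul_expj mulNr cosN sinN /b [v * _]mulrC; ring.
rewrite -RintegralZl//.
  by apply: eq_Rintegral => p _; rewrite /a; field.
under [X in EFin \o X]funext do rewrite mulrC.
apply: (integrable_mul_bounded (M := 2 * N)) => //; last exact: FKi.
  by apply: measurable_funM => //; apply: (measurableT_comp (measurable_sinK N)).
by move=> p _; rewrite normrM ger0_norm// ler_wpM2l// normr_sinK_le.
Qed.

End truncated_inversion.

(** * Functions of bounded variation near a corner *)
Section corner.
Context {R : realType}.
Notation oo2 := (filter_prod (pinfty_nbhs R) (pinfty_nbhs R)).

Lemma variation_at_most_add (a b V V' : R) (h h' : R -> R) :
  variation_at_most a b h V -> variation_at_most a b h' V' ->
  variation_at_most a b (fun x => h x + h' x) (V + V').
Proof.
move=> [phi hphi phiV] [phi' hphi' phiV']; exists (fun x => phi x + phi' x).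
  move=> x y ax xy yb; rewrite (_ : _ - _ = (h y - h x) + (h' y - h' x)); last by ring.
  rewrite (_ : phi y + _ - _ = (phi y - phi x) + (phi' y - phi' x)); last by ring.
  by rewrite (le_trans (ler_normD _ _))// lerD// (hphi, hphi').
by move=> x ax xb; rewrite opprD addrACA lerD// (phiV, phiV').
Qed.

(** Bounded variation in the sense of Hardy and Krause on the half-open rectangle
    ]0, a] x ]0, b], in the form in which it is used: the sections [G ^~ t] form
    a curve of bounded variation. *)
Definition BV_corner (a b : R) (G : R -> R -> R) := exists psi V,
  [/\ 0 <= V, BV_curve a b G psi,
    forall t : R, 0 < t -> t <= b -> psi b - psi t <= V &
    forall t : R, 0 < t -> t <= b -> exists2 V' : R, 0 <= V' & variation_at_most 0 a (G ^~ t) V'].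

Lemma BV_corner_add (a b : R) (G G' : R -> R -> R) :
  BV_corner a b G -> BV_corner a b G' -> BV_corner a b (fun s t => G s t + G' s t).
Proof.
move=> [psi [V [V0 c bd sc]]] [psi' [V' [V0' c' bd' sc']]].
exists (fun t => psi t + psi' t), (V + V'); split.
- exact: addr_ge0.
- move=> t u t0 tu ub; have [c1 c2] := c _ _ t0 tu ub; have [c1' c2'] := c' _ _ t0 tu ub.
  rewrite (_ : psi u + _ - _ = (psi u - psi t) + (psi' u - psi' t)); last by ring.
  split.
    move=> s s0 sa.
    rewrite (_ : _ - _ = (G s u - G s t) + (G' s u - G' s t)); last by ring.
    by rewrite (le_trans (ler_normD _ _))// lerD//; [exact: c1|exact: c1'].
  have -> : (fun s => G s u + G' s u - (G s t + G' s t)) =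
      (fun s => (G s u - G s t) + (G' s u - G' s t)).
    by apply/funext => s; ring.
  exact: variation_at_most_add.
- by move=> t t0 tb; rewrite opprD addrACA lerD// (bd, bd').
- move=> t t0 tb; have [W W0 vW] := sc _ t0 tb; have [W' W0' vW'] := sc' _ t0 tb.
  exists (W + W'); first exact: addr_ge0.
  exact: variation_at_most_add.
Qed.

(** The variation over ]0, d] is small for small [d], uniformly in the other
    variable as far as the variation of the curve is concerned; hence the Cauchy
    criterion. *)
Lemma BV_corner_cvg (a b : R) (G : R -> R -> R) : 0 < a -> 0 < b -> BV_corner a b G ->
  exists (l : R -> R) (l0 : R), [/\
    forall t : R, 0 < t -> t <= b -> G s t @[s --> 0^'+] --> l t,
    l t @[t --> 0^'+] --> l0 &
    (fun p : R * R => G p.1 p.2) @ filter_prod 0^'+ 0^'+ --> l0].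
Proof.
move=> a0 b0 [psi [V [V0 c bd sc]]].
have small_s t (e : R) : 0 < t -> t <= b -> 0 < e ->
    \forall d \near 0^'+, forall s, 0 < s -> s <= d -> `|G d t - G s t| <= e.
  move=> t0 tb e0; have [V' _ [phi dphi phiV]] := sc _ t0 tb.
  have S := dominated_small_variation a0 e0 dphi phiV.
  near=> d => s s0 sd; apply: (@le_trans _ _ (phi d - phi s)).
    by apply: dphi => //; near: d; exact: nbhs_right_le.
  have : forall x : R, 0 < x -> x <= d -> phi d - phi x <= e by near: d.
  exact.
have small_t (e : R) : 0 < e ->
    \forall d \near 0^'+, forall s t, 0 < s -> s <= a -> 0 < t -> t <= d ->
      `|G s d - G s t| <= e.
  move=> e0.
  have dpsi : dominated 0 b psi psi.
    move=> t u t0 tu ub; have [c1 _] := c _ _ t0 tu ub.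
    by rewrite ger0_norm// (le_trans _ (c1 a a0 (lexx _))).
  have S := dominated_small_variation b0 e0 dpsi bd.
  near=> d => s t s0 sa t0 td.
  have db : d <= b by near: d; exact: nbhs_right_le.
  have [c1 _] := c _ _ t0 td db; rewrite (le_trans (c1 _ s0 sa))//.
  have : forall x : R, 0 < x -> x <= d -> psi d - psi x <= e by near: d.
  exact.
have cvg_s t : 0 < t -> t <= b -> cvg (G s t @[s --> 0^'+]).
  move=> t0 tb; apply/cauchy_cvgP/cauchyP => e e0.
  have e20 : 0 < e / 2 by rewrite divr_gt0.
  have [d [dP d0]] : exists d : R, (forall s, 0 < s -> s <= d ->
      `|G d t - G s t| <= e / 2) /\ 0 < d.
    near (0 : R)^'+ => d; exists d; split; near: d; first exact: small_s.
    exact: nbhs_right_gt.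
  exists (G d t); suff : \forall s \near 0^'+, `|G d t - G s t| < e by [].
  near=> s.
  apply: (@le_lt_trans _ _ (e / 2)); last by rewrite ltr_pdivrMr// ltr_pMr// ltr1n.
  apply: dP; near: s; first exact: nbhs_right_gt.
  exact: nbhs_right_le.
have cvg_p : cvg ((fun p : R * R => G p.1 p.2) @ filter_prod 0^'+ 0^'+).
  apply/cauchy_cvgP/cauchyP => e e0.
  have e30 : 0 < e / 3 by rewrite divr_gt0.
  have [t [tP t0 tb]] : exists t : R, [/\ (forall s u, 0 < s -> s <= a -> 0 < u ->
      u <= t -> `|G s t - G s u| <= e / 3), 0 < t & t <= b].
    near (0 : R)^'+ => t; exists t; split; near: t; first exact: small_t.
      exact: nbhs_right_gt.
    exact: nbhs_right_le.
  have [d [dP d0 da]] : exists d : R, [/\ (forall s, 0 < s -> s <= d ->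
      `|G d t - G s t| <= e / 3), 0 < d & d <= a].
    near (0 : R)^'+ => d; exists d; split; near: d; first exact: small_s.
      exact: nbhs_right_gt.
    exact: nbhs_right_le.
  exists (G d t).
  exists ([set s | 0 < s /\ s <= d], [set u | 0 < u /\ u <= t]) => /=.
    by split; near=> s; split; near: s; do ?[exact: nbhs_right_gt|exact: nbhs_right_le].
  move=> [s u] [/= [s0 sd] [u0 ut]]; rewrite /ball/=.
  have -> : G d t - G s u = (G d t - G s t) + (G s t - G s u) by ring.
  rewrite (le_lt_trans (ler_normD _ _))//.
  rewrite (@le_lt_trans _ _ (e / 3 + e / 3))//; last lra.
  by rewrite lerD// (dP, tP)// (le_trans sd).
exists (fun t => lim (G s t @[s --> 0^'+])),
  (lim ((fun p : R * R => G p.1 p.2) @ filter_prod 0^'+ 0^'+)); split => //.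
apply/cvgrPdist_le => e e0.
have /cvgrPdist_le/(_ _ e0) [[A B] /= [A0 B0] AB] := cvg_p.
near=> t.
have t0 : 0 < t by near: t; exact: nbhs_right_gt.
have tb : t <= b by near: t; exact: nbhs_right_le.
have Bt : B t by near: t.
have : (`|lim ((fun p : R * R => G p.1 p.2) @ filter_prod 0^'+ 0^'+) - G s t|
    @[s --> 0^'+] --> `|lim ((fun p : R * R => G p.1 p.2) @ filter_prod 0^'+ 0^'+) -
      lim (G s t @[s --> 0^'+])|).
  by apply: cvg_norm; apply: cvgB; [exact: cvg_cst|exact: cvg_s].
move=> /cvgr_to_le; apply; near=> s; apply: (AB (s, t)); split => //=.
by near: s.
Unshelve. all: by end_near. Qed.

End corner.

Section corners_of_BVF.
Context {R : realType}.

Lemma variation_at_most_le (a b V V' : R) (h : R -> R) : V <= V' ->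
  variation_at_most a b h V -> variation_at_most a b h V'.
Proof.
move=> VV' [phi hphi phiV]; exists phi => // x ax xb.
exact: le_trans (phiV _ ax xb) VV'.
Qed.

(** The two directions in which a coordinate may leave the point [c]. *)
Definition ray (c : R) (u : R -> R) := u = (fun s => c + s) \/ u = (fun s => c - s).

Lemma dominated_on_ge (a b : R) (h phi : R -> R) x y : dominated_on a b h phi ->
  a <= x -> x <= y -> y <= b -> phi x <= phi y.
Proof. by move=> hphi ax xy yb; rewrite -subr_ge0 (le_trans _ (hphi _ _ ax xy yb)). Qed.

Lemma dominated_on_ray (c e : R) (u h phi : R -> R) : 0 < e -> ray c u ->
  dominated_on (c - e) (c + e) h phi ->
  variation_at_most 0 e (h \o u) (phi (c + e) - phi (c - e)).
Proof.
move=> e0 [->|->] hphi.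
  exists (fun s => phi (c + s)) => [x y x0 xy ye|x x0 xe] /=.
    by apply: hphi; lra.
  by rewrite lerD2l lerN2; apply: (dominated_on_ge hphi); lra.
exists (fun s => - phi (c - s)) => [x y x0 xy ye|x x0 xe] /=.
  rewrite distrC (_ : - phi _ - _ = phi (c - x) - phi (c - y)); last by ring.
  by apply: hphi; lra.
rewrite opprK addrC lerD2r; apply: (dominated_on_ge hphi); lra.
Qed.

Lemma ray_itv (c e s : R) (u : R -> R) : ray c u -> 0 < s -> s <= e ->
  c - e <= u s <= c + e.
Proof. by move=> [->|->] s0 se; apply/andP; split; lra. Qed.

Lemma BVF_corner (x0 y0 e1 e2 : R) (g : R * R -> R) (u v : R -> R) :
  0 < e1 -> 0 < e2 -> BVF (x0 - e1) (x0 + e1) (y0 - e2) (y0 + e2) g ->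
  ray x0 u -> ray y0 v -> BV_corner e1 e2 (fun s t => g (u s, v t)).
Proof.
move=> e10 e20 gBV ru rv.
have ex : x0 - e1 < x0 + e1 by lra.
have ey : y0 - e2 < y0 + e2 by lra.
have [[psi psiP] sections] := BVF_curve ex ey gBV.
(* [inc] is symmetric in its two times: on a ray that points downwards the curve
   is run backwards. *)
pose inc y y' w := (forall s, x0 - e1 <= s -> s <= x0 + e1 -> `|g (s, y') - g (s, y)| <= w) /\
    exists2 phi, dominated_on (x0 - e1) (x0 + e1) (fun s => g (s, y') - g (s, y)) phi &
      phi (x0 + e1) - phi (x0 - e1) <= w.
have incC y y' w : inc y y' w -> inc y' y w.
  move=> [i1 [phi i2 i3]]; split; first by move=> s ? ?; rewrite distrC; exact: i1.
  exists phi => // s s' ? ? ?; rewrite (le_trans _ (i2 _ _ _ _ _))// distrC.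
  by rewrite -(opprB (g (s', y'))) -(opprB (g (s, y'))) opprK addrC.
have psi_ge y y' : y0 - e2 <= y -> y <= y' -> y' <= y0 + e2 -> psi y <= psi y'.
  move=> h1 h2 h3; have [c1 _] := psiP _ _ h1 h2 h3.
  by rewrite -subr_ge0 (le_trans _ (c1 x0 _ _))//; lra.
have [psi' [psi'P psi'V]] : exists psi' : R -> R,
    (forall t t', 0 < t -> t <= t' -> t' <= e2 -> inc (v t) (v t') (psi' t' - psi' t)) /\
    (forall t, 0 < t -> t <= e2 -> psi' e2 - psi' t <= psi (y0 + e2) - psi (y0 - e2)).
  case: rv => ->.
    exists (fun t => psi (y0 + t)); split => [t t' t0 tt' te|t t0 te].
      by apply: psiP; lra.
    by rewrite lerD2l lerN2; apply: psi_ge; lra.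
  exists (fun t => - psi (y0 - t)); split => [t t' t0 tt' te|t t0 te].
    rewrite (_ : - psi _ - _ = psi (y0 - t) - psi (y0 - t')); last by ring.
    by apply: incC; apply: psiP; lra.
  by rewrite opprK addrC lerD2r; apply: psi_ge; lra.
exists psi', (psi (y0 + e2) - psi (y0 - e2)); split => //.
- by rewrite subr_ge0; apply: psi_ge; lra.
- move=> t t' t0 tt' te; have [i1 [phi i2 i3]] := psi'P _ _ t0 tt' te; split.
    by move=> s s0 se; have /andP[] := ray_itv ru s0 se; exact: i1.
  by apply: variation_at_most_le i3 _; exact: (dominated_on_ray e10 ru i2).
- move=> t t0 te; have /andP[v1 v2] := ray_itv rv t0 te.
  have [phi hphi] := sections _ v1 v2.
  exists (phi (x0 + e1) - phi (x0 - e1)).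
    by rewrite subr_ge0; apply: (dominated_on_ge hphi); lra.
  exact: (dominated_on_ray e10 ru hphi).
Qed.

Lemma cvg_ray_right (c : R) : (fun x => x - c) @ c^'+ --> 0^'+.
Proof.
move=> A /nbhs_ballP[e /= e0 eA]; apply/nbhs_ballP; exists e => //= x cx xc /=.
apply: eA; last by rewrite subr_gt0.
by move: cx; rewrite /ball/= sub0r opprB.
Qed.

Lemma cvg_ray_left (c : R) : (fun x => c - x) @ c^'- --> 0^'+.
Proof.
move=> A /nbhs_ballP[e /= e0 eA]; apply/nbhs_ballP; exists e => //= x cx xc /=.
apply: eA; last by rewrite subr_gt0.
by move: cx; rewrite /ball/= sub0r normrN.
Qed.

Lemma cvg_filter_prod_map (T1 T2 U1 U2 : Type) (F1 : set_system T1) (F2 : set_system T2)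
    (G1 : set_system U1) (G2 : set_system U2) (h1 : T1 -> U1) (h2 : T2 -> U2) :
  h1 @ F1 --> G1 -> h2 @ F2 --> G2 ->
  (fun p => (h1 p.1, h2 p.2)) @ filter_prod F1 F2 --> filter_prod G1 G2.
Proof.
move=> hF1 hF2 P [[A B] /= [GA GB] AB].
exists (h1 @^-1` A, h2 @^-1` B) => /=; first by split; [exact: hF1|exact: hF2].
by move=> [x y] [/= Ax By]; exact: (AB (h1 x, h2 y)).
Qed.

End corners_of_BVF.

(** * Borel representatives *)
Section borel_representative.
Context d (T : measurableType d) (R : realType).
Implicit Types (f g : T -> quat R).

Lemma norm_coord_qmod (q : quat R) n : `|q 0 n| <= qmod q.
Proof.
rewrite /qmod -sqrtr_sqr ler_wsqrtr// (bigD1 n)//= lerDl.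
by apply: sumr_ge0 => i _; exact: sqr_ge0.
Qed.

Lemma measurable_qmod (D : set T) g : (forall n : 'I_4, measurable_fun D (fun x => g x 0 n)) ->
  measurable_fun D (fun x => qmod (g x)).
Proof.
move=> mg; rewrite /qmod.
apply: (measurableT_comp (f := @Num.sqrt R)).
  by apply: continuous_measurable_fun; exact: sqrt_continuous.
by apply: measurable_sum => n; exact: measurable_funX.
Qed.

(** A member of [L1] is almost everywhere equal to a Borel function, to which the
    theory of integrable functions applies. *)
Lemma L1_representative (m : {measure set T -> \bar R}) f : L1 m f ->
  exists2 g, {ae m, forall x, f x = g x} & qintegrable m [set: T] g.
Proof.
move=> [[g [mg fg]] fi]; exists g => // n.
have mq := measurable_qmod mg.
apply: (@integrable_le _ _ _ _ _ _ (fun x => qmod (g x))) => //; last first.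
  by move=> x _; exact: norm_coord_qmod.
apply/integrableP; split; first exact/measurable_EFinP.
apply: le_lt_trans fi; rewrite le_eqVlt; apply/orP; left; apply/eqP.
apply: ae_eq_integral_any; apply: (ae_imply _ fg) => x -> _ /=.
by rewrite ger0_norm// sqrtr_ge0.
Qed.

End borel_representative.

Section LC_representative.
Context {R : realType}.
Notation mu := (@lebesgue_measure R).
Notation mu2 := (mu \x mu)%E.
Notation mR := (measurableTypeR R).
Notation mR2 := (mR * mR)%type.

Lemma integrable_iterated (A B : set mR) (q : mR2 -> R) : measurable A -> measurable B ->
  measurable_fun setT q -> (forall p, 0 <= q p) ->
  (\int[mu]_(y in B) \int[mu]_(x in A) (q (x, y))%:E < +oo)%E ->
  mu2.-integrable (A `*` B) (EFin \o q).
Proof.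
move=> mA mB mq q0 qfin.
have mAB : measurable (A `*` B) by exact: measurableX.
apply/(integrable_mkcond _ mAB).
have mr : measurable_fun setT ((EFin \o q) \_ (A `*` B)).
  apply/(measurable_restrictT _ mAB); apply: measurable_funTS; exact/measurable_EFinP.
apply/(@integrable21ltyP _ _ _ _ _ mu mu _ mr).
apply: le_lt_trans qfin; rewrite le_eqVlt; apply/orP; left; apply/eqP.
rewrite [RHS]integral_mkcond; apply: eq_integral => y _; rewrite patchE; case: ifPn => yB.
  rewrite [RHS]integral_mkcond; apply: eq_integral => x _; rewrite !patchE.
  have -> : ((x, y) \in A `*` B) = (x \in A).
    apply/idP/idP => [/set_mem[/= xA _]|/set_mem xA]; apply/mem_set => //.
    by split => //; exact: set_mem.
  by case: ifP => _; rewrite ?abse0// gee0_abs// lee_fin.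
rewrite integral0_eq// => x _; rewrite patchE memNset ?abse0// => -[_ /= /mem_set].
exact/negP.
Qed.

(** The iterated integral of the class [LC] involves the function itself, whose
    sections need not be Borel.  Its value is that of the iterated integral of a
    Borel representative, by which Tonelli's theorem yields integrability on the
    product.  The function [G] stands for the section over [a]. *)
Lemma LC_representative (S : R -> R -> quat R) (SB : mR2 -> quat R) (a e1 e2 : R) :
  (forall n : 'I_4, measurable_fun [set: mR2] (fun p => SB p 0 n)) ->
  {ae mu2, forall p : mR2, S p.1 p.2 = SB p} ->
  L1 mu (S a) ->
  (\int[mu]_(t in `[e2, +oo[) \int[mu]_(s in `]0%R, e1])
      (qmod (s^-1 *: (S s t - S a t)))%:E < +oo)%E ->
  exists G : mR -> quat R, forall n : 'I_4,
    mu.-integrable `]e2, +oo[ (EFin \o (fun t => G t 0 n)) /\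
    mu2.-integrable (`]0, e1] `*` `]e2, +oo[)
      (EFin \o (fun p : mR2 => p.1^-1 * (SB p 0 n - G p.2 0 n))).
Proof.
move=> mSB SSB Sa Sfin; have [G SaG Gi] := L1_representative Sa.
have mB : measurable (`[e2, +oo[%classic : set mR) by exact: measurable_itv.
have mA : measurable (`]0, e1]%classic : set mR) by exact: measurable_itv.
have mB' : measurable (`]e2, +oo[%classic : set mR) by exact: measurable_itv.
exists G => n; split; first by apply: integrableS (Gi n).
pose W (p : mR2) : quat R := p.1^-1 *: (SB p - G p.2).
have mW k : measurable_fun [set: mR2] (fun p => W p 0 k).
  under eq_fun do rewrite !mxE.
  apply: measurable_funM.
    by apply: (measurableT_comp measurable_inv); exact: measurable_fst.
  apply: measurable_funB; first exact: mSB.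
  apply: (measurableT_comp (f := fun t => G t 0 k)); last exact: measurable_snd.
  by apply/measurable_EFinP; exact: measurable_int (Gi k).
have Wi : mu2.-integrable (`]0, e1] `*` `[e2, +oo[) (EFin \o (fun p => qmod (W p))).
  apply: (integrable_iterated mA mB); first exact: measurable_qmod.
    by move=> p; exact: sqrtr_ge0.
  apply: le_lt_trans Sfin; rewrite le_eqVlt; apply/orP; left; apply/eqP.
  apply: ae_eq_integral_any; apply: (ae_imply2 _ (ae_prod2 SSB) SaG) => t tS tG _.
  apply: ae_eq_integral_any; apply: (ae_imply _ tS) => s /= sS _.
  by rewrite /W/= -sS tG.
have : mu2.-integrable (`]0, e1] `*` `[e2, +oo[) (EFin \o (fun p => W p 0 n)).
  apply: integrable_le Wi _ => //; first exact: measurableX.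
    exact: measurable_funTS.
  by move=> p _; exact: norm_coord_qmod.
have sub : (`]0, e1] `*` `]e2, +oo[ : set mR2) `<=` `]0, e1] `*` `[e2, +oo[.
  move=> [s t] [/= ? +]; rewrite !in_itv/= !andbT => ?; split => //.
  exact: ltW.
move=> /(integrableS _ _ sub) H.
have {}H := H (measurableX mA mB) (measurableX mA mB').
by apply: eq_integrable H => // [|p _]; [exact: measurableX|rewrite /= !mxE].
Qed.

End LC_representative.

(** * The inversion theorem *)
Section quaternion_limits.
Context {R : realType}.

Lemma cvg_quat (T : Type) (F : set_system T) {FF : Filter F} (f : T -> quat R) (q : quat R) :
  (forall n : 'I_4, f x 0 n @[x --> F] --> q 0 n) -> f @ F --> q.
Proof.
move=> fq A [P qP PA].
have : \forall x \near F, forall n : 'I_4, P 0 n (f x 0 n).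
  by apply: filter_forall => n; exact: (fq n _ (qP 0 n)).
by apply: filterS => x fP; apply: PA => i n; rewrite ord1.
Qed.

Lemma cvg_corner (f : R * R -> quat R) (q : quat R) (F1 F2 : set_system R)
    (u u' v v' : R -> R) {FF1 : Filter F1} {FF2 : Filter F2} :
  cancel u' u -> cancel v' v -> u' @ F1 --> 0^'+ -> v' @ F2 --> 0^'+ ->
  (forall n : 'I_4, (fun p : R * R => f (u p.1, v p.2) 0 n) @ filter_prod 0^'+ 0^'+ --> q 0 n) ->
  f @ filter_prod F1 F2 --> q.
Proof.
move=> uK vK uF vF fq; apply: cvg_quat => n.
have := cvg_comp _ _ (cvg_filter_prod_map uF vF) (fq n).
by apply: cvg_trans; apply: near_eq_cvg; near=> p; rewrite /= uK vK -surjective_pairing.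
Unshelve. all: by end_near. Qed.

End quaternion_limits.

Section inversion.
Context {R : realType}.
Notation mu := (@lebesgue_measure R).
Notation mu2 := (mu \x mu)%E.
Notation mR := (measurableTypeR R).
Notation mR2 := (mR * mR)%type.
Variables (f : R * R -> quat R) (x0 y0 e1 e2 : R).
Hypotheses (e1_gt0 : 0 < e1) (e2_gt0 : 0 < e2).
Hypothesis fBV : QBVF_in (cross_nbhd x0 y0 e1 e2) f.

Let plus (c x : R) := c + x.
Let minus (c x : R) := c - x.

Let ray_plus (c : R) : ray c (plus c). Proof. by left. Qed.
Let ray_minus (c : R) : ray c (minus c). Proof. by right. Qed.

Let corner u v n : ray x0 u -> ray y0 v -> BV_corner e1 e2 (fun s t => f (u s, v t) 0 n).
Proof.
move=> ru rv; apply: (BVF_corner (g := fun p => f p 0 n)) ru rv => //.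
have pm (c e : R) : 0 < e -> c - e < c + e.
  by move=> e0; rewrite ltrBlDr -addrA ltrDl addr_gt0.
apply: (fBV (pm _ _ e1_gt0) (pm _ _ e2_gt0)) => -[x y] [/= + _].
by rewrite in_itv/= -ler_distl => ?; left.
Qed.

Lemma corner_limit u v : ray x0 u -> ray y0 v -> exists q : quat R, forall n : 'I_4,
  (fun p : R * R => f (u p.1, v p.2) 0 n) @ filter_prod 0^'+ 0^'+ --> q 0 n.
Proof.
move=> ru rv.
exists (\row_n lim ((fun p : R * R => f (u p.1, v p.2) 0 n) @ filter_prod 0^'+ 0^'+)) => n.
have [l [l0 [_ _ cl0]]] := BV_corner_cvg e1_gt0 e2_gt0 (corner n ru rv).
by rewrite mxE; apply/cvg_ex; exists l0.
Qed.

Lemma fold2_symm (F : R * R -> quat R) n p :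
  symm F x0 y0 p.1 p.2 0 n = fold2 (fun p => F p 0 n) x0 y0 p.
Proof. by rewrite /symm !mxE. Qed.

Hypothesis fL1 : L1 mu2 (f : mR2 -> quat R).
Hypothesis fLC : LC f x0 y0 e1 e2.

(** The factor [(pi / 2) ^+ 2] of the limit over the quadrant cancels the factor
    [(pi ^+ 2)^-1] of the truncated inversion integral up to [1 / 4]. *)
Theorem QFT_inversion_cvg (qmm qpp qmp qpm : quat R) :
  (forall n : 'I_4, (fun p : R * R => f (minus x0 p.1, minus y0 p.2) 0 n)
    @ filter_prod 0^'+ 0^'+ --> qmm 0 n) ->
  (forall n : 'I_4, (fun p : R * R => f (plus x0 p.1, plus y0 p.2) 0 n)
    @ filter_prod 0^'+ 0^'+ --> qpp 0 n) ->
  (forall n : 'I_4, (fun p : R * R => f (minus x0 p.1, plus y0 p.2) 0 n)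
    @ filter_prod 0^'+ 0^'+ --> qmp 0 n) ->
  (forall n : 'I_4, (fun p : R * R => f (plus x0 p.1, minus y0 p.2) 0 n)
    @ filter_prod 0^'+ 0^'+ --> qpm 0 n) ->
  (fun MN : R * R => QFT_inversion f x0 y0 MN.1 MN.2)
    @ filter_prod (pinfty_nbhs R) (pinfty_nbhs R) --> 4^-1 *: (qmm + qpp + qmp + qpm).
Proof.
move=> cmm cpp cmp cpm; apply: cvg_quat => n.
have [F fF Fi] := L1_representative fL1.
pose U := fold2 (fun p => F p 0 n) x0 y0.
pose H s t := fold2 (fun p => f p 0 n) x0 y0 (s, t).
have Hcorner : BV_corner e1 e2 H.
  exact: (BV_corner_add (BV_corner_add (BV_corner_add
    (corner n (ray_minus x0) (ray_minus y0)) (corner n (ray_plus x0) (ray_plus y0)))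
    (corner n (ray_minus x0) (ray_plus y0))) (corner n (ray_plus x0) (ray_minus y0))).
have [l [l0 [Hl ll0 Hl0]]] := BV_corner_cvg e1_gt0 e2_gt0 Hcorner.
have l0E : l0 = qmm 0 n + qpp 0 n + qmp 0 n + qpm 0 n.
  apply: (cvg_unique (@norm_hausdorff _ _) Hl0).
  exact: cvgD (cvgD (cvgD (cmm n) (cpp n)) (cmp n)) (cpm n).
have [psi [V [V0 Hpsi psiV HV]]] := Hcorner.
have symmE : {ae mu2, forall p : mR2, symm f x0 y0 p.1 p.2 = symm F x0 y0 p.1 p.2}.
  have r := @lebesgue_preserving_reflect R; have t := @lebesgue_preserving_translate R.
  have ae (u v : mR -> mR) (pu : lebesgue_preserving u) (pv : lebesgue_preserving v) :=
    ae_preimage (measurable_pair_map pu pv) (lebesgue2_pair_map pu pv) fF.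
  apply: (ae_imply4 _ (ae _ _ (r x0) (r y0)) (ae _ _ (t x0) (t y0))
    (ae _ _ (r x0) (t y0)) (ae _ _ (t x0) (r y0))) => p /= h1 h2 h3 h4.
  by rewrite /symm h1 h2 h3 h4.
have HU : {ae mu2, forall p : mR2, H p.1 p.2 = U p}.
  by apply: (ae_imply _ symmE) => p pE; rewrite /H /U -!fold2_symm/= pE.
have Ui : mu2.-integrable setT (EFin \o U) := integrable_fold2 x0 y0 (Fi n).
have mSB k : measurable_fun [set: mR2] (fun p => symm F x0 y0 p.1 p.2 0 k).
  under eq_fun do rewrite fold2_symm.
  by apply/measurable_EFinP; exact: measurable_int (integrable_fold2 x0 y0 (Fi k)).
have [a [b [La Lb LCa LCb]]] := fLC.
have [Ga GaP] := LC_representative mSB symmE La LCa.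
have mswap : measurable_fun [set: mR2] (fun p : mR2 => (p.2, p.1)).
  by apply/measurable_fun_pairP; split; [exact: measurable_snd|exact: measurable_fst].
have mSB' k : measurable_fun [set: mR2] (fun p => symm F x0 y0 p.2 p.1 0 k).
  exact: (measurableT_comp (mSB k) mswap).
have [Gb GbP] := @LC_representative _ (fun t s => symm f x0 y0 s t)
  (fun p => symm F x0 y0 p.2 p.1) b e2 e1 mSB'
  (ae_preimage mswap (@lebesgue2_swap R) symmE) Lb LCb.
have [Gai qai] := GaP n; have [Gbi qbi'] := GbP n.
have qai' : mu2.-integrable (`]0, e1] `*` `]e2, +oo[)
    (EFin \o (fun p : mR2 => p.1^-1 * (U p - Ga p.2 0 n))).
  by under [X in EFin \o X]funext do rewrite /U -fold2_symm.
have qbi : mu2.-integrable (`]e1, +oo[ `*` `]0, e2])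
    (EFin \o (fun p : mR2 => p.2^-1 * (U p - Gb p.1 0 n))).
  under [X in EFin \o X]funext do rewrite /U -fold2_symm.
  exact: (integrable_swap (measurable_itv _) (measurable_itv _) qbi').
have mQ : measurable (`]0, +oo[ `*` `]0, +oo[ : set mR2).
  by apply: measurableX; exact: measurable_itv.
have UiQ := integrableS measurableT mQ (@subsetT _ _) Ui.
have -> : (4^-1 *: (qmm + qpp + qmp + qpm)) 0 n =
    (pi ^+ 2)^-1 * (l0 * (pi / 2) * (pi / 2)).
  have pi0 : (pi : R) != 0 by rewrite gt_eqF// pi_gt0.
  by rewrite !mxE l0E; move: (pi : R) pi0 => c c0; field.
apply: cvg_trans (cvgM (cvg_cst ((pi ^+ 2)^-1 : R))
  (quadrant_cvg e1_gt0 e2_gt0 V0 Hpsi psiV HV Hl ll0 UiQ HU Gai qai' Gbi qbi)).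
apply: near_eq_cvg.
have M0 := near_oo2_fst (nbhs_pinfty_ge (num_real (0 : R))).
have N0 := near_oo2_snd (nbhs_pinfty_ge (num_real (0 : R))).
apply: filterS2 M0 N0 => -[M N] /= M0 N0.
rewrite (QFT_inversionE x0 y0 fF Fi n M0 N0) /=; congr (_ * _).
rewrite [RHS](Rintegral_fold2 x0 y0); last first.
  apply: (integrable_mul_bounded (M := M * N)) => //.
  - apply: measurable_funM.
      apply: (measurableT_comp (measurable_sinK M)).
      by apply: measurable_funB => //; exact: measurable_fst.
    apply: (measurableT_comp (measurable_sinK N)).
    by apply: measurable_funB => //; exact: measurable_snd.
  - by move=> p _; rewrite normrM ler_pM// normr_sinK_le.
apply: eq_Rintegral => -[s t] _; rewrite /U /fold2 /=.
have mK (c K r : R) : sinK K (c - r - c) = sinK K r by rewrite addrAC subrr add0r sinKN.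
have pK (c K r : R) : sinK K (c + r - c) = sinK K r by rewrite addrAC subrr add0r.
by rewrite !mK !pK; ring.
Qed.

End inversion.

Theorem theorem3p2 (R : realType) (f : R * R -> quat R) (x0 y0 e1 e2 : R)
    (fL1 : L1 leb2 f) (e1_gt0 : 0 < e1) (e2_gt0 : 0 < e2)
    (fBV : QBVF_in (cross_nbhd x0 y0 e1 e2) f) (fLC : LC f x0 y0 e1 e2) :
  [/\ quadrant_limits_exist f x0 y0,
      (fun MN : R * R => QFT_inversion f x0 y0 MN.1 MN.2)
        @ filter_prod (pinfty_nbhs R) (pinfty_nbhs R) --> eta f x0 y0 &
      {for (x0, y0), continuous f} -> eta f x0 y0 = f (x0, y0)].
Proof.
have [qmm cmm] := corner_limit e1_gt0 e2_gt0 fBV (or_intror erefl) (or_intror erefl).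
have [qpp cpp] := corner_limit e1_gt0 e2_gt0 fBV (or_introl erefl) (or_introl erefl).
have [qmp cmp] := corner_limit e1_gt0 e2_gt0 fBV (or_intror erefl) (or_introl erefl).
have [qpm cpm] := corner_limit e1_gt0 e2_gt0 fBV (or_introl erefl) (or_intror erefl).
have plusK (c : R) : cancel (fun x => x - c) (fun x => c + x) by move=> x; ring.
have minusK (c : R) : cancel (fun x => c - x) (fun x => c - x) by move=> x; ring.
have r := @cvg_ray_right R; have l := @cvg_ray_left R.
have fmm : f @ filter_prod x0^'- y0^'- --> qmm
  by exact: (cvg_corner (minusK x0) (minusK y0) (l x0) (l y0) cmm).
have fpp : f @ filter_prod x0^'+ y0^'+ --> qpp
  by exact: (cvg_corner (plusK x0) (plusK y0) (r x0) (r y0) cpp).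
have fmp : f @ filter_prod x0^'- y0^'+ --> qmp
  by exact: (cvg_corner (minusK x0) (plusK y0) (l x0) (r y0) cmp).
have fpm : f @ filter_prod x0^'+ y0^'- --> qpm
  by exact: (cvg_corner (plusK x0) (minusK y0) (r x0) (l y0) cpm).
have limE (F1 F2 : set_system R) (FF1 : ProperFilter F1) (FF2 : ProperFilter F2) q :
    f @ filter_prod F1 F2 --> q -> lim (f @ filter_prod F1 F2) = q.
  by move=> fq; apply: cvg_lim => //; exact: norm_hausdorff.
have etaE : eta f x0 y0 = 4^-1 *: (qmm + qpp + qmp + qpm).
  rewrite /eta.
  have -> : lim_mm f x0 y0 = qmm by exact: limE fmm.
  have -> : lim_pp f x0 y0 = qpp by exact: limE fpp.
  have -> : lim_mp f x0 y0 = qmp by exact: limE fmp.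
  have -> : lim_pm f x0 y0 = qpm by exact: limE fpm.
  by congr (_ *: _); rewrite [LHS]addrC !addrA [LHS]addrAC.
split.
- by split; apply/cvg_ex; [exists qpp|exists qpm|exists qmp|exists qmm].
- by rewrite etaE; apply: QFT_inversion_cvg fBV fL1 fLC _ _ _ _ _ _ _ _.
- move=> fc; have cf (F1 F2 : set_system R) (FF1 : ProperFilter F1) (FF2 : ProperFilter F2) :
      F1 --> x0 -> F2 --> y0 -> lim (f @ filter_prod F1 F2) = f (x0, y0).
    move=> F1x F2y; apply: limE; apply: cvg_trans fc; apply: cvg_app.
    move=> P [[A B] /= [xA yB] AB]; exists (A, B) => //=.
    by split; [exact: F1x|exact: F2y].
  rewrite /eta /lim_pp /lim_pm /lim_mp /lim_mm !cf; try exact: cvg_within.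
  rewrite -[in LHS](scale1r (f (x0, y0))) -!scalerDl scalerA.
  by rewrite (_ : _ * _ = 1) ?scale1r//; field.
Qed.
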